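(* Let $K=[0,\infty)\times\mathbb R$, let $(u_0,v_0)\in L^{1,1}(\mathbb R;\mathbb R^n)$ and $f\in L^1(K;\mathbb R^n)$, and let $u\in\mathscr H(K)$ be the unique $\mathbb R^n$-valued mild solution on $K$ of $$\partial_t^2u-\partial_x^2u=\sum_{j,k=1}^n\Gamma_{jk}(u)(\partial_tu_j\partial_tu_k-\partial_xu_j\partial_xu_k)+P(u)f,\qquad u(0,\cdot)=u_0,\ \partial_tu(0,\cdot)=v_0$$ (such a global solution being assumed to exist). Then there exists $(\bar u_0,\bar v_0)\in L^{1,1}(\mathbb R;\mathbb R^n)$ such that the solution $u_{\mathrm L}$ of the linear homogeneous wave equation $\partial_t^2u_{\mathrm L}-\partial_x^2u_{\mathrm L}=0$ with $u_{\mathrm L}(0,\cdot)=\bar u_0$, $\partial_tu_{\mathrm L}(0,\cdot)=\bar v_0$ satisfies $$\lim_{t\to\infty}\big(\|u(t)-u_{\mathrm L}(t)\|_{L^\infty(\mathbb R)}+\|\partial_xu(t)-\partial_xu_{\mathrm L}(t)\|_{L^1(\mathbb R)}+\|\partial_tu(t)-\partial_tu_{\mathrm L}(t)\|_{L^1(\mathbb R)}\big)=0.$$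
   Context: Standing assumption: $\Gamma_{jk}:\mathbb R^n\to\mathbb R^n$ ($1\le j,k\le n$) and $P:\mathbb R^n\to\mathcal L(\mathbb R^n)$ are bounded and globally Lipschitz. $\dot W^{1,1}(\mathbb R;\mathbb R^n)$ is the set of locally absolutely continuous $v:\mathbb R\to\mathbb R^n$ with $Dv=v'\in L^1(\mathbb R)$; $L^{1,1}(\mathbb R;\mathbb R^n)=(L^\infty(\mathbb R;\mathbb R^n)\cap\dot W^{1,1}(\mathbb R;\mathbb R^n))\times L^1(\mathbb R;\mathbb R^n)$. $\mathscr H([0,\infty)\times\mathbb R)$ is the space of $u:[0,\infty)\times\mathbb R\to\mathbb R^n$ with $u\in C_b([0,\infty);L^\infty(\mathbb R)\cap\dot W^{1,1}(\mathbb R))$ and $\partial_tu\in C_b([0,\infty);L^1(\mathbb R))$ ($C_b$: bounded continuous). $u_{\mathrm L}(t,x)=\tfrac12(\bar u_0(x+t)+\bar u_0(x-t))+\tfrac12\int_{x-t}^{x+t}\bar v_0(y)\,dy$. An $\mathbb R^n$-valued mild solution on $K$ with data $(u_0,v_0)$ and forcing $f$ is a continuous $u:K\to\mathbb R^n$ whose weak derivatives $\partial_tu,\partial_xu$ exist as locally integrable functions and such that for every $(t,x)\in K$ (the double integral being of an integrable function) $$u(t,x)=\tfrac12\big(u_0(x+t)+u_0(x-t)\big)+\tfrac12\int_{x-t}^{x+t}v_0(y)\,dy+\tfrac12\int_0^t\int_{x-t+\tau}^{x+t-\tau}\Big[\sum_{j,k}\Gamma_{jk}(u)(\partial_tu_j\partial_tu_k-\partial_xu_j\partial_xu_k)+P(u)f\Big](\tau,y)\,dy\,d\tau.$$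 *)

(* Defs.v *)
From HB Require Import structures.
From mathcomp Require Import all_boot all_order all_algebra.
From mathcomp Require Import all_classical all_reals all_analysis.

Set Implicit Arguments.
Unset Strict Implicit.
Unset Printing Implicit Defensive.

Import Order.TTheory GRing.Theory Num.Theory.
Import numFieldNormedType.Exports.

Local Open Scope classical_set_scope.
Local Open Scope ring_scope.

(* R^n is 'cV[R]_n, and L(R^n) is 'M[R]_n acting by [*m].  Both carry the
   maximum norm of the library; every use below is insensitive to replacing it
   by an equivalent norm. *)

Section Defs.
Variable R : realType.

Definition leb : {measure set (measurableTypeR R) -> \bar R} :=
  @lebesgue_measure R.

Definition leb2 :
    {measure set (measurableTypeR R * measurableTypeR R) -> \bar R} :=
  (@lebesgue_measure R \x @lebesgue_measure R)%E.

Definition halfplane : set (R * R) := [set p | 0 <= p.1].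

Definition vintegrable d (T : measurableType d) (mu : {measure set T -> \bar R})
    n (D : set T) (g : T -> 'cV[R]_n) : Prop :=
  forall i, mu.-integrable D (fun x => (g x i ord0)%:E).

Definition vint d (T : measurableType d) (mu : {measure set T -> \bar R})
    n (D : set T) (g : T -> 'cV[R]_n) : 'cV[R]_n :=
  \col_i Rintegral mu D (fun x => g x i ord0).

Definition Linf_norm n (v : R -> 'cV[R]_n) : \bar R :=
  Lnorm leb +oo%E (fun x => `|v x|%:E).

Definition L1_norm n (v : R -> 'cV[R]_n) : \bar R :=
  Lnorm leb 1%E (fun x => `|v x|%:E).

Definition abs_continuous n (a b : R) (v : R -> 'cV[R]_n) : Prop :=
  forall e : R, 0 < e -> exists2 d : R, 0 < d &
    forall (N : nat) (s s' : 'I_N -> R),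
      (forall i, [/\ a <= s i, s i <= s' i & s' i <= b]) ->
      trivIset setT (fun i => `]s i, s' i[%classic) ->
      \sum_i (s' i - s i) < d ->
      \sum_i `|v (s' i) - v (s i)| < e.

Definition loc_abs_continuous n (v : R -> 'cV[R]_n) : Prop :=
  forall a b : R, abs_continuous a b v.

(* The derivative of a locally absolutely continuous function exists almost
   everywhere, and derive1 v is a fixed constant at the remaining points. *)
Definition homW11 n (v : R -> 'cV[R]_n) : Prop :=
  loc_abs_continuous v /\ vintegrable leb setT (derive1 v).

Definition Linf_homW11 n (v : R -> 'cV[R]_n) : Prop :=
  (Linf_norm v < +oo)%E /\ homW11 v.

Definition Linf_homW11_norm n (v : R -> 'cV[R]_n) : \bar R :=
  (Linf_norm v + L1_norm (derive1 v))%E.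

Definition L11 n (v0 v1 : R -> 'cV[R]_n) : Prop :=
  Linf_homW11 v0 /\ vintegrable leb setT v1.

Definition Cb n (X : set (R -> 'cV[R]_n)) (N : (R -> 'cV[R]_n) -> \bar R)
    (g : R -> R -> 'cV[R]_n) : Prop :=
  [/\ forall t, 0 <= t -> X (g t),
      exists C : R, forall t, 0 <= t -> (N (g t) <= C%:E)%E &
      forall t0, 0 <= t0 ->
        N (fun x => g t x - g t0 x) @[t --> within [set t | 0 <= t] (nbhs t0)]
          --> 0%E].

Definition smooth (phi : R * R -> R) : Prop :=
  forall l : seq (R * R),
    let g := foldr (fun v h => 'D_v h) phi l in
    continuous g /\ forall p v, derivable g p v.

Definition test_function (phi : R * R -> R) : Prop :=
  let supp := closure [set p | phi p != 0] in
  [/\ smooth phi, compact supp & supp `<=` [set p | 0 < p.1]].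

Definition loc_integrable n (u : R * R -> 'cV[R]_n) : Prop :=
  forall C : set (R * R), compact C -> C `<=` halfplane ->
    vintegrable leb2 C u.

Definition weak_derivative n (e : R * R) (u w : R * R -> 'cV[R]_n) : Prop :=
  [/\ loc_integrable u, loc_integrable w &
      forall phi, test_function phi ->
        vint leb2 halfplane (fun p => 'D_e phi p *: u p) =
        - vint leb2 halfplane (fun p => phi p *: w p)].

Definition weak_dt n := @weak_derivative n (1, 0).
Definition weak_dx n := @weak_derivative n (0, 1).

(* w is the C_b([0,oo); L^1) version of the weak derivative of u in time.  It
   determines w t for every t >= 0 as an element of L^1. *)
Definition Cb_dt n (u w : R * R -> 'cV[R]_n) : Prop :=
  weak_dt u w /\ Cb (vintegrable leb setT) (@L1_norm n) (curry w).

(* u belongs to the space H, with time derivative ut. *)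
Definition in_H n (u ut : R * R -> 'cV[R]_n) : Prop :=
  Cb (@Linf_homW11 n) (@Linf_homW11_norm n) (curry u) /\ Cb_dt u ut.

Definition dAlembert n (v0 v1 : R -> 'cV[R]_n) (p : R * R) : 'cV[R]_n :=
  let: (t, x) := p in
  2^-1 *: (v0 (x + t) + v0 (x - t)) +
  2^-1 *: vint leb `[x - t, x + t]%classic v1.

Definition nonlinearity n (Gamma : 'I_n -> 'I_n -> 'cV[R]_n -> 'cV[R]_n)
    (P : 'cV[R]_n -> 'M[R]_n) (f u ut ux : R * R -> 'cV[R]_n) (p : R * R) :
    'cV[R]_n :=
  \sum_j \sum_k (ut p j ord0 * ut p k ord0 - ux p j ord0 * ux p k ord0)
                  *: Gamma j k (u p)
  + P (u p) *m f p.

Definition backward_triangle (t x : R) : set (R * R) :=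
  [set p | 0 <= p.1 <= t /\ x - t + p.1 <= p.2 <= x + t - p.1].

(* ut and ux are the weak derivatives of u in time and space. *)
Definition mild_solution n (Gamma : 'I_n -> 'I_n -> 'cV[R]_n -> 'cV[R]_n)
    (P : 'cV[R]_n -> 'M[R]_n) (u0 v0 : R -> 'cV[R]_n)
    (f u ut ux : R * R -> 'cV[R]_n) : Prop :=
  [/\ {within halfplane, continuous u},
      weak_dt u ut,
      weak_dx u ux &
      forall t x, 0 <= t ->
        let F := nonlinearity Gamma P f u ut ux in
        vintegrable leb2 (backward_triangle t x) F /\
        u (t, x) = dAlembert u0 v0 (t, x) +
          2^-1 *: vint leb `[0, t]%classic (fun tau =>
            vint leb `[x - t + tau, x + t - tau]%classic (fun y => F (tau, y)))].

End Defs.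

(* Main.v *)
From HB Require Import structures.
Require Import Defs.
From mathcomp Require Import all_boot all_order all_algebra.
From mathcomp Require Import all_classical all_reals all_analysis.
From mathcomp Require Import measurable_realfun ess_sup_inf ring lra.

Set Implicit Arguments.
Unset Strict Implicit.
Unset Printing Implicit Defensive.

Import Order.TTheory GRing.Theory Num.Theory.
Import numFieldNormedType.Exports.

Local Open Scope classical_set_scope.
Local Open Scope ring_scope.

(** Why the solution scatters.  In the characteristic coordinates xi = x + t and
    sigma = t - x, backward cones are quadrants, and the mild formula reads

      u = half sum and integral of the data + 1/4 int_(xi' <= xi, sigma' <= sigma) Phi,

    where Phi is the nonlinearity.  If Phi is integrable on the plane, then the
    quadrant is the half plane xi' <= xi plus the half plane sigma' <= sigma minus
    the plane, up to the opposite quadrant ([cone_complement]).  The half planes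
    give functions of x + t and of x - t alone, that is, a free wave, and the
    error is the integral of Phi over the future quadrant.  The error and its two
    derivatives are bounded by the integral of |Phi| over xi' + sigma' > 2t, the
    source after time t, which tends to zero.  This is [remainder_component],
    [remainder_Linf], [remainder_dx] and [remainder_dt].

    The heart of the matter is that Phi is integrable ([source_integrable]), for
    large data as well.  Put P = (d_t + d_x) u and Q = (d_t - d_x) u.  The null
    structure gives |Phi| <= C |P| |Q| + C |f| ([nonlinearity_bound]), and each of P and
    Q is transported along its own characteristics, P = p0 (xi) + 1/2 int Phi over
    sigma' <= sigma, and likewise for Q.  Membership of u in the solution space
    bounds the L1 norms of P and Q on time slices by some M.  Far to the right,
    xi > A, the data p0 and the forcing have small mass eps, while by averaging
    there are lines xi = A' with A' as large as desired across which the flux of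
    |Q| is at most 3M ([exists_small_flux]).  Writing P from the initial line and Q
    backwards from xi = A', the mass J (sigma) of |Phi| over A < xi < A' below height
    sigma satisfies J' <= C (b + J') (eps + J) + small, with int b <= 3M.  As long as
    C (eps + J) <= 1/2 the term J' is absorbed, and a Gronwall argument gives
    eps + J <= const (M) eps; for eps small the threshold is never reached
    ([goursat_bound]).  So Phi is integrable over xi > A, over sigma > B by symmetry,
    and over the remaining quadrant because mild solutions have integrable sources
    on triangles ([goursat_integrable]).

    For a mild solution the transport formulas for P and Q have to be derived from
    its weak derivatives.  Testing these with products of smooth cutoffs in xi and
    sigma and letting the cutoffs tend to indicators yields the increments of u0
    along a characteristic ([characteristic_increment]).  This shows that u0 is the
    integral of its derivative ([u0_primitive]) and identifies P and Q almost
    everywhere ([incoming_density], [outgoing_density]).  The space derivative on a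
    fixed time slice is found for every t >= 0 from the mild formula ([derive1_u]), and
    agreement of the two gives the bounds on slices ([strip_energy]).

    That the free wave has a time derivative that is continuous with values in L1 comes
    from the continuity of translations in L1 ([travelling_wave_Cb_dt]).  The time derivative of u
    is only determined on almost every slice; its continuity in time extends the
    final bound to all of them. *)

(** * Lebesgue measure under affine maps *)
Section affine.
Context {R : realType}.
Notation mu := (@lebesgue_measure R).
Local Open Scope ereal_scope.

Lemma measurable_affine (a b : R) :
  measurable_fun setT ((fun x => a * x + b)%R : measurableTypeR R -> measurableTypeR R).
Proof. by apply: measurable_funD => //; apply: measurable_funM. Qed.

(** The affine image of the measure agrees with the measure on half-open
    intervals; the two signs of the slope exchange which end is open. *)
Lemma lebesgue_affine (a b : R) (A : set (measurableTypeR R)) : (a != 0)%R -> measurable A ->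
  `|a|%:E * mu ((fun x => a * x + b)%R @^-1` A) = mu A.
Proof.
move=> a0 mA.
have [a1|a1] : (0 < a)%R \/ (a < 0)%R by case: ltrgt0P a0; [left|right|].
  have na : (0 <= a)%R by exact: ltW.
  pose f : measurableTypeR R -> measurableTypeR R := (fun x => a * x + b)%R.
  pose mf := isMeasurableFun.Build _ _ _ _ f (measurable_affine a b).
  pose ff : {mfun measurableTypeR R >-> measurableTypeR R} := HB.pack f mf.
  rewrite [RHS](@lebesgue_measure_unique R (mscale (NngNum na) (pushforward mu ff))) //=.
    by rewrite /mscale /= /pushforward ger0_norm.
  move=> X [[x y]] _ <-; rewrite /mscale /= /pushforward /=.
  have -> : f @^-1` `]x, y] = `]((x - b) / a)%R, ((y - b) / a)%R]%classic.
    apply/seteqP; split => z /=; rewrite !in_itv /= /f ltr_pdivrMr// ler_pdivlMr//;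
     by rewrite ltrBlDr lerBrDr (mulrC z).
  rewrite !lebesgue_measure_itv /= !lte_fin ltr_pM2r ?invr_gt0//.
  rewrite ltrD2r; case: ifP => _; last by rewrite mule0.
  by rewrite -!EFinB -EFinM; congr EFin; field.
have na : (0 <= - a)%R by rewrite oppr_ge0 ltW.
pose f : measurableTypeR R -> measurableTypeR R := (fun x => a * x + b)%R.
pose mf := isMeasurableFun.Build _ _ _ _ f (measurable_affine a b).
pose ff : {mfun measurableTypeR R >-> measurableTypeR R} := HB.pack f mf.
rewrite [RHS](@lebesgue_measure_unique R (mscale (NngNum na) (pushforward mu ff))) //=.
  by rewrite /mscale /= /pushforward ltr0_norm.
move=> X [[x y]] _ <-; rewrite /mscale /= /pushforward /=.
have -> : f @^-1` `]x, y] = `[((y - b) / a)%R, ((x - b) / a)%R[%classic.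
  apply/seteqP; split => z /=; rewrite !in_itv /= /f ler_ndivrMr// ltr_ndivlMr//;
   by rewrite ltrBlDr lerBrDr (mulrC z) andbC.
rewrite !lebesgue_measure_itv /= !lte_fin ltr_nM2r ?invr_lt0//.
rewrite ltrD2r; case: ifP => _; last by rewrite mule0.
by rewrite -!EFinB -EFinM; congr EFin; field.
Qed.

Lemma ge0_integral_affine (a b : R) (f : R -> \bar R) : (a != 0)%R ->
  measurable_fun setT f -> (forall x, 0 <= f x) ->
  \int[mu]_x f x = `|a|%:E * \int[mu]_x f (a * x + b)%R.
Proof.
move=> a0 mf f0.
pose nu : {measure set (measurableTypeR R) -> \bar R} :=
  measure_function_pushforward__canonical__measure_function_Measure mu
    (measurable_affine a b).
have na : (0 <= `|a|)%R by [].
transitivity (\int[mscale (NngNum na) nu]_x f x).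
  apply: eq_measure_integral => A mA _; rewrite -[LHS](@lebesgue_affine a b)//.
rewrite ge0_integral_mscale//=; congr (_ * _).
rewrite (ge0_integral_pushforward (measurable_affine a b)) //.
Qed.
End affine.

(** * Integration on the plane and characteristic coordinates *)
Section ae_tools.
Context d (T : measurableType d) {R : realType} (m : {measure set T -> \bar R}).
Local Open Scope ereal_scope.

Lemma ae_eq_integrable (D : set T) (f g : T -> \bar R) : measurable D ->
  measurable_fun D g -> ae_eq m D f g -> m.-integrable D f -> m.-integrable D g.
Proof.
move=> mD mg fg /integrableP[mf fi]; apply/integrableP; split => //.
have ma h : measurable_fun D h -> measurable_fun D (abse \o h) by exact: measurableT_comp.
rewrite (_ : \int[m]_(x in D) `|g x| = \int[m]_(x in D) (abse \o f) x)//.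
apply: (ge0_ae_eq_integral mD (f := abse \o g) (g := abse \o f)).
- exact: ma.
- exact: ma.
- by move=> x _; exact: abse_ge0.
- by move=> x _; exact: abse_ge0.
- exact/ae_eq_abse/ae_eq_sym.
Qed.

Lemma ae_eq_Rintegral (D : set T) (f g : T -> R) : measurable D ->
  measurable_fun D f -> measurable_fun D g ->
  {ae m, forall x, D x -> f x = g x} ->
  (\int[m]_(x in D) f x = \int[m]_(x in D) g x)%R.
Proof.
move=> mD mf mg fg; congr fine; apply: ae_eq_integral => //; do ?exact/measurable_EFinP.
by apply: filterS fg => x h /h ->.
Qed.

Lemma Rintegral_EFin (D : set T) (f : T -> R) : measurable D ->
  m.-integrable D (EFin \o f) ->
  (\int[m]_(x in D) f x)%:E = \int[m]_(x in D) (f x)%:E.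
Proof. by move=> mD fi; rewrite /Rintegral fineK//; exact: integrable_fin_num. Qed.
End ae_tools.

Section plane.
Context {R : realType}.
Notation mu := (@lebesgue_measure R).
Notation mu2 := (mu \x mu)%E.
Local Open Scope ereal_scope.

Lemma tonelli12 (h : R * R -> \bar R) : measurable_fun setT h ->
  (forall z, 0 <= h z) -> \int[mu2]_z h z = \int[mu]_x \int[mu]_y h (x, y).
Proof. by move=> mh h0; exact: (@fubini_tonelli1 _ _ (measurableTypeR R) (measurableTypeR R) R mu mu h mh h0). Qed.

Lemma tonelli21 (h : R * R -> \bar R) : measurable_fun setT h ->
  (forall z, 0 <= h z) -> \int[mu2]_z h z = \int[mu]_y \int[mu]_x h (x, y).
Proof. by move=> mh h0; exact: (@fubini_tonelli2 _ _ (measurableTypeR R) (measurableTypeR R) R mu mu h mh h0). Qed.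

Lemma measurable_tonelli1 (h : R * R -> \bar R) : measurable_fun setT h ->
  (forall z, 0 <= h z) -> measurable_fun setT (fun x => \int[mu]_y h (x, y)).
Proof. by move=> mh h0; exact: (@measurable_fun_fubini_tonelli_F _ _ (measurableTypeR R) (measurableTypeR R) R mu h mh h0). Qed.

Lemma measurable_tonelli2 (h : R * R -> \bar R) : measurable_fun setT h ->
  (forall z, 0 <= h z) -> measurable_fun setT (fun y => \int[mu]_x h (x, y)).
Proof. by move=> mh h0; exact: (@measurable_fun_fubini_tonelli_G _ _ (measurableTypeR R) (measurableTypeR R) R mu h mh h0). Qed.

Lemma Rfubini12 (f : R * R -> R) : mu2.-integrable setT (EFin \o f) ->
  (\int[mu2]_z f z = \int[mu]_x \int[mu]_y f (x, y))%R.
Proof.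
move=> fi; rewrite /Rintegral -(integral12_prod_meas1 fi); congr fine.
have mF := measurable_fubini_F fi.
apply: ae_eq_integral => //.
  by apply/measurable_EFinP; apply: measurableT_comp mF.
apply: filterS (ae_integrable1 fi) => x /integrable_fin_num; rewrite /fubini_F => h _.
by rewrite fineK//; exact: h.
Qed.

Lemma Rfubini21 (f : R * R -> R) : mu2.-integrable setT (EFin \o f) ->
  (\int[mu2]_z f z = \int[mu]_y \int[mu]_x f (x, y))%R.
Proof.
move=> fi; rewrite /Rintegral -(integral21_prod_meas1 fi); congr fine.
have mF := measurable_fubini_G fi.
apply: ae_eq_integral => //.
  by apply/measurable_EFinP; apply: measurableT_comp mF.
apply: filterS (ae_integrable2 fi) => x /integrable_fin_num; rewrite /fubini_G => h _.
by rewrite fineK//; exact: h.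
Qed.

Lemma integrable_Rfubini1 (f : R * R -> R) : mu2.-integrable setT (EFin \o f) ->
  mu.-integrable setT (EFin \o (fun x => \int[mu]_y f (x, y))%R).
Proof.
move=> fi; apply: (ae_eq_integrable _ _ _ (integrable_fubini_F fi)) => //.
  apply/measurable_EFinP; apply: measurableT_comp (measurable_fubini_F fi) => //.
apply: filterS (ae_integrable1 fi) => x /integrable_fin_num h _.
by rewrite /= /Rintegral fineK//; exact: h.
Qed.

Lemma patch_setX (f : R * R -> R) (A B : set R) x y :
  (f \_ (A `*` B)) (x, y) = ((fun x' => (fun y' => f (x', y')) \_ B) \_ A) x y.
Proof.
rewrite !patchE; case: (boolP (x \in A)) => [/set_mem xA|xA] /=; rewrite ?patchE.
  case: ifPn => [/set_mem[_ /= yB]|h]; first by rewrite mem_set.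
  case: ifPn => // /set_mem yB; exfalso; move/negP: h; apply; exact/mem_set.
by rewrite memNset// => -[/= /mem_set xA' _]; move/negP: xA; exact.
Qed.

Lemma RfubiniX (f : R * R -> R) (A B : set R) : measurable A -> measurable B ->
  mu2.-integrable (A `*` B) (EFin \o f) ->
  (\int[mu2]_(z in A `*` B) f z = \int[mu]_(x in A) \int[mu]_(y in B) f (x, y))%R.
Proof.
move=> mA mB fi; rewrite Rintegral_mkcond Rfubini12; last first.
  by rewrite -restrict_EFin; apply/integrable_restrict; rewrite ?setTI//; exact: measurableX.
rewrite [in RHS]Rintegral_mkcond; apply: eq_Rintegral => x _ /=.
under eq_Rintegral do rewrite patch_setX.
rewrite !patchE; case: ifPn => xA; first by rewrite [in RHS]Rintegral_mkcond.
by rewrite /Rintegral integral0.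
Qed.

Lemma RfubiniXC (f : R * R -> R) (A B : set R) : measurable A -> measurable B ->
  mu2.-integrable (A `*` B) (EFin \o f) ->
  (\int[mu2]_(z in A `*` B) f z = \int[mu]_(y in B) \int[mu]_(x in A) f (x, y))%R.
Proof.
move=> mA mB fi; rewrite Rintegral_mkcond Rfubini21; last first.
  by rewrite -restrict_EFin; apply/integrable_restrict; rewrite ?setTI//; exact: measurableX.
rewrite [in RHS]Rintegral_mkcond; apply: eq_Rintegral => y _ /=.
under eq_Rintegral do rewrite patch_setX.
rewrite !patchE; case: ifPn => yB; last first.
  rewrite (_ : (fun x => _) = cst 0%R) ?/Rintegral ?integral0//.
  by apply/funext => x; rewrite patchE; case: ifP => // _; rewrite patchE (negbTE yB).
rewrite [in RHS]Rintegral_mkcond; apply: eq_Rintegral => x _.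
by rewrite !patchE; case: ifP => // _; rewrite patchE yB.
Qed.

Lemma ae_section1 (P : set (R * R)) : {ae mu2, forall z, P z} ->
  {ae mu, forall x, {ae mu, forall y, P (x, y)}}.
Proof.
move=> [N [mN N0 PN]].
have N0' : \int[mu]_x (mu \o xsection N) x = 0 by [].
have mx : measurable_fun setT (mu \o xsection N) by exact: measurable_fun_xsection.
have : ae_eq mu setT (mu \o xsection N) (cst 0).
  apply/(ae_eq_integral_abs mu measurableT mx).
  by under eq_integral => x _ do rewrite gee0_abs//.
apply: filterS => x /= /(_ I) h; exists (xsection N x); split => //.
  exact: measurable_xsection.
by move=> y nP; rewrite /xsection /= inE; apply: PN.
Qed.

(** Unlike the other section lemma, the null set has to be sliced along its second
    coordinate, while the product measure is defined by slicing the first one;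
    Tonelli for the indicator function exchanges the two. *)
Lemma ae_section2 (P : set (R * R)) : {ae mu2, forall z, P z} ->
  {ae mu, forall y, {ae mu, forall x, P (x, y)}}.
Proof.
move=> [N [mN N0 PN]].
have N0' : \int[mu]_y (mu \o ysection N) y = 0.
  have mf : measurable_fun setT (fun z : R * R => (\1_N z : R)%:E).
    exact/measurable_EFinP/measurable_indic.
  have m0 z : 0 <= (\1_N z : R)%:E by rewrite lee_fin.
  have := tonelli21 mf m0.
  rewrite (integral_indic mu2 measurableT mN) setIT [X in X = _ -> _]N0 => ->.
  apply: eq_integral => y _ /=.
  have -> : (fun x => (\1_N (x, y) : R)%:E) = (fun x => (\1_(ysection N y) x)%:E).
    by apply/funext => x; rewrite /indic mem_ysection.
  by rewrite integral_indic ?setIT//; exact: measurable_ysection.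
have mx : measurable_fun setT (mu \o ysection N) by exact: measurable_fun_ysection.
have : ae_eq mu setT (mu \o ysection N) (cst 0).
  apply/(ae_eq_integral_abs mu measurableT mx).
  by under eq_integral => x _ do rewrite gee0_abs//.
apply: filterS => y /= /(_ I) h; exists (ysection N y); split => //.
  exact: measurable_ysection.
by move=> x nP; rewrite /ysection /= inE; apply: PN.
Qed.

(** Characteristic coordinates: if z = (xi, sigma) with xi = x + t and
    sigma = t - x, then [ch z] is (t, x), and [hc] is the inverse map.  The half
    plane t >= 0 becomes xi + sigma >= 0, and a backward cone becomes a quadrant.
    A time slice is run through with opposite orientations by xi and sigma, so the
    reflection of x exchanges the two coordinates. *)
Definition ch (z : R * R) : R * R := ((z.1 + z.2) / 2, (z.1 - z.2) / 2)%R.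
Definition hc (p : R * R) : R * R := (p.2 + p.1, p.1 - p.2)%R.

Lemma chK : cancel ch hc.
Proof. by case=> a b; rewrite /ch /hc /=; congr pair; field. Qed.

Lemma hcK : cancel hc ch.
Proof. by case=> a b; rewrite /ch /hc /=; congr pair; field. Qed.

Lemma measurable_ch : measurable_fun setT ch.
Proof.
by apply: measurable_fun_pair; apply: measurable_funM => //;
  [apply: measurable_funD|apply: measurable_funB].
Qed.

Lemma measurable_hc : measurable_fun setT hc.
Proof.
by apply: measurable_fun_pair; [apply: measurable_funD|apply: measurable_funB].
Qed.

(** Two one-dimensional affine changes of variables, first in sigma and then in
    xi, give the Jacobian without any change of variables formula in the plane. *)
Lemma ge0_integral_ch (f : R * R -> \bar R) : measurable_fun setT f ->
  (forall z, 0 <= f z) -> \int[mu2]_z f (ch z) = 2%:E * \int[mu2]_z f z.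
Proof.
move=> mf f0.
have mfch : measurable_fun setT (f \o ch) by exact: measurableT_comp measurable_ch.
have E1 := tonelli12 mfch (fun z => f0 (ch z)); have E2 := tonelli12 mf f0.
rewrite E2 [LHS]E1.
pose k (z : R * R) := f (z.2, z.1 - z.2)%R.
have mk : measurable_fun setT k.
  by apply: measurableT_comp => //; apply: measurable_fun_pair => //; apply: measurable_funB.
transitivity (\int[mu]_x (2%:E * \int[mu]_t k (x, t))).
  apply: eq_integral => x _ /=.
  rewrite (@ge0_integral_affine R 2 (- x)) ?pnatr_eq0//; last first.
    apply: (measurableT_comp mfch) => //; exact: measurable_pair1.
  rewrite ger0_norm//; congr (_ * _); apply: eq_integral => t _ /=.
  by rewrite /k /ch /=; congr (f (_, _)); field.
have mK := measurable_tonelli1 mk (fun z => f0 _).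
have K0 x : setT x -> 0 <= \int[mu]_t k (x, t) by move=> _; apply: integral_ge0 => y _; exact: f0.
transitivity (2%:E * \int[mu]_x \int[mu]_t k (x, t)).
  apply: ge0_integralZl; [exact: measurableT|exact: mK|exact: K0|by rewrite lee_fin].
congr (_ * _).
have K := etrans (esym (tonelli12 mk (fun z => f0 _))) (tonelli21 mk (fun z => f0 _)).
apply: (etrans K); apply: eq_integral => t _.
have mft : measurable_fun setT (fun x => f (t, x)).
  apply: measurableT_comp => //; exact: measurable_pair1.
rewrite (@ge0_integral_affine R 1 (- t)%R _ (oner_neq0 _) mft (fun x => f0 _)).
by rewrite normr1 mul1e; apply: eq_integral => x _; rewrite /k /= mul1r.
Qed.

Lemma measure_ch (A : set (R * R)) : measurable A ->
  mu2 (ch @^-1` A) = 2%:E * mu2 A.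
Proof.
move=> mA.
have mB : measurable (ch @^-1` A).
  by rewrite -[X in measurable X]setTI; apply: measurable_ch.
have E B : measurable B -> mu2 B = \int[mu2]_z (\1_B z)%:E.
  by move=> h; rewrite (integral_indic mu2 measurableT h) setIT.
rewrite (E _ mA) -ge0_integral_ch.
- exact: E.
- exact/measurable_EFinP/measurable_indic.
- by move=> z; rewrite lee_fin.
Qed.

Lemma ae1S (P Q : R -> Prop) : (forall x, P x -> Q x) ->
  {ae mu, forall x, P x} -> {ae mu, forall x, Q x}.
Proof. by move=> PQ; exact: (filterS (F := almost_everywhere mu)). Qed.

Lemma ae1S2 (P P' Q : R -> Prop) : (forall x, P x -> P' x -> Q x) ->
  {ae mu, forall x, P x} -> {ae mu, forall x, P' x} -> {ae mu, forall x, Q x}.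
Proof. by move=> PQ; exact: (filterS2 (F := almost_everywhere mu)). Qed.

Lemma ae2S (P Q : R * R -> Prop) : (forall x, P x -> Q x) ->
  {ae mu2, forall x, P x} -> {ae mu2, forall x, Q x}.
Proof. by move=> PQ; exact: (filterS (F := almost_everywhere mu2)). Qed.

Lemma ae2S2 (P P' Q : R * R -> Prop) : (forall x, P x -> P' x -> Q x) ->
  {ae mu2, forall x, P x} -> {ae mu2, forall x, P' x} -> {ae mu2, forall x, Q x}.
Proof. by move=> PQ; exact: (filterS2 (F := almost_everywhere mu2)). Qed.

Lemma ae1_and (P Q : R -> Prop) : {ae mu, forall x, P x} -> {ae mu, forall x, Q x} ->
  {ae mu, forall x, P x /\ Q x}.
Proof. exact: ae1S2. Qed.

Lemma ae1_fin n (P : 'I_n -> R -> Prop) : (forall i, {ae mu, forall x, P i x}) ->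
  {ae mu, forall x, forall i, P i x}.
Proof. by move=> h; exact: (filter_forall (F := almost_everywhere mu)). Qed.

Lemma ae2_fin n (P : 'I_n -> R * R -> Prop) : (forall i, {ae mu2, forall x, P i x}) ->
  {ae mu2, forall x, forall i, P i x}.
Proof. by move=> h; exact: (filter_forall (F := almost_everywhere mu2)). Qed.

Lemma ae1_ex (P : R -> Prop) (a b : R) : (a < b)%R -> {ae mu, forall x, P x} ->
  exists2 x, (a < x < b)%R & P x.
Proof.
move=> ab [N [mN N0 PN]]; apply: contrapT => nex.
have : mu `]a, b[ <= mu N.
  apply: le_measure; rewrite ?inE// => x /=; rewrite in_itv /= => xab.
  by apply: PN => /= Px; apply: nex; exists x.
by rewrite N0 lebesgue_measure_itv /= lte_fin ab -EFinB lee_fin subr_le0 leNgt ab.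
Qed.

Lemma ae2_ch (P : R * R -> Prop) : {ae mu2, forall p, P p} ->
  {ae mu2, forall z, P (ch z)}.
Proof.
move=> [N [mN N0 PN]]; exists (ch @^-1` N); split.
- by rewrite -[X in measurable X]setTI; apply: measurable_ch.
- by apply: etrans (measure_ch mN) _; rewrite N0 mule0.
- by move=> z nP; apply: PN.
Qed.

Lemma ae2_hc (P : R * R -> Prop) : {ae mu2, forall z, P z} ->
  {ae mu2, forall p, P (hc p)}.
Proof.
move=> [N [mN N0 PN]]; exists (hc @^-1` N).
have mM : measurable (hc @^-1` N).
  by rewrite -[X in measurable X]setTI; apply: measurable_hc.
split=> //; last by move=> z nP; apply: PN.
have := measure_ch mM; rewrite -comp_preimage (_ : hc \o ch = id); last first.
  by apply/funext => z /=; rewrite chK.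
rewrite preimage_id [mu2 N]N0 => /esym/eqP.
by rewrite mule_eq0 eqe pnatr_eq0 /= => /eqP.
Qed.

Lemma integrable_chP (f : R * R -> R) : measurable_fun setT f ->
  mu2.-integrable setT (EFin \o f \o ch) <-> mu2.-integrable setT (EFin \o f).
Proof.
move=> mf.
have E : \int[mu2]_z `|(EFin \o f \o ch) z| = 2%:E * \int[mu2]_z `|(EFin \o f) z|.
  rewrite -(@ge0_integral_ch (fun z => `|(f z)%:E|))//.
  by apply: measurableT_comp => //; exact/measurable_EFinP.
split=> /integrableP[m1 i1]; apply/integrableP; split.
- exact/measurable_EFinP.
- have := integral_ge0 mu2 (D := setT) (fun z _ => abse_ge0 ((EFin \o f) z)).
  rewrite E in i1; move: i1; set I := integral _ _ _; case: I => [r||] //.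
    by move=> _ _; rewrite ltry.
  by rewrite mulry gtr0_sg// mul1e.
- by apply/measurable_EFinP; exact: measurableT_comp measurable_ch.
- by rewrite E; apply: lte_mul_pinfty.
Qed.

Lemma Rintegral_ch (f : R * R -> R) : mu2.-integrable setT (EFin \o f) ->
  (\int[mu2]_z f (ch z) = 2 * \int[mu2]_z f z)%R.
Proof.
move=> /integrableP[/measurable_EFinP mf fi].
have Ep : \int[mu2]_z ((EFin \o f \o ch)^\+ z) = 2%:E * \int[mu2]_z ((EFin \o f)^\+ z).
  apply: (etrans _ (ge0_integral_ch _ (@funepos_ge0 _ _ (EFin \o f)))).
    by apply: eq_integral => z _; rewrite funepos_comp.
  exact/measurable_funepos/measurable_EFinP.
have En : \int[mu2]_z ((EFin \o f \o ch)^\- z) = 2%:E * \int[mu2]_z ((EFin \o f)^\- z).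
  apply: (etrans _ (ge0_integral_ch _ (@funeneg_ge0 _ _ (EFin \o f)))).
    by apply: eq_integral => z _; rewrite funeneg_comp.
  exact/measurable_funeneg/measurable_EFinP.
rewrite /Rintegral integralE [in RHS]integralE Ep En.
have fi' : mu2.-integrable setT (EFin \o f) by apply/integrableP; split => //; exact/measurable_EFinP.
have := integrable_pos_fin_num measurableT fi'.
have := integrable_neg_fin_num measurableT fi'.
case: (integral _ _ _) => //= a _; case: (integral _ _ _) => //= b _.
by rewrite mulrBr.
Qed.

End plane.

(** * Primitives of locally integrable functions *)
Section primitives.
Context {R : realType}.
Notation mu := (@lebesgue_measure R).
Notation mu2 := (mu \x mu)%E.
Implicit Types (f g F G : R -> R).

Definition seg_integrable g := forall a b, mu.-integrable `[a, b] (EFin \o g).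

(** Pairs made of a function and a density of it.  Carrying the density along,
    instead of differentiating, keeps all identities valid at every point; the
    derivative is recovered almost everywhere where it is needed. *)
Definition is_primitive G g := seg_integrable g /\
  forall a b, a <= b -> G b - G a = \int[mu]_(s in `[a, b]) g s.

Lemma integrable_seg g : mu.-integrable setT (EFin \o g) -> seg_integrable g.
Proof. by move=> gi a b; exact: integrableS gi. Qed.

Lemma seg_integrable_measurable g : seg_integrable g -> measurable_fun setT g.
Proof.
move=> gi.
have -> : [set: R] = \bigcup_(n : nat) `[- n%:R, n%:R]%classic.
  apply/seteqP; split => // x _; exists (Num.bound `|x|) => //=.
  by rewrite in_itv /= -ler_norml ltW// archi_boundP.
apply/measurable_fun_bigcup => // n.
by have /integrableP[/measurable_EFinP] := gi (- n%:R) n%:R.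
Qed.

Lemma seg_integrable_locally g : seg_integrable g -> locally_integrable setT g.
Proof.
move=> gi; split; [exact: seg_integrable_measurable|exact: openT|].
move=> K _ cK; have /compact_bounded[M [Mr hM]] := cK.
have KM : K `<=` `[- (M + 1), M + 1]%classic.
  by move=> x Kx /=; rewrite in_itv /= -ler_norml; apply: hM => //; rewrite ltrDl.
have /integrableP[mf] := gi (- (M + 1)) (M + 1).
apply: le_lt_trans; apply: ge0_subset_integral => //; first exact: compact_measurable.
by apply/measurable_EFinP; apply: measurableT_comp => //; exact/measurable_EFinP.
Qed.

Lemma near_shift_derive F G (c x l : R) : {near x, (fun y => F y + c) =1 G} ->
  derivable F x 1 -> derive1 F x = l -> derivable G x 1 /\ derive1 G x = l.
Proof.
move=> FG dF F'.
have dF1 : derivable (fun y => F y + c) x 1 by exact: derivableD dF (derivable_cst _ _ _).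
split; first exact: near_eq_derivable FG dF1.
rewrite derive1E -(near_eq_derive _ FG).
by rewrite [LHS](deriveD dF (derivable_cst _ _ _)) derive_cst addr0 -derive1E.
Qed.

(** Lebesgue differentiation, from a base point that moves to minus infinity
    along the integers. *)
Lemma is_primitive_derive G g : is_primitive G g ->
  {ae mu, forall x, derivable G x 1 /\ derive1 G x = g x}.
Proof.
move=> [gi Gg].
have H (n : nat) : {ae mu, forall x, - n%:R < x -> derivable G x 1 /\ derive1 G x = g x}.
  have := @FTC1 R g (BLeft (- n%:R)) (fun y => gi _ y) (seg_integrable_locally gi).
  move=> /=; apply: ae1S => x h xn.
  have xn' : ((- n%:R)%:E < x%:E)%E by rewrite lte_fin.
  have [dF F'] := h xn'.
  set F := (fun x => \int[mu]_(t in _) g t) in dF F'.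
  have FG : {near x, (fun y => F y + G (- n%:R)) =1 G}.
    near=> y; have yn : - n%:R <= y by near: y; apply: filterS (lt_nbhsr xn) => z; exact: ltW.
    by rewrite /F -Gg// subrK.
  exact: near_shift_derive FG dF F'.
have := ae_foralln H; apply: ae1S => x h; apply: (h (Num.bound `|x|)).
by rewrite ltrNl (le_lt_trans (ler_norm _))// normrN archi_boundP.
Unshelve. all: by end_near.
Qed.

Lemma is_primitiveD G H g h : is_primitive G g -> is_primitive H h ->
  is_primitive (fun x => G x + H x) (fun x => g x + h x).
Proof.
move=> [gi Gg] [hi Hh]; split => [a b|a b ab].
  by apply: eq_integrable (integrableD _ (gi a b) (hi a b)).
by rewrite opprD addrACA Gg// Hh// RintegralD.
Qed.

Lemma is_primitiveZ (k : R) G g : is_primitive G g ->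
  is_primitive (fun x => k * G x) (fun x => k * g x).
Proof.
move=> [gi Gg]; split => [a b|a b ab].
  by apply: eq_integrable (integrableZl _ k (gi a b)).
by rewrite -mulrBr Gg// RintegralZl.
Qed.

Lemma is_primitive_shift (c : R) G g : is_primitive G g ->
  is_primitive (fun x => G x + c) g.
Proof. by move=> [gi Gg]; split => // a b ab; rewrite -Gg//; ring. Qed.

Lemma Rintegral_affine (a b : R) g : a != 0 -> mu.-integrable setT (EFin \o g) ->
  mu.-integrable setT (EFin \o (fun x => g (a * x + b))) /\
  \int[mu]_x g x = `|a| * \int[mu]_x g (a * x + b).
Proof.
move=> a0 gi; have /integrableP[/measurable_EFinP mg gi'] := gi.
have mga : measurable_fun setT (fun x => g (a * x + b)).
  by apply: (measurableT_comp mg); exact: measurable_affine.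
have na : `|a| != 0 by rewrite normr_eq0.
have E (h : R -> \bar R) : measurable_fun setT h -> (forall x, 0 <= h x)%E ->
    (\int[mu]_x h (a * x + b)%R = `|a|^-1%:E * \int[mu]_x h x)%E.
  move=> mh h0; rewrite (@ge0_integral_affine R a b h a0 mh h0) muleA -EFinM.
  by rewrite mulVf// mul1e.
have gia : mu.-integrable setT (EFin \o (fun x => g (a * x + b))).
  apply/integrableP; split; first exact/measurable_EFinP.
  rewrite (E (fun x => `|(g x)%:E|)%E)//; last first.
    by apply: measurableT_comp => //; exact/measurable_EFinP.
  by apply: lte_mul_pinfty => //; rewrite lee_fin.
split => //.
have Ep := E _ (measurable_funepos (proj2 (measurable_EFinP _ _) mg)) (@funepos_ge0 _ _ _).
have En := E _ (measurable_funeneg (proj2 (measurable_EFinP _ _) mg)) (@funeneg_ge0 _ _ _).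
rewrite /Rintegral integralE [in RHS]integralE.
rewrite (_ : (\int[mu]_x (fun x => (g (a * x + b))%:E)^\+ x = `|a|^-1%:E * \int[mu]_x (EFin \o g)^\+ x)%E); last first.
  by rewrite -Ep; apply: eq_integral => x _; exact: (congr1 (fun h => h x) (funepos_comp (EFin \o g) (fun x => a * x + b))).
rewrite (_ : (\int[mu]_x (fun x => (g (a * x + b))%:E)^\- x = `|a|^-1%:E * \int[mu]_x (EFin \o g)^\- x)%E); last first.
  by rewrite -En; apply: eq_integral => x _; exact: (congr1 (fun h => h x) (funeneg_comp (EFin \o g) (fun x => a * x + b))).
have := integrable_pos_fin_num measurableT gi.
have := integrable_neg_fin_num measurableT gi.
rewrite -/(EFin \o g).
case: (\int[mu]_x (EFin \o g)^\- x)%E => //= u _; case: (\int[mu]_x (EFin \o g)^\+ x)%E => //= v _.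
by rewrite -mulrBr mulrA mulfV// mul1r.
Qed.

Lemma is_primitive_affine (a b : R) G g : a != 0 -> is_primitive G g ->
  is_primitive (fun x => G (a * x + b)) (fun x => a * g (a * x + b)).
Proof.
move=> a0 [gi Gg].
pose lo x y := Num.min (a * x + b) (a * y + b).
pose hi x y := Num.max (a * x + b) (a * y + b).
have E x y : x <= y -> (fun s => (g \_ `[lo x y, hi x y]) (a * s + b)) = (fun s => g (a * s + b)) \_ `[x, y].
  move=> xy; apply/funext => s; rewrite !patchE !mem_setE !in_itv /= /lo /hi.
  have [a1|a1] : 0 < a \/ a < 0 by case: ltrgt0P a0; [left|right|].
    have le2 u v : (a * u + b <= a * v + b) = (u <= v) by rewrite lerD2r ler_pM2l.
    by rewrite min_l ?max_r ?le2.
  have le2 u v : (a * u + b <= a * v + b) = (v <= u) by rewrite lerD2r ler_nM2l.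
  by rewrite min_r ?max_l ?le2// andbC.
have hint x y : mu.-integrable setT (EFin \o (g \_ `[lo x y, hi x y])).
  by rewrite -restrict_EFin; apply/(integrable_mkcond _ _).1 => //; exact: gi.
split => [x y|x y xy].
  have [xy|xy] := leP x y; last by rewrite set_itv_ge ?bnd_simp -?ltNge//; exact: integrable_set0.
  have [i1 _] := Rintegral_affine b a0 (hint x y).
  rewrite (_ : (fun x => _) = (fun s => g (a * s + b)) \_ `[x, y]) in i1; last exact: E.
  rewrite -restrict_EFin in i1; move/(integrable_mkcond _ _).2 : i1 => /(_ (measurable_itv _)) i1.
  by apply: eq_integrable (integrableZl _ a i1).
have [i1 e1] := Rintegral_affine b a0 (hint x y).
rewrite (E _ _ xy) in e1 i1; rewrite -restrict_EFin in i1.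
move/(integrable_mkcond _ _).2 : i1 => /(_ (measurable_itv _)) i1.
rewrite -!Rintegral_mkcond in e1; rewrite RintegralZl// -[in RHS](mulKf (_ : `|a| != 0) (Rintegral _ _ _)) ?normr_eq0// -e1.
rewrite /lo /hi; have [a1|a1] : 0 < a \/ a < 0 by case: ltrgt0P a0; [left|right|].
  have le2 u v : (a * u + b <= a * v + b) = (u <= v) by rewrite lerD2r ler_pM2l.
  by rewrite min_l ?max_r ?le2// -Gg ?le2// gtr0_norm// mulVKf.
have le2 u v : (a * u + b <= a * v + b) = (v <= u) by rewrite lerD2r ler_nM2l.
rewrite min_r ?max_l ?le2// -Gg ?le2// ltr0_norm// invrN mulNr mulrN mulVKf//.
by rewrite opprB.
Qed.

(** Absolute continuity of the integral: disjoint intervals of small total length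
    form a set of small measure. *)
Lemma is_primitive_abs_cont G g a b (e : R) : is_primitive G g -> 0 < e ->
  exists2 d : R, 0 < d &
    forall (N : nat) (s s' : 'I_N -> R),
      (forall i, [/\ a <= s i, s i <= s' i & s' i <= b]) ->
      trivIset setT (fun i => `]s i, s' i[%classic) ->
      \sum_i (s' i - s i) < d ->
      \sum_i `|G (s' i) - G (s i)| < e.
Proof.
move=> [gi Gg] e0; pose f := g \_ `[a, b].
have fi : mu.-integrable setT (EFin \o f).
  by rewrite -restrict_EFin; apply/(integrable_mkcond _ _).1 => //; exact: gi.
have [d [d0 hd]] := integral_normr_continuous fi e0.
exists d => // N s s' ss tI sd.
pose F i := `]s i, s' i[%classic.
have mF i : measurable (F i : set (measurableTypeR R)) by exact: measurable_itv.
pose A := \big[setU/set0]_(i < N) F i.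
have mA : measurable (A : set (measurableTypeR R)) by apply: bigsetU_measurable => i _; exact: mF.
have muA : (mu A < d%:E)%E.
  rewrite measure_bigsetU_ord// (eq_bigr (fun i => (s' i - s i)%:E)) ?sumEFin ?lte_fin//.
  move=> i _; have [_ h _] := ss i; apply: (etrans (lebesgue_measure_itv _)); rewrite /= lte_fin.
  case: ltP => [_|h']; first by rewrite EFinB.
  have -> : s' i = s i by apply/le_anti; rewrite h h'.
  by rewrite subrr.
apply: le_lt_trans (hd A mA muA).
have fi' : mu.-integrable setT (EFin \o (fun x => `|f x|)) by exact: integrable_norm.
rewrite -lee_fin Rintegral_EFin//; last exact: integrableS fi'.
rewrite ge0_integral_bigsetU//; last first.
- by apply/measurable_EFinP; have /integrableP[/measurable_EFinP] := integrableS measurableT mA (@subsetT _ _) fi'.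
- by apply: sub_trivIset tI.
- exact: index_enum_uniq.
rewrite -sumEFin; apply: lee_sum => i _; have [h1 h2 h3] := ss i.
rewrite -[leRHS]Rintegral_EFin//; last exact: integrableS fi'.
rewrite lee_fin Gg// -Rintegral_itv_bndo_bndc; last first.
  by apply: integrableS (gi (s i) (s' i)) => //; apply: subset_itvl; rewrite bnd_simp.
rewrite -Rintegral_itv_obnd_cbnd; last first.
  by apply: integrableS (gi (s i) (s' i)) => //; apply: subset_itvScc; rewrite bnd_simp.
have fg x : x \in F i -> g x = f x.
  rewrite inE /F /= in_itv /= => /andP[x1 x2]; rewrite /f patchE mem_set//= in_itv /=.
  by rewrite (le_trans h1 (ltW x1)) (le_trans (ltW x2) h3).
have -> : \int[mu]_(x in F i) g x = \int[mu]_(x in F i) f x by exact: eq_Rintegral.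
apply: le_normr_Rintegral => //.
exact: integrableS fi.
Qed.

Lemma is_primitive_continuous G g : is_primitive G g -> continuous G.
Proof.
move=> Gg x; apply/cvgrPdist_lt => e e0.
have [d d0 hd] := is_primitive_abs_cont (x - 1) (x + 1) Gg e0.
near=> y.
have yx : `|x - y| < Num.min d 1.
  by near: y; apply: cvgr_dist_lt => //; rewrite lt_min d0 ltr01.
move: yx; rewrite lt_min => /andP[yd y1].
have := hd 1%N (fun=> Num.min x y) (fun=> Num.max x y).
rewrite !big_ord1; have -> : Num.max x y - Num.min x y = `|x - y|.
  by case: (leP x y) => h; [rewrite ler0_norm ?subr_le0// opprB|rewrite gtr0_norm ?subr_gt0].
have -> : `|G (Num.max x y) - G (Num.min x y)| = `|G x - G y|.
  by case: (leP x y) => h //; rewrite distrC.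
apply => //.
  move: y1; rewrite ltr_distlC => /andP[y1 y2] i.
  by rewrite le_min ge_max ge_min le_max !lexx /= !lerDl !gerDl !(ltW y1) !(ltW y2); split => //; lra.
by move=> i j _ _; rewrite !ord1.
Unshelve. all: by end_near.
Qed.

(** Differentiability of a continuous function at x is the Cauchy criterion for
    its difference quotients.  The points where all quotients of increment below
    1 / (m + 1) agree up to 1 / (n + 1) form a closed set, since the quotients are
    continuous in x; countable operations on n and m remain. *)
Lemma measurable_derivable (w : R -> R) : continuous w ->
  measurable [set x | derivable w x 1].
Proof.
move=> cw.
pose Q (h x : R) := h^-1 * (w (h + x) - w x).
have cQ h : continuous (Q h).
  move=> x; apply: cvgM; first exact: cvg_cst.
  apply: cvgB; last exact: cw.
  by apply: continuous_comp (cw _); apply: cvgD; [exact: cvg_cst|exact: cvg_id].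
pose A n m := \bigcap_(p in [set p : R * R | [/\ 0 < `|p.1|, `|p.1| < m.+1%:R^-1,
    0 < `|p.2| & `|p.2| < m.+1%:R^-1]]) [set x | `|Q p.1 x - Q p.2 x| <= n.+1%:R^-1].
have mA n m : measurable (A n m).
  apply: closed_measurable; apply: closed_bigI => p _.
  have : closed ((fun x => `|Q p.1 x - Q p.2 x|) @^-1` [set y | y <= n.+1%:R^-1]).
    apply: closed_comp => [x _|]; last exact: closed_le.
    by apply: cvg_norm; apply: cvgB; exact: cQ.
  by [].
rewrite (_ : [set x | _] = \bigcap_n \bigcup_m A n m); last first.
  apply/seteqP; split => x /=.
    move=> /cvg_ex[l /cvgrPdist_le hl] n _.
    have n0 : (0 : R) < n.+1%:R^-1 / 2 by rewrite divr_gt0 ?invr_gt0.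
    have /= [d /= d0 hd] := hl _ n0.
    exists (Num.bound d^-1) => //.
    have db : (Num.bound d^-1).+1%:R^-1 < d.
      rewrite -[ltRHS]invrK ltf_pV2 ?posrE ?invr_gt0//.
      by rewrite (lt_trans (archi_boundP _)) ?invr_ge0 ?ltW// ltr_nat.
    move=> [h k] /= [h0 hb k0 kb].
    have E u : 0 < `|u| -> `|u| < (Num.bound d^-1).+1%:R^-1 -> `|l - Q u x| <= n.+1%:R^-1 / 2.
      move=> u0 ub; have := hd u; rewrite /ball_ /= sub0r normrN (lt_trans ub db) => /(_ isT).
      by rewrite -normr_gt0 u0 => /(_ isT); rewrite /= [u%:A]mulr1.
    rewrite (_ : Q h x - Q k x = (l - Q k x) - (l - Q h x)); last by ring.
    by rewrite (splitr n.+1%:R^-1) (le_trans (ler_normB _ _))// lerD// E.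
  move=> hA; apply/cauchy_cvgP/cauchyP => e e0.
  pose n := Num.bound e^-1.
  have ne : n.+1%:R^-1 < e.
    rewrite -[ltRHS]invrK ltf_pV2 ?posrE ?invr_gt0//.
    by rewrite (lt_trans (archi_boundP _)) ?invr_ge0 ?ltW// ltr_nat.
  have [m _ hm] := hA n I.
  pose h0 : R := m.+1%:R^-1 / 2.
  have m0 : (0 : R) < m.+1%:R^-1 by rewrite invr_gt0.
  have h00 : 0 < h0 by rewrite divr_gt0.
  have h0m : h0 < m.+1%:R^-1 by rewrite /h0 ltr_pdivrMr// ltr_pMr// ltr1n.
  exists (Q h0 x).
  suff : \forall h \near (0 : R)^', `|Q h0 x - Q h x| < e.
    apply: filterS => h he; rewrite /= -ball_normE /= /Q.
    by have -> : h%:A = h by exact: mulr1.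
  near=> h.
  apply: le_lt_trans ne; apply: (hm (h0, h)); split => //=; rewrite ?(gtr0_norm h00)//.
    by rewrite normr_gt0; near: h; exact: nbhs_dnbhs_neq.
  by near: h; exact: dnbhs0_lt.
apply: bigcapT_measurable => n; exact: bigcupT_measurable.
Unshelve. all: by end_near.
Qed.

(** [derive1 v] is the limit of measurable difference quotients where v is
    derivable and the default value of [lim] elsewhere, so the Borel
    measurability of the set of differentiability is what has to be known. *)
Lemma measurable_derive1 n (v : R -> 'cV[R]_n) i j :
  (forall i, continuous (fun x => v x i ord0)) ->
  measurable_fun setT (fun x => derive1 v x i j).
Proof.
move=> cv; rewrite (ord1 j).
pose D := \bigcap_(i in [set: 'I_n]) [set x | derivable (fun x => v x i ord0) x 1].
have mD : measurable (D : set (measurableTypeR R)).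
  by apply: fin_bigcap_measurable => // k _; exact: measurable_derivable.
have DE x : D x <-> derivable v x 1.
  rewrite derivable_mxP; split => [h k l|h k _ /=]; first by rewrite ord1; exact: h.
  exact: h.
rewrite -(setUv D); apply/measurable_funU => //; first exact: measurableC.
split.
  apply: (@measurable_fun_cvg _ _ R D (fun k x => k.+1%:R * (v (k.+1%:R^-1 + x) i ord0 - v x i ord0))).
    move=> k; apply: measurable_funTS; apply: measurable_funM => //.
    apply: measurable_funB; last exact: continuous_measurable_fun.
    apply: (measurableT_comp (f := fun x => v x i ord0)) => //; first exact: continuous_measurable_fun.
    exact: measurable_funD.
  move=> x Dx; have dv := (DE x).1 Dx.
  rewrite derive1E derive_mx// mxE.
  have /derivable_mxP/(_ i ord0) /cvg_ex[l hl] := dv.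
  rewrite [X in _ --> X](_ : _ = l); last exact/cvg_lim.
  apply/cvgrPdist_le => e e0; have /cvgrPdist_le/(_ e e0)[d /= d0 hd] := hl.
  near=> k; have k0 : (0 : R) < k.+1%:R^-1 by rewrite invr_gt0.
  have kd : k.+1%:R^-1 < d by near: k; exact: near_infty_natSinv_lt (PosNum d0).
  have := hd k.+1%:R^-1; rewrite /ball_ /= sub0r normrN gtr0_norm// => /(_ kd).
  by rewrite gt_eqF// invrK /= [k.+1%:R^-1%:A]mulr1 => /(_ isT).
(* off D, the limit of the quotients diverges and is the chosen point *)
apply: (eq_measurable_fun (cst ((point : 'cV[R]_n) i ord0))); last exact: measurable_cst.
move=> x; rewrite inE => nDx; congr (fun_of_matrix _ i ord0); symmetry.
rewrite derive1E; apply: dvgP => h; apply: nDx; exact/DE.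
Unshelve. all: by end_near.
Qed.

(** A vector function is differentiated componentwise at almost every point,
    whatever densities its components were given with. *)
Lemma derive1_components n (v : R -> 'cV[R]_n) (g : 'I_n -> R -> R) :
  (forall i, is_primitive (fun x => v x i ord0) (g i)) ->
  {ae mu, forall x, forall i, derive1 v x i ord0 = g i x}.
Proof.
move=> vg; have := ae1_fin (fun i => is_primitive_derive (vg i)).
apply: ae1S => x h i; rewrite derive1E derive_mx ?mxE.
  by rewrite -derive1E; exact: (h i).2.
by apply/derivable_mxP => k l; rewrite ord1; exact: (h k).1.
Qed.

Lemma ler_norm_cV n (x : 'cV[R]_n) : `|x| <= \sum_i `|x i ord0|.
Proof.
rewrite [leLHS]mx_normrE; apply: bigmax_le => [|[i j] _]; first exact: sumr_ge0.
by rewrite (ord1 j) (bigD1 i)//= lerDl sumr_ge0.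
Qed.

Lemma ler_coord_norm n (x : 'cV[R]_n) i : `|x i ord0| <= `|x|.
Proof.
rewrite [leRHS]mx_normrE; exact: (le_bigmax _ (fun ij => `|x ij.1 ij.2|) (i, ord0)).
Qed.

Lemma loc_abs_continuous_primitive n (v : R -> 'cV[R]_n) (g : 'I_n -> R -> R) :
  (forall i, is_primitive (fun x => v x i ord0) (g i)) -> loc_abs_continuous v.
Proof.
move=> vg a b e e0.
have e1 : 0 < e / n.+1%:R by rewrite divr_gt0.
have /choice[d hd] i : exists d : R, 0 < d /\
    forall (N : nat) (s s' : 'I_N -> R),
      (forall i, [/\ a <= s i, s i <= s' i & s' i <= b]) ->
      trivIset setT (fun i => `]s i, s' i[%classic) ->
      \sum_i (s' i - s i) < d ->
      \sum_k `|v (s' k) i ord0 - v (s k) i ord0| < e / n.+1%:R.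
  by have [d d0 h] := is_primitive_abs_cont a b (vg i) e1; exists d.
exists (\big[Num.min/1]_i d i).
  by apply: (big_ind (fun x => 0 < x)) => // [x y x0 y0|i _]; [rewrite lt_min x0|exact: (hd i).1].
move=> N s s' ss tI sd.
apply: (@le_lt_trans _ _ (\sum_k \sum_i `|v (s' k) i ord0 - v (s k) i ord0|)).
  by apply: ler_sum => k _; apply: le_trans (ler_norm_cV _) _; apply: ler_sum => i _; rewrite !mxE.
rewrite exchange_big /=.
apply: (@le_lt_trans _ _ (\sum_(i < n) e / n.+1%:R)).
  apply: ler_sum => i _; apply/ltW; apply: (hd i).2 => //.
  by apply: lt_le_trans sd _; exact: bigmin_le_cond.
rewrite sumr_const card_ord -(mulr_natr (e / _)) mulrAC ltr_pdivrMr//.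
by rewrite ltr_pM2l// ltr_nat.
Qed.

End primitives.

(** * Integration by parts, translations and tails on the line *)
Section line_tools.
Context {R : realType}.
Notation mu := (@lebesgue_measure R).
Notation mu2 := (mu \x mu)%E.
Implicit Types (f g F G : R -> R).

Lemma restrict_integrable d (T : measurableType d) (m : {measure set T -> \bar R})
    (A : set T) (f : T -> R) : measurable A ->
  m.-integrable setT (EFin \o (f \_ A)) <-> m.-integrable A (EFin \o f).
Proof.
by move=> mA; rewrite -restrict_EFin; split => h; apply/(integrable_mkcond _ mA).
Qed.

Lemma mu_ge0_integralZl (f : R -> \bar R) (k : \bar R) : measurable_fun setT f ->
  (forall x, 0 <= f x)%E -> (0 <= k)%E -> (\int[mu]_x (k * f x) = k * \int[mu]_x f x)%E.
Proof. by move=> mf f0 k0; apply: ge0_integralZl => //; exact: mf. Qed.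

Lemma mu_ge0_integralZr (f : R -> \bar R) (k : \bar R) : measurable_fun setT f ->
  (forall x, 0 <= f x)%E -> (0 <= k)%E -> (\int[mu]_x (f x * k) = \int[mu]_x f x * k)%E.
Proof. by move=> mf f0 k0; apply: ge0_integralZr => //; exact: mf. Qed.

Lemma integrable_prod f g : mu.-integrable setT (EFin \o f) ->
  mu.-integrable setT (EFin \o g) ->
  mu2.-integrable setT (EFin \o (fun z : R * R => f z.1 * g z.2)).
Proof.
move=> /integrableP[/measurable_EFinP mf fi] /integrableP[/measurable_EFinP mg gi].
have mfg : measurable_fun setT (fun z : R * R => f z.1 * g z.2).
  by apply: measurable_funM; apply: measurableT_comp.
apply/integrableP; split; first exact/measurable_EFinP.
have m1 : measurable_fun setT (fun z : R * R => `|(f z.1 * g z.2)%:E|)%E.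
  by apply: measurableT_comp => //; exact/measurable_EFinP.
have maf : measurable_fun setT (fun x => `|(f x)%:E|)%E.
  by apply: measurableT_comp => //; exact/measurable_EFinP.
have mag : measurable_fun setT (fun x => `|(g x)%:E|)%E.
  by apply: measurableT_comp => //; exact/measurable_EFinP.
have := tonelli12 m1 (fun z => abse_ge0 _).
move=> ->; rewrite (_ : (\int[mu]_x _)%E =
    (\int[mu]_x (`|(f x)%:E| * \int[mu]_y `|(g y)%:E|))%E); last first.
  apply: eq_integral => x _.
  rewrite -(mu_ge0_integralZl mag)//.
  by apply: eq_integral => y _; rewrite -abseM.
rewrite (mu_ge0_integralZr maf)//; last exact: integral_ge0.
by apply: lte_mul_pinfty => //; [exact: integral_ge0|rewrite ge0_fin_numE//; exact: integral_ge0].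
Qed.

(** Both sides are the integral over the triangle a <= s <= t <= b of
    phi' (t) g (s), computed in the two orders. *)
Lemma primitive_by_parts G g (phi dphi : R -> R) (a b : R) : a <= b ->
  is_primitive G g -> continuous dphi ->
  (forall x : R, is_derive x (1 : R) phi (dphi x)) -> phi a = 0 -> phi b = 0 ->
  \int[mu]_(s in `[a, b]) (dphi s * G s) = - \int[mu]_(s in `[a, b]) (phi s * g s).
Proof.
move=> ab [gi Gg] cd dphiE pa pb.
have cphi : continuous phi.
  by move=> x; apply: differentiable_continuous; apply/derivable1_diffP; have [] := dphiE x.
have FTC x y : x <= y -> \int[mu]_(s in `[x, y]) dphi s = phi y - phi x.
  rewrite le_eqVlt => /orP[/eqP->|xy].
    by rewrite set_itv1 Rintegral_set1 subrr.
  rewrite /Rintegral (@continuous_FTC2 _ dphi phi x y xy).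
  - by [].
  - by apply: continuous_subspaceT.
  - split => [z _||]; first by have [] := dphiE z.
    + by apply: cvg_at_right_filter; exact: cphi.
    + by apply: cvg_at_left_filter; exact: cphi.
  - by move=> z _; rewrite derive1E; have [] := dphiE z.
pose A := `[a, b]%classic : set (measurableTypeR R).
have mA : measurable A by exact: measurable_itv.
have di : seg_integrable dphi.
  by move=> x y; apply: continuous_compact_integrable; [exact: segment_compact|exact: continuous_subspaceT].
(* the kernel phi' (t) g (s) on the triangle, with (t, s) = z *)
pose K (z : R * R) := (dphi \_ A) z.1 * (g \_ A) z.2 * ((z.2 <= z.1)%R : nat)%:R.
have mle : measurable_fun setT (fun z : R * R => ((z.2 <= z.1)%R : nat)%:R : R).
  have mb : measurable_fun setT (fun z : R * R => z.2 <= z.1) by exact: measurable_fun_ler.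
  rewrite (_ : (fun z => _) = (fun z : R * R => if z.2 <= z.1 then 1 else 0)); last first.
    by apply/funext => z; case: (z.2 <= z.1).
  exact: measurable_fun_ifT.
have Ki : mu2.-integrable setT (EFin \o K).
  have i1 : mu.-integrable setT (EFin \o (dphi \_ A)) by apply/(restrict_integrable mu _ mA); exact: di.
  have i2 : mu.-integrable setT (EFin \o (g \_ A)) by apply/(restrict_integrable mu _ mA); exact: gi.
  have := integrable_prod i1 i2.
  move=> ip; have /integrableP[/measurable_EFinP mp _] := ip.
  apply: le_integrable ip => //; first by apply/measurable_EFinP; exact: measurable_funM.
  move=> z _; rewrite lee_fin /K normrM ler_piMr//.
  by case: (z.2 <= z.1)%R; rewrite ?normr1 ?normr0 ?ler01.
have E1 : \int[mu2]_z K z = \int[mu]_(t in A) (dphi t * (G t - G a)).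
  rewrite Rfubini12// [RHS]Rintegral_mkcond; apply: eq_Rintegral => t _.
  rewrite [RHS]patchE; case: ifPn => [|tA]; last first.
    rewrite /Rintegral (_ : (fun y => _) = cst 0%E) ?integral0//.
    by apply/funext => s; rewrite /K /= patchE (negbTE tA) !mul0r.
  rewrite inE /A /= in_itv /= => /andP[at_ tb].
  rewrite Gg// -RintegralZl// [RHS]Rintegral_mkcond; apply: eq_Rintegral => s _.
  rewrite /K /= !patchE (_ : t \in A); last by apply/mem_set; rewrite /A /= in_itv /= at_ tb.
  rewrite !mem_setE !in_itv /=; case: (leP a s) => as_ /=; last by rewrite !mulr0 mul0r.
  case: (leP s t) => st; last by rewrite mulr0.
  by rewrite (le_trans st tb) mulr1.
have E2 : \int[mu2]_z K z = \int[mu]_(s in A) (g s * (phi b - phi s)).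
  rewrite Rfubini21// [RHS]Rintegral_mkcond; apply: eq_Rintegral => s _.
  rewrite [RHS]patchE; case: ifPn => [|sA]; last first.
    rewrite /Rintegral (_ : (fun y => _) = cst 0%E) ?integral0//.
    by apply/funext => t; rewrite /K /= (patchE _ _ s) (negbTE sA) mulr0 mul0r.
  rewrite inE /A /= in_itv /= => /andP[as_ sb].
  rewrite -FTC// -RintegralZl// [RHS]Rintegral_mkcond; apply: eq_Rintegral => t _.
  rewrite /K /= !patchE (_ : s \in A); last by apply/mem_set; rewrite /A /= in_itv /= as_ sb.
  rewrite !mem_setE !in_itv /=; case: (leP t b) => tb /=; rewrite ?andbF ?mul0r//.
  rewrite !andbT; case: (leP s t) => st; last by rewrite mulr0.
  by rewrite (le_trans as_ st) mulr1 mulrC.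
have cG : continuous G by exact: is_primitive_continuous (conj gi Gg).
have iK (h k : R -> R) : continuous h -> seg_integrable k -> mu.-integrable A (EFin \o (fun s => h s * k s)).
  move=> ch ki; have [M hM] : exists M, forall s, A s -> `|h s| <= M.
    have /compact_bounded[M [Mr hM]] : compact (h @` A).
      by apply: continuous_compact; [exact: continuous_subspaceT|exact: segment_compact].
    by exists (M + 1) => s As; apply: hM; [rewrite ltrDl|exists s].
  have := integrableZl mA M (integrable_norm (ki a b)).
  apply: le_integrable => //.
    apply/measurable_EFinP; apply: measurable_funM; apply: measurable_funTS.
      exact: continuous_measurable_fun.
    exact: seg_integrable_measurable.
  move=> s As /=; rewrite lee_fin normrM [leRHS]ger0_norm ?ler_wpM2r ?hM//.
  by rewrite mulr_ge0// (le_trans _ (hM _ As)).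
have iG := iK _ _ cG di.
have E3 : \int[mu]_(t in A) (dphi t * G t) = \int[mu]_(t in A) (dphi t * (G t - G a)).
  rewrite [RHS](_ : _ = \int[mu]_(t in A) (dphi t * G t - dphi t * G a)); last first.
    by apply: eq_Rintegral => t _; rewrite mulrBr.
  rewrite RintegralB//.
  - have Z : \int[mu]_(x in A) dphi x = 0 by rewrite /A FTC// pa pb subrr.
    have -> : \int[mu]_(x in A) (dphi x * G a) = 0.
      by rewrite RintegralZr// ?Z ?mul0r//; exact: di.
    by rewrite subr0.
  - by apply: eq_integrable iG => // t _; rewrite /= mulrC.
  - exact: integrableZr (di a b).
rewrite -/A E3 -E1 E2 -mulN1r -RintegralZl//; last exact: iK.
by apply: eq_Rintegral => s _; rewrite pb sub0r mulrN mulN1r mulrC.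
Qed.

Lemma integral_itv_eq0_ae f : seg_integrable f ->
  (forall a b, a <= b -> \int[mu]_(s in `[a, b]) f s = 0) ->
  {ae mu, forall x, f x = 0}.
Proof.
move=> fi f0; have : is_primitive (cst 0) f.
  by split => // a b ab; rewrite subrr f0.
move=> /is_primitive_derive; apply: ae1S => x [_ <-].
by rewrite derive1E derive_cst.
Qed.

Lemma integrableB_norm f g : mu.-integrable setT (EFin \o f) -> mu.-integrable setT (EFin \o g) ->
  mu.-integrable setT (EFin \o (fun x => `|f x - g x|)).
Proof. by move=> fi gi; apply: integrable_norm; apply: eq_integrable (integrableB _ fi gi). Qed.

Lemma integrable_translate f (c : R) : mu.-integrable setT (EFin \o f) ->
  mu.-integrable setT (EFin \o (fun x => f (x + c))).
Proof.
move=> fi; have [h _] := Rintegral_affine c (oner_neq0 _) fi.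
by apply: eq_integrable h => // x _; rewrite /= mul1r.
Qed.

Lemma Rintegral_translate f (c : R) : mu.-integrable setT (EFin \o f) ->
  \int[mu]_x f (x + c) = \int[mu]_x f x.
Proof.
move=> fi; have [_ ->] := Rintegral_affine c (oner_neq0 _) fi.
by rewrite normr1 mul1r; apply: eq_Rintegral => x _; rewrite mul1r.
Qed.

Lemma Rintegral_reflect f : mu.-integrable setT (EFin \o f) ->
  mu.-integrable setT (EFin \o (fun x => f (- x))) /\
  \int[mu]_x f (- x) = \int[mu]_x f x.
Proof.
move=> fi; have n1 : (-1 : R) != 0 by rewrite oppr_eq0 oner_eq0.
have [h ->] := Rintegral_affine 0 n1 fi.
have E : (fun x => f (- x)) = (fun x => f (-1 * x + 0)) by apply/funext => x; rewrite mulN1r addr0.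
by rewrite normrN normr1 mul1r E.
Qed.

(** Dominated convergence: the indicator functions tend to zero pointwise. *)
Lemma integral_vanishing_sets d (T : measurableType d) (m : {measure set T -> \bar R})
    (f : T -> R) (A : nat -> set T) (e : R) :
  m.-integrable setT (EFin \o f) -> (forall n, measurable (A n)) ->
  (forall x, \forall n \near \oo, ~ A n x) -> 0 < e ->
  \forall n \near \oo, \int[m]_(x in A n) `|f x| < e.
Proof.
move=> fi mA A0 e0.
have fi' : m.-integrable setT (EFin \o (fun x => `|f x|)) by exact: integrable_norm.
have mf : measurable_fun setT (fun x => `|f x|) by have /integrableP[/measurable_EFinP] := fi'.
pose u n := (fun x => `|f x|) \_ (A n).
have cv : (\int[m]_x (EFin \o u n) x)%E @[n --> \oo] --> (\int[m]_x (cst 0 x))%E.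
  apply: (dominated_cvg _ _ _ _ fi') => //.
  - move=> n; apply/measurable_EFinP; apply/(measurable_restrictT _ _).1 => //.
    exact: measurable_funTS.
  - move=> x _; apply: cvg_near_cst; apply: filterS (A0 x) => n An.
    by rewrite /u /= patchE memNset.
  - move=> n x _; rewrite /u /= patchE lee_fin.
    by case: ifP => _; rewrite ?normr_id// normr0.
rewrite integral0 in cv.
have /fine_cvgP[_ cv'] := cv.
have /cvgrPdist_lt/(_ e e0) := cv'.
apply: filterS => n; rewrite /= sub0r normrN Rintegral_mkcond.
exact/le_lt_trans/ler_norm.
Qed.

Lemma integrable_tail f (e : R) : mu.-integrable setT (EFin \o f) -> 0 < e ->
  exists2 M : R, 0 < M & \int[mu]_(x in ~` `[- M, M]) `|f x| < e.
Proof.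
move=> fi e0; pose A (n : nat) := ~` `[- n%:R, n%:R]%classic : set (measurableTypeR R).
have mA n : measurable (A n) by apply: measurableC; exact: measurable_itv.
have A0 x : \forall n \near \oo, ~ A n x.
  near=> n; apply; rewrite /= in_itv /= -ler_norml; near: n; exact: nbhs_infty_ger.
have [n _ hn] := integral_vanishing_sets fi mA A0 e0.
by exists n.+1%:R => //; apply: (hn n.+1); rewrite /= leqW.
Unshelve. all: by end_near.
Qed.

End line_tools.

(** * Quadrant integrals as primitives *)
Definition sumle {R : realType} (c : R) := [set z : R * R | z.1 + z.2 <= c].
Definition sumgt {R : realType} (c : R) := [set z : R * R | c < z.1 + z.2].

Ltac solve_quadrant T :=
  first [ by [] | by exfalso; intuition discriminate
        | by rewrite mem_set// /T /sumle /sumgt /=; lra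
        | by rewrite memNset// /T /sumle /sumgt /=; lra ].

Section plane_primitives.
Context {R : realType}.
Notation mu := (@lebesgue_measure R).
Notation mu2 := (mu \x mu)%E.
Implicit Types (g : R -> R) (Phi : R * R -> R).

Notation lray x := (`]-oo, x]%classic : set (measurableTypeR R)).

Lemma integrable_Rfubini2 (f : R * R -> R) : mu2.-integrable setT (EFin \o f) ->
  mu.-integrable setT (EFin \o (fun y => \int[mu]_x f (x, y))).
Proof.
move=> fi; have /integrableP[/measurable_EFinP mf fi'] := fi.
have maf : measurable_fun setT (fun z => `|(f z)%:E|)%E.
  by apply: measurableT_comp => //; exact/measurable_EFinP.
have mG : measurable_fun setT (fun y => \int[mu]_x f (x, y)).
  exact: (measurableT_comp _ (measurable_fubini_G fi)).
apply/integrableP; split; first exact/measurable_EFinP.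
apply: le_lt_trans fi'.
rewrite [leRHS](tonelli21 maf)//.
apply: ge0_le_integral => //.
- by apply: measurableT_comp => //; exact/measurable_EFinP.
- exact: (measurable_tonelli2 maf).
move=> y _.
have my : measurable_fun setT (fun x => (f (x, y))%:E).
  by apply/measurable_EFinP; apply: (measurableT_comp mf); exact: measurable_pair2.
apply: (@le_trans _ _ `|\int[mu]_x (f (x, y))%:E|%E); last exact: le_abse_integral.
rewrite /comp /Rintegral; set I := (\int[mu]_x (f (x, y))%:E)%E.
by case: I => [r||] //=; rewrite ?leey ?normr0.
Qed.

Lemma eq_Rintegral_on d (T : measurableType d) (m : {measure set T -> \bar R})
    (A B : set T) (f g : T -> R) :
  (forall x, A x -> B x -> f x = g x) -> (forall x, A x -> ~ B x -> f x = 0) ->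
  (forall x, ~ A x -> B x -> g x = 0) ->
  \int[m]_(x in A) f x = \int[m]_(x in B) g x.
Proof.
move=> AB AnB nAB; rewrite Rintegral_mkcond [RHS]Rintegral_mkcond.
apply: eq_Rintegral => x _; rewrite !patchE.
case: ifPn => [/set_mem Ax|Ax]; case: ifPn => [/set_mem Bx|Bx] //.
- exact: AB.
- by apply: AnB => // /mem_set; apply/negP.
- by apply/esym/nAB => // /mem_set; apply/negP.
Qed.

Lemma is_primitive_Ny g : mu.-integrable setT (EFin \o g) ->
  is_primitive (fun x => \int[mu]_(s in lray x) g s) g.
Proof.
move=> gi; split; first exact: integrable_seg.
move=> a b ab.
have gib : mu.-integrable (lray b) (EFin \o g) by exact: integrableS gi.
have := @Rintegral_itvB R g -oo%O (BRight b) a gib.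
rewrite !bnd_simp => /(_ isT ab) ->.
by apply: Rintegral_itv_obnd_cbnd; exact: integrableS gi.
Qed.

(** Fubini, applied to the primitive from minus infinity of the marginal. *)
Lemma is_primitive_plane1 Phi (S : set R) : measurable S ->
  mu2.-integrable setT (EFin \o Phi) ->
  is_primitive (fun x => \int[mu2]_(z in lray x `*` S) Phi z)
    (fun x => \int[mu]_(s in S) Phi (x, s)).
Proof.
move=> mS Phii.
have gi : mu.-integrable setT (EFin \o (fun x => \int[mu]_(s in S) Phi (x, s))).
  have i1 : mu2.-integrable setT (EFin \o (Phi \_ (setT `*` S))).
    apply/(restrict_integrable mu2); first exact: measurableX.
    by apply: integrableS Phii => //; exact: measurableX.
  apply: eq_integrable (integrable_Rfubini1 i1) => // x _ /=.
  congr EFin; rewrite [RHS]Rintegral_mkcond; apply: eq_Rintegral => s _.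
  by rewrite !patchE in_setX mem_setT.
have := is_primitive_Ny gi.
rewrite (_ : (fun x => _) = (fun x => \int[mu2]_(z in lray x `*` S) Phi z))//.
apply/funext => x; rewrite RfubiniX//.
by apply: integrableS Phii => //; exact: measurableX.
Qed.

Lemma is_primitive_plane2 Phi (S : set R) : measurable S ->
  mu2.-integrable setT (EFin \o Phi) ->
  is_primitive (fun y => \int[mu2]_(z in S `*` lray y) Phi z)
    (fun y => \int[mu]_(s in S) Phi (s, y)).
Proof.
move=> mS Phii.
have gi : mu.-integrable setT (EFin \o (fun y => \int[mu]_(s in S) Phi (s, y))).
  have i1 : mu2.-integrable setT (EFin \o (Phi \_ (S `*` setT))).
    apply/(restrict_integrable mu2); first exact: measurableX.
    by apply: integrableS Phii => //; exact: measurableX.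
  apply: eq_integrable (integrable_Rfubini2 i1) => // x _ /=.
  congr EFin; rewrite [RHS]Rintegral_mkcond; apply: eq_Rintegral => s _.
  by rewrite !patchE in_setX mem_setT andbT.
have := is_primitive_Ny gi.
rewrite (_ : (fun x => _) = (fun y => \int[mu2]_(z in S `*` lray y) Phi z))//.
apply/funext => x; rewrite RfubiniXC//.
by apply: integrableS Phii => //; exact: measurableX.
Qed.

Lemma Rintegral_setID (Phi : R * R -> R) (A B : set (R * R)) : measurable A -> measurable B ->
  mu2.-integrable setT (EFin \o Phi) ->
  \int[mu2]_(z in A) Phi z = \int[mu2]_(z in A `&` B) Phi z + \int[mu2]_(z in A `\` B) Phi z.
Proof.
move=> mA mB Phii; rewrite -[in LHS](setUIDK A B) Rintegral_setU//.
- exact: measurableI.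
- exact: measurableD.
- by apply: integrableS Phii => //; apply: measurableU; [exact: measurableI|exact: measurableD].
- by apply/disj_setPS => z [[_ Bz] [_ nBz]].
Qed.

Lemma measurable_sum_le (c : R) : measurable [set z : R * R | z.1 + z.2 <= c].
Proof.
rewrite (_ : [set z | _] = (fun z : R * R => z.1 + z.2) @^-1` `]-oo, c]); last first.
  by apply/seteqP; split => z /=; rewrite in_itv.
by rewrite -[X in measurable X]setTI; apply: measurable_funD => //; exact: measurable_itv.
Qed.


Lemma measurable_sum_gt (c : R) : measurable (sumgt c).
Proof.
rewrite (_ : sumgt c = ~` sumle c); first exact: measurableC (measurable_sum_le c).
by apply/seteqP; split => z; rewrite /sumgt /sumle /= ltNge => /negP.
Qed.

(** Along a time slice the corner (x + t, t - x) of the past quadrant slides on the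
    line xi + sigma = 2t: one side is swept in, the other one out.  Cutting Phi to
    the region below this line changes nothing in the quadrant and turns the
    integral into two independent half-plane integrals minus the total one. *)
Lemma past_cone_primitive Phi t : mu2.-integrable setT (EFin \o Phi) ->
  is_primitive (fun x => \int[mu2]_(z in lray (x + t) `*` lray (t - x)) Phi z)
    (fun x => \int[mu]_(s in lray (t - x)) Phi (x + t, s)
              - \int[mu]_(s in lray (x + t)) Phi (s, t - x)).
Proof.
move=> Phii; pose T := sumle (2 * t); have mT : measurable T := measurable_sum_le _.
pose Pt := Phi \_ T.
have Pti : mu2.-integrable setT (EFin \o Pt).
  by apply/(restrict_integrable mu2) => //; exact: integrableS Phii.
have p1 := is_primitive_plane1 measurableT Pti.
have p2 := is_primitive_plane2 measurableT Pti.
have p1' := is_primitive_affine t (oner_neq0 R) p1.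
have n1 : (-1 : R) != 0 by rewrite oppr_eq0 oner_eq0.
have p2' := is_primitive_affine t n1 p2.
have := is_primitive_shift (- \int[mu2]_z Pt z) (is_primitiveD p1' p2').
rewrite (_ : (fun x : R => _ + _ - _) = (fun x => \int[mu2]_(z in lray (x + t) `*` lray (t - x)) Phi z)); last first.
  apply/funext => x; rewrite mul1r mulN1r (addrC (- x)).
  have mB : measurable (lray (x + t) `*` [set: R]) by exact: measurableX.
  have mC : measurable ([set: R] `*` lray (t - x)) by exact: measurableX.
  rewrite (Rintegral_setID mB mC Pti) [X in _ - X](Rintegral_setID measurableT mC Pti).
  have -> : \int[mu2]_(z in (lray (x + t) `*` [set: R]) `\` ([set: R] `*` lray (t - x))) Pt z =
            \int[mu2]_(z in setT `\` ([set: R] `*` lray (t - x))) Pt z.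
    by apply: eq_Rintegral_on => -[a b]; rewrite /Pt ?patchE /= ?in_itv /= ?andbT; have [ha|ha] := leP a (x + t); have [hb|hb] := leP b (t - x) => h1 h2; solve_quadrant T.
  have -> : \int[mu2]_(z in (lray (x + t) `*` [set: R]) `&` ([set: R] `*` lray (t - x))) Pt z =
            \int[mu2]_(z in lray (x + t) `*` lray (t - x)) Phi z.
    by apply: eq_Rintegral_on => -[a b]; rewrite /Pt ?patchE /= ?in_itv /= ?andbT; have [ha|ha] := leP a (x + t); have [hb|hb] := leP b (t - x) => h1 h2; solve_quadrant T.
  by rewrite setTI; ring.
move=> h; rewrite (_ : (fun x => _ - _) = (fun x => 1 * \int[mu]_s Pt (1 * x + t, s) + -1 * \int[mu]_s Pt (s, -1 * x + t)))//.
apply/funext => x; rewrite !mul1r !mulN1r (addrC (- x)); congr (_ - _).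
  rewrite Rintegral_mkcond; apply: eq_Rintegral => s _.
  rewrite /Pt !patchE; congr (if _ then _ else _).
  rewrite mem_setE in_itv /=; apply/idP/idP => [h1|/set_mem]; last by rewrite /T /sumle /=; lra.
  by apply/mem_set; rewrite /T /sumle /=; lra.
rewrite Rintegral_mkcond; apply: eq_Rintegral => s _.
rewrite /Pt !patchE; congr (if _ then _ else _).
rewrite mem_setE in_itv /=; apply/idP/idP => [h1|/set_mem]; last by rewrite /T /sumle /=; lra.
by apply/mem_set; rewrite /T /sumle /=; lra.
Qed.

Notation rray x := (`]x, +oo[%classic : set (measurableTypeR R)).

(** The same inclusion-exclusion above the line xi + sigma = 2t, where the future
    quadrants live.  This is the form in which the difference between the solution
    and its asymptotic state appears. *)
Lemma future_cone_primitive Phi t : mu2.-integrable setT (EFin \o Phi) ->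
  is_primitive (fun x => \int[mu2]_(z in rray (x + t) `*` rray (t - x)) Phi z)
    (fun x => \int[mu]_s (Phi \_ (sumgt (2 * t))) (s, t - x)
              - \int[mu]_s (Phi \_ (sumgt (2 * t))) (x + t, s)).
Proof.
move=> Phii; pose T := sumgt (2 * t); have mT : measurable T := measurable_sum_gt _.
rewrite -/T; pose Pt := Phi \_ T.
have Pti : mu2.-integrable setT (EFin \o Pt).
  by apply/(restrict_integrable mu2) => //; exact: integrableS Phii.
have p1 := is_primitive_plane1 measurableT Pti.
have p2 := is_primitive_plane2 measurableT Pti.
have p1' := is_primitiveZ (-1) (is_primitive_affine t (oner_neq0 R) p1).
have n1 : (-1 : R) != 0 by rewrite oppr_eq0 oner_eq0.
have p2' := is_primitiveZ (-1) (is_primitive_affine t n1 p2).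
have := is_primitive_shift (\int[mu2]_z Pt z) (is_primitiveD p1' p2').
rewrite (_ : (fun x : R => _ + _ + _) = (fun x => \int[mu2]_(z in rray (x + t) `*` rray (t - x)) Phi z)); last first.
  apply/funext => x; rewrite !mul1r !mulN1r (addrC (- x)).
  have mB : measurable (lray (x + t) `*` [set: R]) by exact: measurableX.
  have mC : measurable ([set: R] `*` lray (t - x)) by exact: measurableX.
  rewrite [X in _ + X](Rintegral_setID measurableT mB Pti) setTI.
  have mTB : measurable ([set: R * R] `\` lray (x + t) `*` [set: R]) by exact: measurableD.
  rewrite (Rintegral_setID mTB mC Pti).
  have -> : \int[mu2]_(z in ([set: R * R] `\` lray (x + t) `*` [set: R]) `&` ([set: R] `*` lray (t - x))) Pt z =
            \int[mu2]_(z in [set: R] `*` lray (t - x)) Pt z.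
    by apply: eq_Rintegral_on => -[a b]; rewrite /Pt ?patchE /= ?in_itv /= ?andbT; have [ha|ha] := leP a (x + t); have [hb|hb] := leP b (t - x) => h1 h2; solve_quadrant T.
  have -> : \int[mu2]_(z in ([set: R * R] `\` lray (x + t) `*` [set: R]) `\` ([set: R] `*` lray (t - x))) Pt z =
            \int[mu2]_(z in rray (x + t) `*` rray (t - x)) Phi z.
    by apply: eq_Rintegral_on => -[a b]; rewrite /Pt ?patchE /= ?in_itv /= ?andbT; have [ha|ha] := leP a (x + t); have [hb|hb] := leP b (t - x) => h1 h2; solve_quadrant T.
  by ring.
move=> h; rewrite (_ : (fun x => _ - _) = (fun x => -1 * (1 * \int[mu]_s Pt (1 * x + t, s)) + -1 * (-1 * \int[mu]_s Pt (s, -1 * x + t))))//.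
by apply/funext => x; rewrite !mul1r !mulN1r opprK addrC (addrC (- x)).
Qed.

(** Splitting the plane at the corner (x, y): the integral over the past quadrant
    is a function of x plus a function of y up to the integral over the future
    quadrant.  The first two produce the asymptotic free wave, and the last one is
    the error. *)
Lemma cone_complement Phi (x y : R) : mu2.-integrable setT (EFin \o Phi) ->
  \int[mu2]_(z in lray x `*` lray y) Phi z =
  \int[mu2]_(z in lray x `*` setT) Phi z + \int[mu2]_(z in setT `*` lray y) Phi z
  - \int[mu2]_z Phi z + \int[mu2]_(z in rray x `*` rray y) Phi z.
Proof.
move=> Pti.
have mB : measurable (lray x `*` [set: R]) by exact: measurableX.
have mC : measurable ([set: R] `*` lray y) by exact: measurableX.
rewrite [X in _ - X](Rintegral_setID measurableT mB Pti) setTI.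
have mTB : measurable ([set: R * R] `\` lray x `*` [set: R]) by exact: measurableD.
rewrite (Rintegral_setID mTB mC Pti) (Rintegral_setID mC mB Pti).
have E (A B : set (R * R)) : A = B -> \int[mu2]_(z in A) Phi z = \int[mu2]_(z in B) Phi z by move->.
rewrite (E (([set: R] `*` lray y) `&` (lray x `*` [set: R])) (lray x `*` lray y)); last first.
  by apply/seteqP; split => -[a b] /=; tauto.
rewrite (E (([set: R * R] `\` lray x `*` [set: R]) `&` ([set: R] `*` lray y)) (([set: R] `*` lray y) `\` (lray x `*` [set: R]))); last first.
  by apply/seteqP; split => -[a b] /=; tauto.
rewrite (E (([set: R * R] `\` lray x `*` [set: R]) `\` ([set: R] `*` lray y)) (rray x `*` rray y)); first by ring.
apply/seteqP; split => -[a b] /=; rewrite !in_itv /= !andbT !ltNge.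
  by move=> [[_ h1] h2]; split; apply/negP; tauto.
by move=> [/negP h1 /negP h2]; tauto.
Qed.

End plane_primitives.

(** * The Goursat estimate *)
Section gronwall.
Context {R : realType}.
Notation mu := (@lebesgue_measure R).
Notation mu2 := (mu \x mu)%E.
Notation lray x := (`]-oo, x]%classic : set (measurableTypeR R)).

Lemma ae_le_Rintegral d (T : measurableType d) (m : {measure set T -> \bar R})
    (D : set T) (f g : T -> R) : measurable D ->
  m.-integrable D (EFin \o f) -> m.-integrable D (EFin \o g) ->
  (forall x, D x -> 0 <= f x) -> (forall x, D x -> 0 <= g x) ->
  {ae m, forall x, D x -> f x <= g x} ->
  \int[m]_(x in D) f x <= \int[m]_(x in D) g x.
Proof.
move=> mD fi gi f0 g0 fg; rewrite -lee_fin !Rintegral_EFin//.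
apply: ae_ge0_le_integral => //.
- exact: measurable_int fi.
- exact: measurable_int gi.
Qed.

Lemma Rintegral_lray_small (f : R -> R) (e : R) : mu.-integrable setT (EFin \o f) ->
  (forall x, 0 <= f x) -> 0 < e -> forall s, exists2 r, r <= s & \int[mu]_(x in lray r) f x < e.
Proof.
move=> fi f0 e0 s; pose A (n : nat) := lray (- n%:R).
have mA n : measurable (A n) by exact: measurable_itv.
have A0 x : \forall n \near \oo, ~ A n x.
  near=> n; rewrite /A /= in_itv /=; apply/negP; rewrite -ltNge.
  by rewrite ltrNl; near: n; exact: nbhs_infty_gtr.
have [n _ hn] := integral_vanishing_sets fi mA A0 e0.
pose k := (n + Num.bound `|s|)%N.
exists (- k%:R).
  rewrite lerNl; apply: le_trans (ler_norm _) _; rewrite normrN ltW//.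
  by rewrite (lt_le_trans (archi_boundP _))// ler_nat leq_addl.
have := hn k; rewrite /= leq_addr => /(_ isT).
by under eq_Rintegral do rewrite ger0_norm//.
Unshelve. all: by end_near.
Qed.

Lemma le_Rintegral_lray (f : R -> R) (r s : R) : mu.-integrable setT (EFin \o f) ->
  (forall x, 0 <= f x) -> r <= s ->
  \int[mu]_(x in lray r) f x <= \int[mu]_(x in lray s) f x.
Proof.
move=> fi f0 rs; have [_ h] := is_primitive_Ny fi.
by rewrite -subr_ge0 h// Rintegral_ge0.
Qed.

(** A Gronwall argument for a quadratic inequality.  Since j is bounded by C times
    (b + j) (eps + J), with J the primitive of j, the term j (eps + J) can be
    absorbed on the left as long as C (eps + J) <= 1/2.  The remaining factor b is
    only integrable, not small, so the line is cut into k + 1 pieces on which its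
    integral is at most 1 / (4C): each piece at most doubles eps + J, up to 4 eps.
    When C 2 ^ k eps is small the outcome stays below the threshold 1/2, which by
    continuity of J is then never crossed. *)
Section bootstrap.
Variables (C eps M : R) (j b g : R -> R) (k : nat).
Hypotheses (C0 : 0 < C) (eps0 : 0 < eps).
Hypotheses (ji : mu.-integrable setT (EFin \o j)) (bi : mu.-integrable setT (EFin \o b))
  (gi : mu.-integrable setT (EFin \o g)).
Hypotheses (j0 : forall x, 0 <= j x) (b0 : forall x, 0 <= b x) (g0 : forall x, 0 <= g x).
Hypotheses (bM : \int[mu]_x b x <= M) (geps : \int[mu]_x g x <= eps).
Let J s := \int[mu]_(x in lray s) j x.
Let B s := \int[mu]_(x in lray s) b x.
Hypothesis jle : {ae mu, forall s, j s <= C * (b s + j s) * (eps + J s) + g s}.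
Hypothesis kM : 4 * C * M <= k.+1%:R.
Hypothesis small : C * (6 * 2 ^+ k.+1) * eps < 2^-1.

Let Jp : is_primitive J j. Proof. exact: is_primitive_Ny. Qed.
Let Bp : is_primitive B b. Proof. exact: is_primitive_Ny. Qed.

Let J_ge0 s : 0 <= J s. Proof. by apply: Rintegral_ge0. Qed.
Let J_le r s : r <= s -> J r <= J s. Proof. exact: le_Rintegral_lray. Qed.

(** One absorption: on [r, s] the bound C (eps + J) <= 1/2 gives
    j <= 2 C b (eps + J s) + 2 g. *)
Let step r s : r <= s -> C * (eps + J s) <= 2^-1 ->
  eps + J s <= eps + J r + 2 * C * (eps + J s) * (B s - B r) + 2 * eps.
Proof.
move=> rs small_s; rewrite -addrA -addrA lerD2l -lerBlDl Jp.2// Bp.2//.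
have gs : \int[mu]_(x in `[r, s]) g x <= eps.
  apply: le_trans geps; rewrite Rintegral_mkcond; apply: le_Rintegral => //.
    by apply/(restrict_integrable mu) => //; exact: integrableS gi.
  by move=> x _; rewrite patchE; case: ifP.
apply: (@le_trans _ _ (\int[mu]_(x in `[r, s]) (2 * C * (eps + J s) * b x + 2 * g x))).
  have i1 : mu.-integrable `[r, s] (EFin \o (fun x => 2 * C * (eps + J s) * b x)).
    by apply: eq_integrable (integrableZl _ (2 * C * (eps + J s)) (integrable_seg bi r s)).
  have i2 : mu.-integrable `[r, s] (EFin \o (fun x => 2 * g x)).
    by apply: eq_integrable (integrableZl _ 2 (integrable_seg gi r s)).
  have k0 : 0 <= 2 * C * (eps + J s) by rewrite !mulr_ge0// ?(ltW C0)// addr_ge0// ltW.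
  apply: ae_le_Rintegral => //.
  - exact: (integrable_seg ji).
  - by apply: eq_integrable (integrableD _ i1 i2).
  - by move=> x _; rewrite addr_ge0// mulr_ge0.
  apply: ae1S jle => x jx; rewrite /= in_itv /= => /andP[_ xs].
  have h1 : C * (b x + j x) * (eps + J x) <= C * (b x + j x) * (eps + J s).
    by rewrite ler_wpM2l ?lerD2l ?J_le// mulr_ge0 ?addr_ge0// ltW.
  have h2 : j x * (C * (eps + J s)) <= j x * 2^-1 by rewrite ler_wpM2l.
  nra.
rewrite RintegralD//; last 2 first.
  by apply: eq_integrable (integrableZl _ (2 * C * (eps + J s)) (integrable_seg bi r s)).
  by apply: eq_integrable (integrableZl _ 2 (integrable_seg gi r s)).
rewrite !RintegralZl//; [|exact: (integrable_seg gi)|exact: (integrable_seg bi)].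
by rewrite lerD2l ler_wpM2l.
Qed.

Let ivt (f : R -> R) (v r s : R) : continuous f -> r <= s -> f r <= v -> v <= f s ->
  exists2 c, r <= c <= s & f c = v.
Proof.
move=> cf rs fr fs.
have [|c] := @IVT R f r s v rs (continuous_subspaceT cf).
  by rewrite ge_min fr /= le_max fs orbT.
by rewrite in_itv /= => h1 h2; exists c.
Qed.

(** Induction over the pieces: the constants solve G_(i+1) = 2 G_i + 4 with
    G_0 = 8, since G <= G / 2 + G_i + 2 eps on each of them. *)
Let claim i s : C * (eps + J s) <= 2^-1 -> 4 * C * B s <= i.+1%:R ->
  eps + J s <= (6 * 2 ^+ i.+1 - 4) * eps.
Proof.
elim: i s => [|i IH] s Cs Bs.
  have [r rs Jr] := Rintegral_lray_small ji j0 eps0 s.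
  have := step rs Cs; rewrite -/(J r) in Jr.
  have Br : 0 <= B r by apply: Rintegral_ge0.
  have G0 : 0 <= eps + J s by rewrite addr_ge0// ltW.
  have : (eps + J s) * (4 * C * (B s - B r)) <= (eps + J s) * 1.
    rewrite ler_wpM2l// mulrBr; have : 0 <= 4 * C * B r by rewrite !mulr_ge0// ltW.
    by move: Bs; lra.
  rewrite expr1; nra.
have [Bs'|Bs'] := leP (4 * C * B s) i.+1%:R.
  apply: le_trans (IH _ Cs Bs') _; rewrite ler_wpM2r ?(ltW eps0)//.
  by rewrite lerD2r ler_wpM2l// [leRHS]exprS ler_peMl ?exprn_ge0// ler1n.
have v0 : 0 < i.+1%:R / (4 * C) by rewrite divr_gt0// mulr_gt0.
have [r0 r0s Br0] := Rintegral_lray_small bi b0 v0 s.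
have cB : continuous B by exact: is_primitive_continuous Bp.
have [||r /andP[_ rs] Br] := ivt (v := i.+1%:R / (4 * C)) cB r0s.
- exact: ltW.
- by rewrite ler_pdivrMr ?mulr_gt0// mulrC ltW.
have Er : 4 * C * B r = i.+1%:R by rewrite Br mulrC divfK// gt_eqF// mulr_gt0.
have Gr : eps + J r <= (6 * 2 ^+ i.+1 - 4) * eps.
  apply: IH; last by rewrite Er.
  by apply: le_trans Cs; rewrite ler_wpM2l ?(ltW C0)// lerD2l J_le.
have := step rs Cs.
have G0 : 0 <= eps + J s by rewrite addr_ge0// ltW.
have : (eps + J s) * (4 * C * (B s - B r)) <= (eps + J s) * 1.
  by rewrite ler_wpM2l// mulrBr Er; move: Bs; rewrite -[i.+2]addn1 natrD; lra.
rewrite [2 ^+ i.+2]exprS; move: Gr; move: (2 ^+ i.+1) => y; nra.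
Qed.

Lemma bootstrap s : C * (eps + J s) <= 2^-1.
Proof.
rewrite leNgt; apply/negP => Cs.
have p0 : (0 : R) < 2 ^+ k.+1 by rewrite exprn_gt0.
have [r rs Jr] := Rintegral_lray_small ji j0 eps0 s; rewrite -/(J r) in Jr.
have p2 : (2 : R) <= 2 ^+ k.+1 by rewrite exprS ler_pMr// exprn_ege1// ler1n.
have Cr : C * (eps + J r) <= 2^-1.
  apply: le_trans (ltW small); rewrite -mulrA ler_wpM2l ?(ltW C0)//.
  have h2 : 2 * eps <= 2 ^+ k.+1 * eps by rewrite ler_wpM2r// ltW.
  apply: (@le_trans _ _ (2 * eps)); first by move: Jr; lra.
  by apply: le_trans h2 _; rewrite -mulrA ler_peMl ?ler1n// mulr_ge0// ltW.
have cJ : continuous (fun s => C * (eps + J s)).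
  move=> x; apply: cvgM; first exact: cvg_cst.
  by apply: cvgD; [exact: cvg_cst|exact: (is_primitive_continuous Jp)].
(* if the threshold is passed, it is attained exactly, where claim contradicts it *)
have [c _ Ec] := ivt cJ rs Cr (ltW Cs).
have BM : 4 * C * B c <= k.+1%:R.
  apply: le_trans kM; rewrite ler_wpM2l ?mulr_ge0 ?(ltW C0)//; apply: le_trans bM.
  rewrite /B Rintegral_mkcond; apply: le_Rintegral => //.
    by apply/(restrict_integrable mu) => //; exact: integrableS bi.
  by move=> x _; rewrite patchE; case: ifP.
have Cc : C * (eps + J c) <= 2^-1 by rewrite Ec.
have := claim Cc BM => h.
have : C * (eps + J c) <= C * ((6 * 2 ^+ k.+1 - 4) * eps) by rewrite ler_wpM2l ?(ltW C0).
have Ce : 0 < C * eps by exact: mulr_gt0.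
rewrite Ec (_ : C * _ = C * (6 * 2 ^+ k.+1) * eps - 4 * (C * eps)); last by ring.
by move: small; lra.
Qed.

End bootstrap.

(** Here h stands for the size of the source, a + int h for the incoming flux and
    b + int h for the outgoing one.  Integrating the inequality over x and bounding
    the first factor by its total mass eps + J reduces to the one-dimensional
    bootstrap for the marginal j of h.  The integral of b need not be small: this is
    why largeness of the solution does not matter. *)
Lemma goursat_bound (C eps M : R) (h g : R * R -> R) (a b : R -> R) (k : nat) :
  0 < C -> 0 < eps ->
  mu2.-integrable setT (EFin \o h) -> mu2.-integrable setT (EFin \o g) ->
  mu.-integrable setT (EFin \o a) -> mu.-integrable setT (EFin \o b) ->
  (forall z, 0 <= h z) -> (forall z, 0 <= g z) -> (forall x, 0 <= a x) -> (forall x, 0 <= b x) ->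
  \int[mu]_x a x <= eps -> \int[mu]_x b x <= M -> \int[mu2]_z g z <= eps ->
  {ae mu2, forall z, h z <= C * (a z.1 + \int[mu]_(y in lray z.2) h (z.1, y))
                            * (b z.2 + \int[mu]_x h (x, z.2)) + g z} ->
  4 * C * M <= k.+1%:R -> C * (6 * 2 ^+ k.+1) * eps < 2^-1 ->
  \int[mu2]_z h z <= (2 * C)^-1.
Proof.
move=> C0 eps0 hi gi ai bi h0 g0 a0 b0 aeps bM geps hle kM small.
pose j s := \int[mu]_x h (x, s); pose gam s := \int[mu]_x g (x, s).
have ji : mu.-integrable setT (EFin \o j) by exact: integrable_Rfubini2.
have gami : mu.-integrable setT (EFin \o gam) by exact: integrable_Rfubini2.
have j0 s : 0 <= j s by apply: Rintegral_ge0.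
have gam0 s : 0 <= gam s by apply: Rintegral_ge0.
have gameps : \int[mu]_s gam s <= eps by rewrite /gam -Rfubini21.
have hlei s : mu2.-integrable (setT `*` lray s) (EFin \o h).
  by apply: integrableS hi => //; exact: measurableX.
have Jint s : mu.-integrable setT (EFin \o (fun x => \int[mu]_(y in lray s) h (x, y))).
  have i1 : mu2.-integrable setT (EFin \o (h \_ (setT `*` lray s))).
    by apply/(restrict_integrable mu2) => //; exact: measurableX.
  apply: eq_integrable (integrable_Rfubini1 i1) => // x _ /=.
  congr EFin; rewrite [RHS]Rintegral_mkcond; apply: eq_Rintegral => y _.
  by rewrite !patchE in_setX mem_setT.
(* the mass of h below height s, seen as a primitive of its marginal j *)
have JE s : \int[mu]_x \int[mu]_(y in lray s) h (x, y) = \int[mu]_(y in lray s) j y.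
  by rewrite -[LHS](RfubiniX measurableT _ (hlei s))// (RfubiniXC measurableT _ (hlei s)).
have jle : {ae mu, forall s, j s <= C * (b s + j s) * (eps + \int[mu]_(x in lray s) j x) + gam s}.
  have := ae1_and (ae_section2 hle) (ae1_and (ae_integrable2 hi) (ae_integrable2 gi)).
  apply: ae1S => s [hs [his gis]].
  pose u x := C * (b s + j s) * (a x + \int[mu]_(y in lray s) h (x, y)).
  have ui : mu.-integrable setT (EFin \o u).
    by apply: eq_integrable (integrableZl _ (C * (b s + j s)) (integrableD _ ai (Jint s))).
  have u0 x : 0 <= u x.
    by rewrite mulr_ge0 ?addr_ge0 ?mulr_ge0 ?addr_ge0 ?(ltW C0)//; apply: Rintegral_ge0.
  apply: (@le_trans _ _ (\int[mu]_x (u x + g (x, s)))).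
    apply: ae_le_Rintegral => //.
    - by apply: eq_integrable (integrableD _ ui gis).
    - by move=> x _; rewrite addr_ge0.
    by apply: ae1S hs => x hx _; rewrite /u (mulrAC C).
  rewrite RintegralD//.
  rewrite lerD2r /u RintegralZl//; last by apply: eq_integrable (integrableD _ ai (Jint s)).
  rewrite ler_wpM2l ?mulr_ge0 ?addr_ge0 ?(ltW C0)// RintegralD//.
  by rewrite JE lerD2r.
have boot s : C * (eps + \int[mu]_(x in lray s) j x) <= 2^-1 :=
  bootstrap C0 eps0 ji bi gami j0 b0 gam0 bM gameps jle kM small s.
rewrite (Rfubini21 hi) -/(j _).
rewrite leNgt; apply/negP => hlt.
pose A (n : nat) := `]n%:R, +oo[%classic : set (measurableTypeR R).
have mA n : measurable (A n) by exact: measurable_itv.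
have A0 x : \forall n \near \oo, ~ A n x.
  near=> n; rewrite /A /= in_itv /= andbT; apply/negP; rewrite -leNgt.
  by near: n; exact: nbhs_infty_ger.
have [n _ hn] := integral_vanishing_sets ji mA A0 eps0.
have := hn n (leqnn n); under eq_Rintegral do rewrite ger0_norm//.
have : \int[mu]_x j x = \int[mu]_(x in lray n%:R) j x + \int[mu]_(x in A n) j x.
  have E : setT = lray n%:R `|` A n by rewrite /A -itv_bndbnd_setU// set_itvNyy.
  rewrite {1}E Rintegral_setU -?E//.
  by apply/disj_setPS => y []; rewrite /A /= !in_itv /= andbT => h1; rewrite ltNge h1.
move=> Ejn jn; have hlt' : (2 * C)^-1 < \int[mu]_x j x := hlt.
have hb : eps + \int[mu]_(x in lray n%:R) j x <= (2 * C)^-1.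
  by rewrite invfM ler_pdivlMr// mulrC boot.
by move: hlt'; rewrite Ejn; lra.
Unshelve. all: by end_near.
Qed.

End gronwall.

(** * Exchanging the characteristic variables *)
Section ae_lift.
Context {R : realType}.
Notation mu := (@lebesgue_measure R).
Notation mu2 := (mu \x mu)%E.

Lemma ae2_and (P Q : R * R -> Prop) : {ae mu2, forall x, P x} -> {ae mu2, forall x, Q x} ->
  {ae mu2, forall x, P x /\ Q x}.
Proof. exact: ae2S2. Qed.

Lemma ae2_fst (P : R -> Prop) : {ae mu, forall x, P x} -> {ae mu2, forall z, P z.1}.
Proof.
move=> [N [mN N0 PN]]; exists (N `*` setT); split.
- exact: measurableX.
- have -> : mu2 (N `*` setT) = (mu N * mu setT)%E by exact: product_measure1E.
  by rewrite N0 mul0e.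
- by move=> z nP; split => //; apply: PN.
Qed.

Lemma ae2_snd (P : R -> Prop) : {ae mu, forall x, P x} -> {ae mu2, forall z, P z.2}.
Proof.
move=> [N [mN N0 PN]]; exists (setT `*` N); split.
- exact: measurableX.
- have -> : mu2 (setT `*` N) = (mu setT * mu N)%E by exact: product_measure1E.
  by rewrite N0 mule0.
- by move=> z nP; split => //; apply: PN.
Qed.

End ae_lift.

Section swap.
Context {R : realType}.
Notation mu := (@lebesgue_measure R).
Notation mu2 := (mu \x mu)%E.
Notation lray x := (`]-oo, x]%classic : set (measurableTypeR R)).

Definition swp (z : R * R) : R * R := (z.2, z.1).

Lemma measurable_swp : measurable_fun setT swp.
Proof. by apply: measurable_fun_pair. Qed.

Lemma ge0_integral_swp (f : R * R -> \bar R) : measurable_fun setT f ->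
  (forall z, 0 <= f z)%E -> (\int[mu2]_z f (swp z) = \int[mu2]_z f z)%E.
Proof.
move=> mf f0; have mfs : measurable_fun setT (f \o swp) by exact: measurableT_comp measurable_swp.
by rewrite [LHS](tonelli12 mfs (fun z => f0 _)) [RHS](tonelli21 mf f0).
Qed.

Lemma measure_swp (A : set (R * R)) : measurable A -> mu2 (swp @^-1` A) = mu2 A.
Proof.
move=> mA.
have mB : measurable (swp @^-1` A).
  by rewrite -[X in measurable X]setTI; apply: measurable_swp.
have E B : measurable B -> mu2 B = (\int[mu2]_z (\1_B z)%:E)%E.
  by move=> h; rewrite (integral_indic mu2 measurableT h) setIT.
rewrite (E _ mA) -ge0_integral_swp.
- exact: E.
- exact/measurable_EFinP/measurable_indic.
- by move=> z; rewrite lee_fin.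
Qed.

Lemma ae2_swp (P : R * R -> Prop) : {ae mu2, forall p, P p} ->
  {ae mu2, forall z, P (swp z)}.
Proof.
move=> [N [mN N0 PN]]; exists (swp @^-1` N); split.
- by rewrite -[X in measurable X]setTI; apply: measurable_swp.
- by apply: etrans (measure_swp mN) _.
- by move=> z nP; apply: PN.
Qed.

Lemma integrable_swp (f : R * R -> R) :
  mu2.-integrable setT (EFin \o f) -> mu2.-integrable setT (EFin \o (f \o swp)).
Proof.
move=> /integrableP[/measurable_EFinP mf fi]; apply/integrableP; split.
  by apply/measurable_EFinP; exact: measurableT_comp measurable_swp.
rewrite (_ : (\int[mu2]_z _)%E = (\int[mu2]_z `|(EFin \o f) z|)%E)//.
apply: (@ge0_integral_swp (fun z => `|(f z)%:E|)%E) => //.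
by apply: measurableT_comp => //; exact/measurable_EFinP.
Qed.

Lemma measurable_Rintegral_section (K : (R * R) * R -> R) : measurable_fun setT K ->
  measurable_fun setT (fun z => \int[mu]_s K (z, s)).
Proof.
move=> mK; have mEK : measurable_fun setT (EFin \o K) by exact/measurable_EFinP.
have mp : measurable_fun setT (fun z : R * R => \int[mu]_s (EFin \o K)^\+ (z, s))%E.
  apply: (@measurable_fun_fubini_tonelli_F _ _ (R * R)%type (measurableTypeR R) R mu) => //.
  exact: measurable_funepos.
have mn : measurable_fun setT (fun z : R * R => \int[mu]_s (EFin \o K)^\- (z, s))%E.
  apply: (@measurable_fun_fubini_tonelli_F _ _ (R * R)%type (measurableTypeR R) R mu) => //.
  exact: measurable_funeneg.
have := measurableT_comp (@fine_measurable R setT measurableT) (emeasurable_funB mp mn).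
apply: eq_measurable_fun => z _; rewrite /Rintegral [in RHS]integralE /=; congr (fine (_ - _)).
  by apply: eq_integral => s _; exact: (congr1 (fun h => h s) (esym (funepos_comp (EFin \o K) (fun s => (z, s))))).
by apply: eq_integral => s _; exact: (congr1 (fun h => h s) (esym (funeneg_comp (EFin \o K) (fun s => (z, s))))).
Qed.

Lemma measurable_partial (Phi : R * R -> R) : measurable_fun setT Phi ->
  measurable_fun setT (fun z : R * R => \int[mu]_(s in lray z.2) Phi (z.1, s)).
Proof.
move=> mPhi.
pose K (w : (R * R) * R) := if w.2 <= w.1.2 then Phi (w.1.1, w.2) else 0.
have mK : measurable_fun setT K.
  apply: measurable_fun_ifT => //.
    apply: measurable_fun_ler => //; exact: measurableT_comp measurable_fst.
  apply: (measurableT_comp mPhi); apply: measurable_fun_pair => //.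
  exact: measurableT_comp measurable_fst.
have := measurable_Rintegral_section mK.
apply: eq_measurable_fun => z _; rewrite [RHS]Rintegral_mkcond.
by apply: eq_Rintegral => s _; rewrite patchE mem_setE in_itv.
Qed.

Lemma measurable_partial2 (Phi : R * R -> R) : measurable_fun setT Phi ->
  measurable_fun setT (fun z : R * R => \int[mu]_(s in lray z.1) Phi (s, z.2)).
Proof.
move=> mPhi; have m1 : measurable_fun setT (Phi \o swp) by exact: measurableT_comp measurable_swp.
exact: (measurableT_comp (measurable_partial m1) measurable_swp).
Qed.

Lemma quadrant_integrable_measurable (Phi : R * R -> R) :
  (forall N, mu2.-integrable (lray N `*` lray N) (EFin \o Phi)) ->
  measurable_fun setT Phi.
Proof.
move=> Phii.
have -> : [set: R * R] = \bigcup_(n : nat) (lray n%:R `*` lray n%:R).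
  apply/seteqP; split => // -[x y] _.
  exists (maxn (Num.bound `|x|) (Num.bound `|y|)) => //=; rewrite !in_itv /=.
  split; apply: le_trans (ler_norm _) _; apply: le_trans (ltW (archi_boundP _)) _ => //;
    by rewrite ler_nat ?leq_maxl ?leq_maxr.
apply/measurable_fun_bigcup => // n; first exact: measurableX.
by have /integrableP[/measurable_EFinP] := Phii n%:R.
Qed.

End swap.

(** * From an energy bound to an integrable source *)
Section core.
Context {R : realType}.
Notation mu := (@lebesgue_measure R).
Notation mu2 := (mu \x mu)%E.
Notation lray x := (`]-oo, x]%classic : set (measurableTypeR R)).
Notation rray x := (`]x, +oo[%classic : set (measurableTypeR R)).

Definition strip (T : R) := [set z : R * R | 0 <= z.1 + z.2 <= T].

Lemma measurable_strip T : measurable (strip T).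
Proof.
rewrite (_ : strip T = (fun z : R * R => z.1 + z.2) @^-1` `[0, T]); last first.
  by apply/seteqP; split => z /=; rewrite in_itv.
by rewrite -[X in measurable X]setTI; apply: measurable_funD => //; exact: measurable_itv.
Qed.

(** Averaging: the set A <= x <= A + L, - x <= y <= B with L = A + B is contained in
    the strip 0 <= x + y <= 2L, whose total energy is 2LM.  So not all of the lines
    in an interval of length L can carry more than 3M. *)
Lemma exists_small_flux (Q : R * R -> R) (M A B : R) : 0 < M -> 0 < A + B ->
  measurable_fun setT Q -> (forall z, 0 <= Q z) ->
  (forall T, 0 < T -> (\int[mu2]_(z in strip T) (Q z)%:E <= (M * T)%:E)%E) ->
  exists2 x, A <= x & (\int[mu]_(y in `[(- x)%R, B]) (Q (x, y))%:E <= (3 * M)%:E)%E.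
Proof.
move=> M0 AB mQ Q0 QM; pose L := A + B.
apply: contrapT => nex.
pose D := strip (2 * L) `&` (`[A, A + L] `*` lray B).
have mD : measurable D.
  by apply: measurableI; [exact: measurable_strip|exact: measurableX].
have L2 : 0 < 2 * L by rewrite mulr_gt0.
have mQE : measurable_fun setT (fun z => (Q z)%:E) by exact/measurable_EFinP.
have h1 : (\int[mu2]_(z in D) (Q z)%:E <= (M * (2 * L))%:E)%E.
  apply: le_trans (QM _ L2); apply: ge0_subset_integral => //.
  - exact: measurable_strip.
  - exact: measurable_funTS.
  - by move=> z _; rewrite lee_fin.
  - by move=> z [].
have m1 : measurable_fun setT ((fun z => (Q z)%:E) \_ D).
  by apply/(measurable_restrictT _ _).1 => //; exact: measurable_funTS.
have p1 z : (0 <= ((fun z => (Q z)%:E) \_ D) z)%E by rewrite patchE; case: ifP => // _; rewrite lee_fin.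
rewrite integral_mkcond (tonelli12 m1 p1) in h1.
have : (\int[mu]_(x in `[A, (A + L)%R]) (3 * M)%:E <= (M * (2 * L))%:E)%E.
  apply: le_trans h1; rewrite [leLHS]integral_mkcond; apply: ge0_le_integral => //.
  - by move=> x _; rewrite patchE; case: ifP => // _; rewrite lee_fin mulr_ge0// ltW.
  - apply/(measurable_restrictT _ _).1 => //; exact: measurable_cst.
  - exact: measurable_tonelli1.
  move=> x _; rewrite patchE; case: ifPn => [|_]; last exact: integral_ge0.
  rewrite inE /= in_itv /= => /andP[Ax xA]; apply: ltW; rewrite ltNge; apply/negP => hx.
  apply: nex; exists x => //; apply: le_trans hx.
  rewrite [leLHS]integral_mkcond; apply: ge0_le_integral => //.
  - by move=> y _; rewrite patchE; case: ifP => // _; rewrite lee_fin.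
  - apply/(measurable_restrictT _ _).1 => //; apply: measurable_funTS.
    by apply/measurable_EFinP; apply: (measurableT_comp mQ); exact: measurable_pair1.
  - apply: (measurableT_comp m1); exact: measurable_pair1.
  move=> y _; rewrite !patchE; case: ifPn => [|_]; last exact: p1.
  rewrite inE /= in_itv /= => /andP[xy yB].
  rewrite mem_set// /D /strip /=; split; last by rewrite !in_itv /= Ax xA yB.
  by apply/andP; split; rewrite /L in xA *; lra.
have -> : (\int[mu]_(x in `[A, (A + L)%R]) (3 * M)%:E = (3 * M * L)%:E)%E.
  rewrite integral_cst// [in RHS]EFinM; congr (_ * _)%E.
  apply: (etrans (lebesgue_measure_itv _)).
  by rewrite /= lte_fin ltrDl AB -EFinD addrAC subrr add0r.
by rewrite lee_fin /L; nra.
Qed.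

Section goursat_system.
Variables (n : nat) (Phi : 'I_n -> R * R -> R) (p0 q0 : 'I_n -> R -> R) (g : R * R -> R) (C M : R).

(** For a solution with source Phi these are its two characteristic derivatives
    (d_t + d_x) u and (d_t - d_x) u at the point z: the first one is transported
    along xi = z.1 and the second one along sigma = z.2, starting from the data
    p0 and q0 on the initial line. *)
Definition P_of i (z : R * R) := p0 i z.1 + 2^-1 * \int[mu]_(s in lray z.2) Phi i (z.1, s).
Definition Q_of i (z : R * R) := q0 i z.2 + 2^-1 * \int[mu]_(s in lray z.1) Phi i (s, z.2).

Hypotheses (C0 : 0 < C) (M0 : 0 < M).
Hypothesis Phi0 : forall i z, z.1 + z.2 < 0 -> Phi i z = 0.
Hypothesis Phii : forall i N, mu2.-integrable (lray N `*` lray N) (EFin \o Phi i).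
Hypothesis p0i : forall i, mu.-integrable setT (EFin \o p0 i).
Hypothesis q0i : forall i, mu.-integrable setT (EFin \o q0 i).
Hypothesis gi : mu2.-integrable setT (EFin \o g).
Hypothesis g0 : forall z, 0 <= g z.
Hypothesis Phile : {ae mu2, forall z, 0 <= z.1 + z.2 ->
  \sum_i `|Phi i z| <= C * (\sum_i `|P_of i z|) * (\sum_i `|Q_of i z|) + g z}.
Hypothesis QM : forall T, 0 < T ->
  (\int[mu2]_(z in strip T) (\sum_i `|Q_of i z|)%:E <= (M * T)%:E)%E.

Let mPhi i : measurable_fun setT (Phi i).
Proof. exact: quadrant_integrable_measurable. Qed.

Let mQ : measurable_fun setT (fun z => \sum_i `|Q_of i z|).
Proof.
apply: measurable_sum => i; apply: measurableT_comp => //.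
apply: measurable_funD.
  apply: measurableT_comp; last exact: measurable_snd.
  by have /integrableP[/measurable_EFinP] := q0i i.
by apply: measurable_funM => //; exact: measurable_partial2.
Qed.

Let a x := \sum_i `|p0 i x|.
Let ai : mu.-integrable setT (EFin \o a).
Proof.
rewrite (_ : EFin \o a = fun x => (\sum_(i <- index_enum 'I_n) (`|p0 i x|)%:E)%E); last first.
  by apply/funext => x; rewrite /a /= sumEFin.
by apply: integrable_sum => // i _; exact: integrable_norm.
Qed.

Let hh (z : R * R) := \sum_i `|Phi i z|.
Let hh0 z : 0 <= hh z. Proof. exact: sumr_ge0. Qed.
Let hhi N : mu2.-integrable (lray N `*` lray N) (EFin \o hh).
Proof.
rewrite (_ : EFin \o hh = fun x => (\sum_(i <- index_enum 'I_n) (`|Phi i x|)%:E)%E); last first.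
  by apply/funext => x; rewrite /hh /= sumEFin.
apply: integrable_sum => [|i _]; first exact: measurableX.
exact: (integrable_norm (Phii i N)).
Qed.

Let mhh : measurable_fun setT hh.
Proof. by apply: measurable_sum => i; apply: measurableT_comp. Qed.

Let cut A A' B := (`]A, A'] `*` lray B) : set (R * R).

Let sum_integral (D : set (measurableTypeR R)) (f : 'I_n -> R -> R) : measurable D ->
  (forall i, mu.-integrable D (EFin \o f i)) ->
  mu.-integrable D (EFin \o (fun x => \sum_i f i x)) /\
  \int[mu]_(x in D) (\sum_i f i x) = \sum_i \int[mu]_(x in D) f i x.
Proof.
move=> mD fi; elim: (index_enum _) => [|i r [IH1 IH2]].
  rewrite (_ : (fun x => _) = cst 0); last by apply/funext => x; rewrite big_nil.
  by rewrite big_nil /Rintegral integral0; split => //; exact: integrable0.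
rewrite (_ : (fun x => _) = (fun x => f i x + \sum_(i <- r) f i x)); last first.
  by apply/funext => x; rewrite big_cons.
rewrite big_cons -IH2; split; last by apply: RintegralD => //; exact: fi.
exact: (integrableD mD (fi i) IH1).
Qed.

(** Far to the right, xi > A, the data p0 and the forcing g have mass at most eps, so
    P is small there up to the source itself.  The other factor Q is traced
    backwards from a line xi = A' where its flux is at most 3M.  The Goursat
    estimate then bounds the source between A and A' independently of A' and of the
    height B, although A' is only known to exist beyond any given A1. *)
Let truncated_bound : exists A : R, forall A1 B, 0 < A1 + B -> A <= A1 ->
  exists2 A', A1 <= A' & \int[mu2]_(z in cut A A' B) hh z <= (2 * C)^-1.
Proof.
pose k := Num.bound (4 * C * (3 * M)).
have kM : 4 * C * (3 * M) <= k.+1%:R.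
  apply: ltW; apply: lt_le_trans (archi_boundP _) _; last by rewrite ler_nat leqnSn.
  by rewrite !mulr_ge0// ltW.
(* the threshold of the Goursat estimate; eps makes its left side 1/4 *)
pose K : R := C * (6 * 2 ^+ k.+1).
have K0 : 0 < K by rewrite mulr_gt0// mulr_gt0// exprn_gt0.
pose eps := (4 * K)^-1.
have eps0 : 0 < eps by rewrite invr_gt0 mulr_gt0.
have small : C * (6 * 2 ^+ k.+1) * eps < 2^-1.
  rewrite -/K /eps invfM mulrCA mulfV ?gt_eqF// mulr1.
  by rewrite ltf_pV2 ?posrE// ltr_nat.
pose AA (m : nat) : set (measurableTypeR R) := rray m%:R.
have mAA m : measurable (AA m) by exact: measurable_itv.
have AA0 x : \forall m \near \oo, ~ AA m x.
  near=> m; rewrite /AA /= in_itv /= andbT; apply/negP; rewrite -leNgt.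
  by near: m; exact: nbhs_infty_ger.
have [m1 _ hm1] := integral_vanishing_sets ai mAA AA0 eps0.
pose BB (m : nat) : set (measurableTypeR R * measurableTypeR R) := rray m%:R `*` setT.
have mBB m : measurable (BB m) by exact: measurableX.
have BB0 x : \forall m \near \oo, ~ BB m x.
  apply: filterS (AA0 x.1) => m h [h1 _]; exact: h h1.
have [m2 _ hm2] := integral_vanishing_sets gi mBB BB0 eps0.
pose m := maxn m1 m2.
exists m%:R => A1 B AB mA1.
have [A' A1A' flux] := exists_small_flux M0 AB mQ (fun z => sumr_ge0 _ (fun i _ => normr_ge0 _)) QM.
exists A' => //.
pose D := cut m%:R A' B.
have mD : measurable (D : set (measurableTypeR R * measurableTypeR R)) by exact: measurableX.
pose N := Num.max A' B.
have DN : D `<=` lray N `*` lray N.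
  move=> z [] /=; rewrite !in_itv /= => /andP[_ h1] h2.
  by rewrite /N !le_max h1 h2 orbT.
pose h := hh \_ D.
have hi : mu2.-integrable setT (EFin \o h).
  apply/(restrict_integrable mu2) => //; apply: integrableS (hhi N) => //.
  exact: measurableX.
have h0 z : 0 <= h z by rewrite /h patchE; case: ifP.
pose a' := a \_ (rray m%:R).
have a0 x : 0 <= a x by exact: sumr_ge0.
have a'i : mu.-integrable setT (EFin \o a').
  by apply/(restrict_integrable mu) => //; exact: integrableS ai.
have a'eps : \int[mu]_x a' x <= eps.
  rewrite /a' -Rintegral_mkcond; have := hm1 m; rewrite /= leq_maxl => /(_ isT)/ltW.
  by under eq_Rintegral do rewrite ger0_norm//.
pose g' := g \_ (BB m).
have g'i : mu2.-integrable setT (EFin \o g').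
  by apply/(restrict_integrable mu2) => //; exact: integrableS gi.
have g'0 z : 0 <= g' z by rewrite /g' patchE; case: ifP.
have g'eps : \int[mu2]_z g' z <= eps.
  rewrite /g' -Rintegral_mkcond; have := hm2 m; rewrite /= leq_maxr => /(_ isT)/ltW.
  by under eq_Rintegral do rewrite ger0_norm//.
pose b0 y := \sum_i `|Q_of i (A', y)|.
have mb0 : measurable_fun setT b0.
  exact: (measurableT_comp mQ (measurable_pair1 A')).
have b00 y : 0 <= b0 y by exact: sumr_ge0.
pose b := b0 \_ `[- A', B].
have bi0 : mu.-integrable `[- A', B] (EFin \o b0).
  apply/integrableP; split; first by apply/measurable_EFinP; exact: measurable_funTS.
  apply: le_lt_trans (ltry (3 * M)); apply: le_trans flux.
  by under eq_integral do rewrite gee0_abs ?lee_fin//.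
have bi : mu.-integrable setT (EFin \o b) by apply/(restrict_integrable mu).
have b'0 x : 0 <= b x by rewrite /b patchE; case: ifP.
have bM : \int[mu]_x b x <= 3 * M.
  rewrite /b -Rintegral_mkcond -lee_fin Rintegral_EFin//.
have a'0 x : 0 <= a' x by rewrite /a' patchE; case: ifP.
suff hle : {ae mu2, forall z, h z <= C * (a' z.1 + \int[mu]_(y in lray z.2) h (z.1, y))
                            * (b z.2 + \int[mu]_x h (x, z.2)) + g' z}.
  rewrite Rintegral_mkcond.
  exact: (goursat_bound C0 eps0 hi g'i a'i bi h0 g'0 a'0 b'0 a'eps bM g'eps hle kM small).
(* sections of Phi are integrable on almost every characteristic only *)
pose F i := Phi i \_ (lray N `*` lray N).
have Fi i : mu2.-integrable setT (EFin \o F i).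
  by apply/(restrict_integrable mu2) => //; exact: measurableX.
have s1 : {ae mu2, forall z, forall i, mu.-integrable setT (fun y => (F i (z.1, y))%:E)}.
  apply: (@ae2_fin R n (fun i z => mu.-integrable setT (fun y => (F i (z.1, y))%:E))) => i.
  exact: (ae2_fst (P := fun x => mu.-integrable setT (fun y => (F i (x, y))%:E)) (ae_integrable1 (Fi i))).
have s2 : {ae mu2, forall z, forall i, mu.-integrable setT (fun x => (F i (x, z.2))%:E)}.
  apply: (@ae2_fin R n (fun i z => mu.-integrable setT (fun y => (F i (y, z.2))%:E))) => i.
  exact: (ae2_snd (P := fun x => mu.-integrable setT (fun y => (F i (y, x))%:E)) (ae_integrable2 (Fi i))).
have s3 : {ae mu2, forall z, mu.-integrable setT (fun x => (h (x, z.2))%:E)}.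
  exact: (ae2_snd (P := fun x => mu.-integrable setT (fun y => (h (y, x))%:E)) (ae_integrable2 hi)).
apply: ae2S2 Phile (ae2_and s1 (ae2_and s2 s3)).
move=> z hz [i1 [i2 i3]]; rewrite /h patchE.
have J1 : 0 <= \int[mu]_(y in lray z.2) h (z.1, y) by apply: Rintegral_ge0.
have J2 : 0 <= \int[mu]_x h (x, z.2) by apply: Rintegral_ge0.
have triv : 0 <= C * (a' z.1 + \int[mu]_(y in lray z.2) h (z.1, y)) * (b z.2 + \int[mu]_x h (x, z.2)) + g' z.
  by rewrite addr_ge0// !mulr_ge0 ?addr_ge0// ltW.
case: ifPn => [/set_mem Dz|_]; last exact: triv.
have [z0|z0] := leP 0 (z.1 + z.2); last first.
  rewrite (_ : hh z = 0) //; rewrite /hh big1// => i _.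
  by rewrite Phi0// normr0.
apply: le_trans (hz z0) _.
have [] := Dz; rewrite /= !in_itv /= => /andP[mz zA'] zB.
have -> : g' z = g z by rewrite /g' patchE mem_set//; split => //=; rewrite in_itv /= mz.
rewrite lerD2r; apply: ler_pM.
- by rewrite mulr_ge0 ?sumr_ge0// ltW.
- by rewrite sumr_ge0.
- rewrite ler_wpM2l ?(ltW C0)//.
  have -> : a' z.1 = a z.1 by rewrite /a' patchE mem_set//= in_itv /= mz.
  have zN1 : z.1 <= N by rewrite /N le_max zA'.
  have zN2 : z.2 <= N by rewrite /N le_max zB orbT.
  have Fy i : mu.-integrable (lray z.2) (EFin \o (fun y => Phi i (z.1, y))).
    have mz2 : measurable (lray z.2) by exact: measurable_itv.
    apply: eq_integrable (integrableS measurableT mz2 (@subsetT _ _) (i1 i)) => //.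
    move=> y /set_mem /=; rewrite in_itv /= => yz.
    by rewrite /F patchE mem_set//; split => /=; rewrite in_itv //= (le_trans yz).
  have S i : `|P_of i z| <= `|p0 i z.1| + \int[mu]_(y in lray z.2) `|Phi i (z.1, y)|.
    apply: le_trans (ler_normD _ _) _; rewrite lerD2l normrM gtr0_norm ?invr_gt0//.
    have I0 : 0 <= \int[mu]_(y in lray z.2) `|Phi i (z.1, y)| by apply: Rintegral_ge0.
    apply: (@le_trans _ _ (2^-1 * \int[mu]_(y in lray z.2) `|Phi i (z.1, y)|)).
      by rewrite ler_wpM2l ?invr_ge0//; apply: le_normr_Rintegral => //; exact: Fy.
    by rewrite ler_piMl// invf_le1// ler1n.
  apply: le_trans (ler_sum _ (fun i _ => S i)) _; rewrite big_split /= lerD2l.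
  have [_ <-] := sum_integral (measurable_itv _) (fun i => integrable_norm (Fy i)).
  rewrite le_eqVlt; apply/orP; left; apply/eqP; apply: eq_Rintegral => y /set_mem /=.
  rewrite in_itv /= => yz; rewrite /h patchE mem_set//; split => /=; rewrite in_itv /= ?mz//.
  exact: le_trans yz zB.
have zN1 : A' <= N by rewrite /N le_max lexx.
have zN2 : z.2 <= N by rewrite /N le_max zB orbT.
have -> : b z.2 = b0 z.2.
  by rewrite /b patchE mem_set//= in_itv /= zB andbT; move: z0 zA'; lra.
have Fx i c : c <= A' -> mu.-integrable (lray c) (EFin \o (fun x => Phi i (x, z.2))).
  move=> cA'; have mz2 : measurable (lray c) by exact: measurable_itv.
  apply: eq_integrable (integrableS measurableT mz2 (@subsetT _ _) (i2 i)) => //.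
  move=> x /set_mem /=; rewrite in_itv /= => xc.
  by rewrite /F patchE mem_set//; split => /=; rewrite in_itv //= (le_trans xc)// (le_trans cA').
pose Iv := `]z.1, A']%classic : set (measurableTypeR R).
have mIv : measurable Iv by exact: measurable_itv.
have IvA : Iv `<=` lray A' by move=> x; rewrite /Iv /= !in_itv /= => /andP[].
have FI i : mu.-integrable Iv (EFin \o (fun x => Phi i (x, z.2))).
  by apply: integrableS (Fx i A' (lexx _)) => //; exact: measurable_itv.
(* Q at z differs from Q on the line xi = A' by the source in between *)
have S i : `|Q_of i z| <= `|Q_of i (A', z.2)| + \int[mu]_(x in Iv) `|Phi i (x, z.2)|.
  have E : \int[mu]_(x in lray A') Phi i (x, z.2) =
      \int[mu]_(x in lray z.1) Phi i (x, z.2) + \int[mu]_(x in Iv) Phi i (x, z.2).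
    have U : lray A' = lray z.1 `|` Iv by rewrite /Iv -itv_bndbnd_setU// bnd_simp.
    rewrite U Rintegral_setU//.
      by rewrite -U; exact: Fx.
    by apply/disj_setPS => y []; rewrite /Iv /= !in_itv /= => h1 /andP[]; rewrite ltNge h1.
  have -> : Q_of i z = Q_of i (A', z.2) - 2^-1 * \int[mu]_(x in Iv) Phi i (x, z.2).
    by rewrite /Q_of /= E mulrDr; ring.
  apply: le_trans (ler_normB _ _) _; rewrite lerD2l normrM gtr0_norm ?invr_gt0//.
  have I0 : 0 <= \int[mu]_(x in Iv) `|Phi i (x, z.2)| by apply: Rintegral_ge0.
  apply: (@le_trans _ _ (2^-1 * \int[mu]_(x in Iv) `|Phi i (x, z.2)|)).
    by rewrite ler_wpM2l ?invr_ge0//; apply: le_normr_Rintegral => //; exact: FI.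
  by rewrite ler_piMl// invf_le1// ler1n.
apply: le_trans (ler_sum _ (fun i _ => S i)) _; rewrite big_split /= lerD2l.
have [si <-] := sum_integral mIv (fun i => integrable_norm (FI i)).
rewrite Rintegral_mkcond; apply: le_Rintegral => //.
  by apply/(restrict_integrable mu).
move=> x _; rewrite patchE; case: ifPn => [/set_mem|_] //.
rewrite /Iv /= in_itv /= => /andP[h1 h2].
by rewrite /h patchE mem_set//; split => /=; rewrite in_itv /= ?h2 ?(lt_trans mz h1).
Unshelve. all: by end_near.
Qed.

(** Exhaustion of the half plane xi > A by the truncated domains, whose bound is
    uniform. *)
Lemma goursat_integrable_right : exists A : R, forall i, mu2.-integrable (rray A `*` setT) (EFin \o Phi i).
Proof.
have [A hA] := truncated_bound; exists A => i.
pose c := (2 * C)^-1.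
have key m : (\int[mu2]_(z in cut A m%:R m%:R) (hh z)%:E <= c%:E)%E.
  pose B := `|A| + m%:R + 1.
  have B1 : 0 < Num.max A m%:R + B.
    have h1 : A <= Num.max A m%:R by rewrite le_max lexx.
    have h2 := ler_norm (- A); rewrite normrN in h2.
    have h3 : 0 <= m%:R :> R by [].
    by rewrite /B; lra.
  have [A' A'1 hA'] := hA (Num.max A m%:R) B B1 (ltac:(by rewrite le_max lexx)).
  have A'm : m%:R <= A' by apply: le_trans A'1; rewrite le_max lexx orbT.
  pose N := Num.max A' B.
  have sub : cut A A' B `<=` lray N `*` lray N.
    move=> z [] /=; rewrite !in_itv /= => /andP[_ h1] h2.
    by rewrite /N !le_max h1 h2 orbT.
  have mA' : measurable (cut A A' B : set (measurableTypeR R * measurableTypeR R)) by exact: measurableX.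
  have i1 : mu2.-integrable (cut A A' B) (EFin \o hh).
    by apply: integrableS (hhi N) => //; exact: measurableX.
  apply: (@le_trans _ _ (\int[mu2]_(z in cut A A' B) (hh z)%:E)%E).
    apply: ge0_subset_integral => //.
    - exact: measurableX.
    - by apply/measurable_EFinP; exact: measurable_funTS.
    - by move=> z _; rewrite lee_fin.
    move=> z [] /=; rewrite !in_itv /= => /andP[h1 h2] h3; split => /=.
      by rewrite in_itv /= h1 (le_trans h2).
    rewrite in_itv /= (le_trans h3)// /B.
    by have := normr_ge0 A; lra.
  by rewrite -Rintegral_EFin// lee_fin.
pose E m := cut A m%:R m%:R.
have mE m : measurable (E m : set (measurableTypeR R * measurableTypeR R)) by exact: measurableX.
have EU : rray A `*` setT = \bigcup_m E m.
  apply/seteqP; split => [[x y] [/= h _]|z [m _] [/= h _]]; last first.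
    by split => //=; move: h; rewrite !in_itv /= andbT => /andP[].
  exists (maxn (Num.bound `|x|) (Num.bound `|y|)) => //=; split => /=; rewrite !in_itv /=.
    move: h; rewrite in_itv /= andbT => ->/=.
    apply: le_trans (ler_norm _) _; apply: le_trans (ltW (archi_boundP _)) _ => //.
    by rewrite ler_nat leq_maxl.
  apply: le_trans (ler_norm _) _; apply: le_trans (ltW (archi_boundP _)) _ => //.
  by rewrite ler_nat leq_maxr.
have ndE : nondecreasing_seq E.
  move=> m1 m2 m12; apply/subsetPset => z [] /=; rewrite !in_itv /= => /andP[h1 h2] h3.
  split => /=; rewrite in_itv /= ?h1 ?(le_trans h2) ?(le_trans h3) ?ler_nat//.
have mU : measurable (rray A `*` setT : set (measurableTypeR R * measurableTypeR R)) by exact: measurableX.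
have hb : (\int[mu2]_(z in rray A `*` setT) (hh z)%:E <= c%:E)%E.
  rewrite EU.
  have cv : (\int[mu2]_(x in E i) (hh x)%:E @[i --> \oo] -->
      \int[mu2]_(x in \bigcup_i E i) (hh x)%:E)%E.
    apply: (@ge0_nondecreasing_set_cvg_integral _ (measurableTypeR R * measurableTypeR R)%type R E) => //.
      by move=> m; apply/measurable_EFinP; exact: measurable_funTS.
    by move=> m z _; rewrite lee_fin.
  rewrite -(cvg_lim _ cv)//; apply: lime_le; first by apply/cvg_ex; eexists; exact: cv.
  by near=> m; exact: key.
apply/integrableP; split.
  by apply/measurable_EFinP; apply: measurable_funTS; exact: (mPhi i).
apply: le_lt_trans (ltry c); apply: le_trans hb; apply: ge0_le_integral => //.
- apply: measurableT_comp => //; apply/measurable_EFinP.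
  by apply: measurable_funTS; exact: (mPhi i).
- by apply/measurable_EFinP; exact: measurable_funTS.
- move=> z _; rewrite lee_fin /hh (bigD1 i)//= lerDl; exact: sumr_ge0.
Unshelve. all: by end_near.
Qed.

End goursat_system.

(** The exchange of the two characteristic variables also exchanges P and Q, so the
    source is integrable over xi > A and over sigma > B; the rest of the plane
    is a quadrant, where integrability is assumed. *)
Lemma goursat_integrable (n : nat) (Phi : 'I_n -> R * R -> R) (p0 q0 : 'I_n -> R -> R)
    (g : R * R -> R) (C M : R) : 0 < C -> 0 < M ->
  (forall i z, z.1 + z.2 < 0 -> Phi i z = 0) ->
  (forall i N, mu2.-integrable (lray N `*` lray N) (EFin \o Phi i)) ->
  (forall i, mu.-integrable setT (EFin \o p0 i)) ->
  (forall i, mu.-integrable setT (EFin \o q0 i)) ->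
  mu2.-integrable setT (EFin \o g) -> (forall z, 0 <= g z) ->
  {ae mu2, forall z, 0 <= z.1 + z.2 -> \sum_i `|Phi i z| <=
    C * (\sum_i `|P_of Phi p0 i z|) * (\sum_i `|Q_of Phi q0 i z|) + g z} ->
  (forall T, 0 < T -> (\int[mu2]_(z in strip T) (\sum_i `|P_of Phi p0 i z|)%:E <= (M * T)%:E)%E) ->
  (forall T, 0 < T -> (\int[mu2]_(z in strip T) (\sum_i `|Q_of Phi q0 i z|)%:E <= (M * T)%:E)%E) ->
  forall i, mu2.-integrable setT (EFin \o Phi i).
Proof.
move=> C0 M0 Phi0 Phii p0i q0i gi g0 Phile PM QM i.
have [A hA] := goursat_integrable_right C0 M0 Phi0 Phii p0i q0i gi g0 Phile QM.
have mPhi i0 : measurable_fun setT (Phi i0) by exact: quadrant_integrable_measurable.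
pose Phi' i0 := Phi i0 \o swp.
have Phi'i i0 N : mu2.-integrable (lray N `*` lray N) (EFin \o Phi' i0).
  have mN : measurable (lray N `*` lray N : set (measurableTypeR R * measurableTypeR R)) by exact: measurableX.
  apply/(restrict_integrable mu2) => //.
  have := integrable_swp ((restrict_integrable mu2 (Phi i0) mN).2 (Phii i0 N)).
  congr (mu2.-integrable setT); apply/funext => z; congr EFin; rewrite /= !patchE.
  by congr (if _ then _ else _); apply/idP/idP => /set_mem[h1 h2]; apply/mem_set; split.
have Phile' : {ae mu2, forall z, 0 <= z.1 + z.2 -> \sum_i `|Phi' i z| <=
    C * (\sum_i `|P_of Phi' q0 i z|) * (\sum_i `|Q_of Phi' p0 i z|) + (g \o swp) z}.
  apply: ae2S (ae2_swp Phile) => -[x y] /=; rewrite addrC => h xy.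
  by apply: le_trans (h xy) _; rewrite lerD2r -!mulrA ler_wpM2l ?(ltW C0)// mulrC.
have QM' T : 0 < T -> (\int[mu2]_(z in strip T) (\sum_i `|Q_of Phi' p0 i z|)%:E <= (M * T)%:E)%E.
  move=> T0; apply: le_trans (PM T T0); rewrite le_eqVlt; apply/orP; left; apply/eqP.
  have mP : measurable_fun setT (fun z => \sum_i `|P_of Phi p0 i z|).
    apply: measurable_sum => i0; apply: measurableT_comp => //.
    apply: measurable_funD.
      apply: measurableT_comp; last exact: measurable_fst.
      by have /integrableP[/measurable_EFinP] := p0i i0.
    by apply: measurable_funM => //; exact: measurable_partial.
  rewrite integral_mkcond [RHS]integral_mkcond -[RHS]ge0_integral_swp.
  - apply: eq_integral => -[x y] _; rewrite !patchE /=.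
    congr (if _ then _ else _); apply/idP/idP => /set_mem h1; apply/mem_set;
     by move: h1; rewrite /strip /= addrC.
  - apply/(measurable_restrictT _ _).1; first exact: measurable_strip.
    by apply/measurable_EFinP; exact: measurable_funTS.
  - by move=> z; rewrite patchE; case: ifP => // _; rewrite lee_fin sumr_ge0.
have [B hB] := goursat_integrable_right C0 M0 (Phi := Phi') (fun i0 z h => Phi0 i0 (swp z)
  (ltac:(by move: h; rewrite addrC))) Phi'i q0i p0i (integrable_swp gi)
  (fun z => g0 (swp z)) Phile' QM'.
pose N := Num.max A B.
have mA : measurable (rray A `*` setT : set (measurableTypeR R * measurableTypeR R)) by exact: measurableX.
have mB : measurable (rray B `*` setT : set (measurableTypeR R * measurableTypeR R)) by exact: measurableX.
have mN : measurable (lray N `*` lray N : set (measurableTypeR R * measurableTypeR R)) by exact: measurableX.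
have i1 := (restrict_integrable mu2 (Phi i) mA).2 (hA i).
have i2 := integrable_swp ((restrict_integrable mu2 (Phi' i) mB).2 (hB i)).
have i3 := (restrict_integrable mu2 (Phi i) mN).2 (Phii i N).
have := integrableD measurableT (integrable_norm i1)
  (integrableD measurableT (integrable_norm i2) (integrable_norm i3)).
apply: le_integrable => //; first by apply/measurable_EFinP; exact: mPhi.
move=> z _ /=; rewrite lee_fin !patchE.
rewrite [leRHS]ger0_norm ?addr_ge0//.
have Ph : Phi' i (swp z) = Phi i z by rewrite /Phi' /= /swp; case: (z).
case: (ltP A z.1) => h1.
  rewrite mem_set /=; last by split => //=; rewrite in_itv /= h1.
  by rewrite lerDl addr_ge0.
case: (ltP B z.2) => h2.
  rewrite (_ : (swp z \in rray B `*` setT) = true); last first.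
    by apply/mem_set; split => //=; rewrite in_itv /= h2.
  rewrite Ph addrCA lerDl addr_ge0//.
rewrite (_ : (z \in lray N `*` lray N) = true); last first.
  by apply/mem_set; split => //=; rewrite in_itv /= /N le_max ?h1 ?h2 ?orbT.
by rewrite addrA lerDr addr_ge0.
Qed.

End core.

(** * Smooth steps *)
Section flat_functions.
Context {R : realType}.

(** The functions p (1 / x) exp (- 1 / x), continued by zero.  Letting p range over all
    polynomials makes the family closed under differentiation, so that smoothness
    is an induction which never mentions the order of the derivative. *)
Definition flat (p : {poly R}) (x : R) : R :=
  if 0 < x then p.[x^-1] * expR (- x^-1) else 0.

Definition dflat (p : {poly R}) : {poly R} := 'X^2 * (p - p^`()).

(** The exponential dominates each power of 1 / x; the order 2 is what the
    derivative at the origin needs. *)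
Lemma flat_small p : exists2 C : R, 0 <= C & forall x, `|flat p x| <= C * x ^+ 2.
Proof.
exists (\sum_(i < size p) `|p`_i| * (i.+2)`!%:R); first by apply: sumr_ge0 => i _; rewrite mulr_ge0.
move=> x; rewrite /flat; case: ifPn => [x0|_]; last first.
  by rewrite normr0 mulr_ge0 ?sqr_ge0// sumr_ge0 => // i _; rewrite mulr_ge0.
rewrite normrM (ger0_norm (expR_ge0 _)) horner_coef.
apply: le_trans (ler_wpM2r (expR_ge0 _) (ler_norm_sum _ _ _)) _.
rewrite !mulr_suml; apply: ler_sum => i _.
rewrite normrM -!mulrA ler_wpM2l//.
have y0 : 0 < x^-1 by rewrite invr_gt0.
rewrite normrX gtr0_norm// expRN.
have := expR_ge1Dxn i.+1 (ltW y0).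
set E := expR _ => hE.
have E0 : 0 < E by exact: expR_gt0.
have f0 : 0 < (i.+2)`!%:R :> R by rewrite ltr0n fact_gt0.
rewrite ler_pdivrMr//.
have h2 : x^-1 ^+ i.+2 / (i.+2)`!%:R <= E by apply: le_trans hE; rewrite lerDr.
have -> : x^-1 ^+ i = (i.+2)`!%:R * x ^+ 2 * (x^-1 ^+ i.+2 / (i.+2)`!%:R).
  rewrite !exprS; field; rewrite ?gt_eqF//.
by rewrite ler_wpM2l// mulr_ge0// ?sqr_ge0// ltW.
Qed.

Lemma is_derive_flat p (x : R) : is_derive x (1 : R) (flat p) (flat (dflat p) x).
Proof.
have [x0|x0|x0] := ltgtP 0 x.
- rewrite /flat x0.
  have h1 : is_derive x (1 : R) (fun y => p.[y^-1] * expR (- y^-1))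
     ((dflat p).[x^-1] * expR (- x^-1)).
    have iV : is_derive x (1 : R) (fun y : R => y^-1) (- x ^- 2 *: 1).
      by apply: is_deriveV; rewrite gt_eqF.
    have ip : is_derive (x^-1) (1 : R) (horner p) (p^`().[x^-1]) by exact: is_derive_poly.
    have i1 := @is_derive1_comp _ _ _ _ _ _ ip iV.
    have i2 : is_derive x (1 : R) (fun y : R => - y^-1) (- (- x ^- 2 *: 1)).
      exact: is_deriveN.
    have i3 := @is_derive1_comp _ _ _ _ _ _ (is_derive_expR _) i2.
    apply: (is_derive_eq (is_deriveM i1 i3)).
    rewrite /dflat !hornerE /= /GRing.scale /= !mulr1 exprVn; ring.
  apply: near_eq_is_derive h1.
  by near=> y; rewrite ifT//; near: y; exact: lt_nbhsr.
- rewrite /flat [in X in is_derive _ _ _ X]ifF; last by apply/negbTE; rewrite -leNgt ltW.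
  apply: near_eq_is_derive (is_derive_cst 0 _ _).
  by near=> y; rewrite ifF//; apply/negbTE; rewrite -leNgt ltW//; near: y; exact: lt_nbhsl.
rewrite -x0 {2}/flat ltxx.
have [C C0 hC] := flat_small p.
have cv : h^-1 *: ((flat p \o shift 0) (h *: 1) - flat p 0) @[h --> 0^'] --> (0 : R).
  apply/cvgrPdist_le => e e0; near=> h.
  rewrite sub0r normrN /= addr0 /flat ltxx subr0 -/(flat p (h *: 1)) normrM.
  rewrite [h *: 1]mulr1.
  have h0 : h != 0 by near: h; exact: nbhs_dnbhs_neq.
  have hh : `|h| * (C + 1) <= e.
    rewrite -ler_pdivlMr ?ltr_wpDl//.
    near: h; apply: dnbhs0_le; rewrite divr_gt0// ltr_wpDl//.
  apply: le_trans hh; rewrite normrV ?unitfE// ler_pdivrMl ?normr_gt0//.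
  apply: le_trans (hC h) _; rewrite [leRHS]mulrA -normrM -expr2 ger0_norm ?sqr_ge0// mulrC.
  by rewrite ler_wpM2l ?sqr_ge0// lerDl.
apply: DeriveDef; first by apply/cvg_ex; exists 0; exact: cv.
exact: cvg_lim cv.
Unshelve. all: by end_near.
Qed.

Lemma continuous_flat p : continuous (flat p).
Proof.
move=> x; apply: differentiable_continuous; apply/derivable1_diffP.
by have [] := is_derive_flat p x.
Qed.

Definition step (x : R) : R := flat 1 x.
(** With p = 1 the derivative is exp (- 1 / x) / x ^ 2 on x > 0, a probability
    density: rescaled, it is an approximate identity concentrated on one side. *)
Definition dstep (x : R) : R := flat (dflat 1) x.

Lemma stepE x : 0 < x -> step x = expR (- x^-1).
Proof. by move=> x0; rewrite /step /flat x0 hornerC mul1r. Qed.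

Lemma step_eq0 x : x <= 0 -> step x = 0.
Proof. by move=> x0; rewrite /step /flat ltNge x0. Qed.

Lemma dstep_eq0 x : x <= 0 -> dstep x = 0.
Proof. by move=> x0; rewrite /dstep /flat ltNge x0. Qed.

Lemma step_ge0 x : 0 <= step x.
Proof. by have [x0|x0] := leP x 0; [rewrite step_eq0|rewrite stepE// expR_ge0]. Qed.

Lemma step_le1 x : step x <= 1.
Proof.
have [x0|x0] := leP x 0; first by rewrite step_eq0.
by rewrite stepE// expR_le1 oppr_le0 invr_ge0 ltW.
Qed.

Lemma dstep_ge0 x : 0 <= dstep x.
Proof.
rewrite /dstep /flat; case: ifP => // x0; rewrite mulr_ge0 ?expR_ge0//.
by rewrite /dflat derivC subr0 mulr1 hornerXn sqr_ge0.
Qed.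

Lemma is_derive_step x : is_derive x (1 : R) step (dstep x).
Proof. exact: is_derive_flat. Qed.

Lemma continuous_step : continuous step. Proof. exact: continuous_flat. Qed.
Lemma continuous_dstep : continuous dstep. Proof. exact: continuous_flat. Qed.

Lemma step_cvg1 : step x @[x --> +oo] --> (1 : R).
Proof.
have h : expR (- x^-1) @[x --> +oo] --> (1 : R).
  rewrite -[X in _ --> X]expR0; apply: continuous_cvg; first exact: continuous_expR.
  rewrite -[X in _ --> X]oppr0; apply: cvgN.
  by apply/(gtr0_cvgV0 (f := id)) => //; near=> x; near: x; exact: nbhs_pinfty_gt.
apply: cvg_trans h; apply: near_eq_cvg; near=> x.
by rewrite stepE//; near: x; exact: nbhs_pinfty_gt.
Unshelve. all: by end_near.
Qed.

Lemma dstep_integral : (@lebesgue_measure R).-integrable setT (EFin \o dstep) /\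
  \int[@lebesgue_measure R]_x dstep x = 1.
Proof.
have E : (\int[@lebesgue_measure R]_x (dstep x)%:E = 1)%E.
  transitivity (\int[@lebesgue_measure R]_(x in `[0%R, +oo[) (dstep x)%:E)%E.
    rewrite [RHS]integral_mkcond; apply: eq_integral => x _; rewrite patchE.
    case: ifPn => //; rewrite notin_setE /= in_itv /= andbT => /negP; rewrite -ltNge => x0.
    by rewrite dstep_eq0// ltW.
  rewrite (@ge0_continuous_FTC2y R dstep step 0 1).
  - by rewrite step_eq0// sube0.
  - by move=> x _; exact: dstep_ge0.
  - by apply: continuous_subspaceT; exact: continuous_dstep.
  - exact: step_cvg1.
  - by move=> x _; have [] := is_derive_step x.
  - by apply: cvg_at_right_filter; exact: continuous_step.
  - by move=> x _; rewrite derive1E; have [] := is_derive_step x.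
have mE : measurable_fun setT dstep by apply: continuous_measurable_fun; exact: continuous_dstep.
split; last by rewrite /Rintegral E.
apply/integrableP; split; first exact/measurable_EFinP.
under eq_integral do rewrite gee0_abs ?lee_fin ?dstep_ge0//.
by rewrite E ltry.
Qed.

End flat_functions.

(** * Cutoffs and the limits they produce *)
Section cutoffs.
Context {R : realType}.
Notation mu := (@lebesgue_measure R).

Lemma dominated_cvg_Rintegral d (T : measurableType d) (m : {measure set T -> \bar R})
    (D : set T) (f_ : nat -> T -> R) (f g : T -> R) : measurable D ->
  (forall n, measurable_fun D (f_ n)) -> (forall x, D x -> f_ n x @[n --> \oo] --> f x) ->
  m.-integrable D (EFin \o g) -> (forall n x, D x -> `|f_ n x| <= g x) ->
  \int[m]_(x in D) f_ n x @[n --> \oo] --> \int[m]_(x in D) f x.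
Proof.
move=> mD mf_ cvf gi fg.
have mEf_ n : measurable_fun D (EFin \o f_ n) by exact/measurable_EFinP.
have cvE x : D x -> (EFin \o f_ n) x @[n --> \oo] --> (f x)%:E.
  by move=> Dx; apply: cvg_EFin; [near=> n|exact: cvf].
have mEf : measurable_fun D (EFin \o f).
  by apply: (emeasurable_fun_cvg (fun n => EFin \o f_ n)) => //.
have cv : (\int[m]_(x in D) (EFin \o f_ n) x)%E @[n --> \oo] --> (\int[m]_(x in D) (EFin \o f) x)%E.
  by apply: (dominated_cvg mD _ _ _ gi) => // n x Dx; rewrite /= lee_fin fg.
have fi : m.-integrable D (EFin \o f).
  apply: le_integrable gi => // x Dx; rewrite /= lee_fin.
  have g0 : 0 <= g x by apply: le_trans (fg 0%N x Dx).
  rewrite (ger0_norm g0); have cvn : `|f_ n x| @[n --> \oo] --> `|f x| by apply: cvg_norm; exact: cvf.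
  rewrite -(cvg_lim (@Rhausdorff R) cvn); apply: limr_le; first by apply/cvg_ex; eexists; exact: cvn.
  by near=> n; exact: fg.
have := cv; rewrite -Rintegral_EFin//.
by move=> /fine_cvgP[].
Unshelve. all: by end_near.
Qed.

(** A smooth function with support [a, b], converging to 1 inside as k grows, and
    its derivative, the difference of two one-sided bumps at a and b. *)
Definition cutoff (a b : R) (k x : R) := step (k * (x - a)) * step (k * (b - x)).
Definition dcutoff (a b : R) (k x : R) :=
  k * dstep (k * (x - a)) * step (k * (b - x)) - k * step (k * (x - a)) * dstep (k * (b - x)).

Lemma is_derive_affine (F f : R -> R) (c e x : R) : (forall x : R, is_derive x (1 : R) F (f x)) ->
  is_derive x (1 : R) (fun x => F (c * x + e)) (c * f (c * x + e)).
Proof.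
move=> Ff.
have i1 : is_derive x (1 : R) (fun x => c * x + e) c.
  apply: (is_derive_eq (is_deriveD (is_deriveZ c (is_derive_id x 1)) (is_derive_cst e x 1))).
  by rewrite addr0 [_ *: _]mulr1.
rewrite [c * f _]mulrC; exact: (@is_derive1_comp _ F (fun x => c * x + e) _ _ _ (Ff (c * x + e)) i1).
Qed.

Lemma is_derive_cutoff a b k x : is_derive x (1 : R) (cutoff a b k) (dcutoff a b k x).
Proof.
have E1 : (fun x => step (k * (x - a))) = (fun x => step (k * x + - (k * a))).
  by apply/funext => y; congr step; ring.
have E2 : (fun x => step (k * (b - x))) = (fun x => step (- k * x + k * b)).
  by apply/funext => y; congr step; ring.
have i1 := is_derive_affine k (- (k * a)) x is_derive_step.
have i2 := is_derive_affine (- k) (k * b) x is_derive_step.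
rewrite -E1 in i1; rewrite -E2 in i2.
apply: (is_derive_eq (is_deriveM i1 i2)).
rewrite /dcutoff /GRing.scale /=.
have -> : k * x + - (k * a) = k * (x - a) by ring.
have -> : - k * x + k * b = k * (b - x) by ring.
ring.
Qed.

Lemma cutoff_ge0 a b k x : 0 <= cutoff a b k x.
Proof. by rewrite mulr_ge0 ?step_ge0. Qed.

Lemma cutoff_le1 a b k x : cutoff a b k x <= 1.
Proof. by rewrite mulr_ile1 ?step_ge0 ?step_le1. Qed.

Lemma cutoff_out a b k x : 0 <= k -> ~~ (a < x < b) -> cutoff a b k x = 0 /\ dcutoff a b k x = 0.
Proof.
move=> k0; rewrite negb_and -!leNgt /cutoff /dcutoff => /orP[h|h].
  have h1 : k * (x - a) <= 0 by rewrite mulr_ge0_le0// subr_le0.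
  by rewrite (step_eq0 h1) (dstep_eq0 h1) !(mulr0, mul0r) subr0.
have h1 : k * (b - x) <= 0 by rewrite mulr_ge0_le0// subr_le0.
by rewrite (step_eq0 h1) (dstep_eq0 h1) !(mulr0, mul0r) subr0.
Qed.

Lemma continuous_affine (c e : R) : continuous (fun x : R => c * x + e).
Proof. by move=> x; apply: cvgD; [apply: cvgM; [exact: cvg_cst|exact: cvg_id]|exact: cvg_cst]. Qed.

Lemma continuous_comp_affine (F : R -> R) (c e : R) : continuous F -> continuous (fun x => F (c * x + e)).
Proof. by move=> cF x; apply: continuous_comp; [exact: continuous_affine|exact: cF]. Qed.

Lemma continuous_cutoff a b k : continuous (cutoff a b k).
Proof.
move=> x; apply: differentiable_continuous; apply/derivable1_diffP.
by have [] := is_derive_cutoff a b k x.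
Qed.

Lemma continuous_dcutoff a b k : continuous (dcutoff a b k).
Proof.
rewrite (_ : dcutoff a b k = fun x => k * dstep (k * x + - (k * a)) * step (- k * x + k * b)
   - k * step (k * x + - (k * a)) * dstep (- k * x + k * b)); last first.
  by apply/funext => x; rewrite /dcutoff; congr (_ * dstep _ * step _ - _ * step _ * dstep _); ring.
have h (F : R -> R) (c e : R) : continuous F -> continuous (fun x : R => F (c * x + e)) by exact: continuous_comp_affine.
move=> x; apply: cvgB; apply: cvgM; (try apply: cvgM); try exact: cvg_cst;
  apply: h; (exact: continuous_step || exact: continuous_dstep).
Qed.

Lemma nat_mul_cvgy (y : R) : 0 < y -> n.+1%:R * y @[n --> \oo] --> +oo.
Proof.
move=> y0; apply/cvgryPge => M; near=> n.
rewrite -ler_pdivrMr//; apply: (@le_trans _ _ n%:R); last by rewrite ler_nat.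
near: n; exact: nbhs_infty_ger.
Unshelve. all: by end_near.
Qed.

Lemma cutoff_cvg a b x : a < x < b -> cutoff a b n.+1%:R x @[n --> \oo] --> (1 : R).
Proof.
move=> /andP[ax xb]; rewrite -[X in _ --> X]mulr1; apply: cvgM.
  by apply: (cvg_comp _ _ (nat_mul_cvgy _) step_cvg1); rewrite subr_gt0.
by apply: (cvg_comp _ _ (nat_mul_cvgy _) step_cvg1); rewrite subr_gt0.
Qed.

Lemma bounded_on_itv (w : R -> R) (a b : R) : continuous w -> a <= b ->
  exists2 K : R, 0 <= K & forall x, a <= x <= b -> `|w x| <= K.
Proof.
move=> cw ab.
have cn : {within `[a, b], continuous (fun x => `|w x|)}.
  by apply: continuous_subspaceT => x; apply: cvg_norm; exact: cw.
have [c _ hc] := EVT_max ab cn.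
by exists `|w c| => // x xab; apply: hc; rewrite in_itv.
Qed.

(** After the rescaling y = n (x - a) the bump becomes the fixed density [dstep], and
    the other two factors converge to 1 and to w a. *)
Lemma left_bump_cvg (w : R -> R) (a b : R) : continuous w -> a < b ->
  \int[mu]_(x in `[a, b]) (n.+1%:R * dstep (n.+1%:R * (x - a)) * step (n.+1%:R * (b - x)) * w x)
    @[n --> \oo] --> w a.
Proof.
move=> cw ab.
(* w is frozen outside [a, b] to have a bounded continuous function on the line *)
pose wt x := w (Num.max a (Num.min x b)).
have cwt : continuous wt.
  move=> x; apply: continuous_comp; last exact: cw.
  by apply: continuous_max; [exact: cvg_cst|apply: continuous_min; [exact: cvg_id|exact: cvg_cst]].
have [K K0 hK] := bounded_on_itv cw (ltW ab).
have wtK x : `|wt x| <= K.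
  by apply: hK; rewrite le_max lexx /= ge_max (ltW ab) /= ge_min lexx orbT.
have [di dE] := @dstep_integral R.
pose h n y := dstep y * step (n.+1%:R * (b - a) - y) * wt (n.+1%:R^-1 * y + a).
have ch n : continuous (h n).
  have cwn : continuous (fun y : R => wt (n.+1%:R^-1 * y + a)) by exact: continuous_comp_affine.
  have csn : continuous (fun y : R => step (n.+1%:R * (b - a) - y)).
    rewrite (_ : (fun y => _) = (fun y => step (-1 * y + n.+1%:R * (b - a)))).
      by apply: continuous_comp_affine; exact: continuous_step.
    by apply/funext => y; congr step; ring.
  move=> y; apply: cvgM; last exact: cwn.
  apply: cvgM; first exact: continuous_dstep.
  exact: csn.
have mh n : measurable_fun setT (h n) by apply: continuous_measurable_fun; exact: ch.
have hle n y : setT y -> `|h n y| <= K * dstep y.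
  move=> _; rewrite /h !normrM (ger0_norm (dstep_ge0 _)) (ger0_norm (step_ge0 _)) mulrC.
  apply: ler_pM => //; first by rewrite mulr_ge0 ?dstep_ge0 ?step_ge0.
  by rewrite ler_piMr ?dstep_ge0 ?step_le1.
have gi : mu.-integrable setT (EFin \o (fun y => K * dstep y)).
  exact: (integrableZl measurableT K di).
have hi n : mu.-integrable setT (EFin \o h n).
  apply: le_integrable gi; [by []|by apply/measurable_EFinP; exact: (mh n)|].
  move=> y _; rewrite /= lee_fin; apply: le_trans (hle n y I) _; exact: ler_norm.
have cvh y : setT y -> h n y @[n --> \oo] --> dstep y * w a.
  move=> _; rewrite (_ : dstep y * w a = dstep y * 1 * w a); last by rewrite mulr1.
  apply: cvgM.
    apply: cvgM; first exact: cvg_cst.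
    apply: (cvg_comp _ _ _ step_cvg1).
    rewrite (_ : (fun n => _) = (fun n => - y + n.+1%:R * (b - a))); last first.
      by apply/funext => n; rewrite addrC.
    apply/cvgryPge => M; have /cvgryPge/(_ (M + y)) := nat_mul_cvgy (y := b - a) (ltac:(by rewrite subr_gt0)).
    by apply: filterS => n h2; rewrite -lerBlDl opprK.
  have -> : w a = wt (0 * y + a).
    by rewrite /wt mul0r add0r /Num.min ab /Num.max ltxx.
  apply: continuous_cvg; first exact: cwt.
  apply: cvgD; last exact: cvg_cst.
  apply: cvgM; last exact: cvg_cst.
  exact: cvg_harmonic.
have := @dominated_cvg_Rintegral _ (measurableTypeR R) mu setT h _ _ measurableT mh cvh gi hle.
rewrite RintegralZr// dE mul1r; apply: cvg_trans; apply: near_eq_cvg; near=> n.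
have k0 : n.+1%:R != 0 :> R by [].
have [gn ->] := Rintegral_affine (- (n.+1%:R * a)) k0 (hi n).
rewrite [RHS]Rintegral_mkcond; transitivity (\int[mu]_x (`|n.+1%:R| * h n (n.+1%:R * x - n.+1%:R * a))).
  by rewrite RintegralZl.
apply: eq_Rintegral => x _; rewrite patchE /h.
have -> : n.+1%:R * x - n.+1%:R * a = n.+1%:R * (x - a) by ring.
have -> : n.+1%:R * (b - a) - n.+1%:R * (x - a) = n.+1%:R * (b - x) by ring.
rewrite (mulKf k0) subrK gtr0_norm//.
case: ifPn.
  rewrite inE /= in_itv /= => /andP[ax xb].
  have -> : wt x = w x.
    rewrite /wt; congr w; rewrite (min_idPl xb); exact/max_idPr.
  by rewrite !mulrA.
rewrite notin_setE /= in_itv /= => /negP; rewrite negb_and -!ltNge => /orP[h1|h1].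
  by rewrite dstep_eq0 ?mul0r ?mulr0// pmulr_rle0// subr_le0 ltW.
by rewrite (step_eq0 (x := _ * (b - x))) ?mulr0 ?mul0r ?mulr0// pmulr_rle0// subr_le0 ltW.
Unshelve. all: by end_near.
Qed.

(** The derivative of a function climbing from 0 to 1 at a and descending at b tests w
    against a point mass at a minus one at b.  The bump at b is the reflection of
    the one at a. *)
Lemma dcutoff_cvg (w : R -> R) (a b : R) : continuous w -> a < b ->
  \int[mu]_(x in `[a, b]) (dcutoff a b n.+1%:R x * w x) @[n --> \oo] --> w a - w b.
Proof.
move=> cw ab.
pose f1 n x := n.+1%:R * dstep (n.+1%:R * (x - a)) * step (n.+1%:R * (b - x)) * w x.
pose f2 n x := n.+1%:R * step (n.+1%:R * (x - a)) * dstep (n.+1%:R * (b - x)) * w x.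
have ca (F : R -> R) (c e : R) : continuous F -> continuous (fun x : R => F (c * x + e)).
  exact: continuous_comp_affine.
have cA (F : R -> R) n : continuous F -> continuous (fun x => F (n.+1%:R * (x - a))).
  move=> cF; rewrite (_ : (fun x => _) = (fun x => F (n.+1%:R * x + - (n.+1%:R * a)))); first exact: ca.
  by apply/funext => x; congr F; ring.
have cB (F : R -> R) n : continuous F -> continuous (fun x => F (n.+1%:R * (b - x))).
  move=> cF; rewrite (_ : (fun x => _) = (fun x => F (- n.+1%:R * x + n.+1%:R * b))); first exact: ca.
  by apply/funext => x; congr F; ring.
have ic (F : R -> R) (x y : R) : continuous F -> mu.-integrable `[x, y] (EFin \o F).
  by move=> cF; apply: continuous_compact_integrable; [exact: segment_compact|exact: continuous_subspaceT].
have c1 n : continuous (f1 n).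
  move=> x; apply: cvgM; last exact: cw.
  apply: cvgM; last exact: (cB step n continuous_step).
  apply: cvgM; [exact: cvg_cst|exact: (cA dstep n continuous_dstep)].
have c2 n : continuous (f2 n).
  move=> x; apply: cvgM; last exact: cw.
  apply: cvgM; last exact: (cB dstep n continuous_dstep).
  apply: cvgM; [exact: cvg_cst|exact: (cA step n continuous_step)].
have E n : \int[mu]_(x in `[a, b]) (dcutoff a b n.+1%:R x * w x) =
    \int[mu]_(x in `[a, b]) f1 n x - \int[mu]_(x in `[a, b]) f2 n x.
  rewrite -RintegralB//; [|exact: ic|exact: ic].
  by apply: eq_Rintegral => x _; rewrite /dcutoff /f1 /f2; ring.
under eq_fun do rewrite E.
apply: cvgB; first exact: left_bump_cvg.
have cw' : continuous (fun x => w (- x)).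
  move=> x; apply: (@continuous_comp _ _ _ -%R w); [exact: opp_continuous|exact: cw].
have := left_bump_cvg (a := - b) (b := - a) cw' (ltac:(by rewrite ltrN2)).
rewrite opprK; apply: cvg_trans; apply: near_eq_cvg; near=> n.
rewrite [LHS]Rintegral_mkcond [RHS]Rintegral_mkcond.
have i2 : mu.-integrable setT (EFin \o (f2 n \_ `[a, b])).
  by apply/(restrict_integrable mu) => //; exact: ic.
have [_ <-] := Rintegral_reflect i2.
apply: eq_Rintegral => x _; rewrite !patchE.
have -> : (- x \in `[a, b]%classic) = (x \in `[- b, - a]%classic).
  by apply/idP/idP; rewrite !inE /= !in_itv /= => /andP[h1 h2]; apply/andP; split; lra.
case: ifP => // _; rewrite /f2.
have -> : x + b = b - - x by ring.
have -> : - a - x = - x - a by ring.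
ring.
Unshelve. all: by end_near.
Qed.

End cutoffs.

(** * Test functions in characteristic coordinates *)
Section test_functions.
Context {R : realType}.

Lemma is_derive_direction (f : R * R -> R) (z v : R * R) (l : R) :
  is_derive (0 : R) (1 : R) (fun h : R => f (h *: v + z)) l -> is_derive z v f l.
Proof.
move=> [df fl]; apply: DeriveDef; first exact/derivable1P.
rewrite -fl /derive; set g1 := fun h => h^-1 *: _; set g2 := fun h => h^-1 *: _.
suff -> : g1 = g2 by [].
by apply/funext => h; rewrite /g1 /g2 /= addr0 scale0r add0r [_%:A]mulr1.
Qed.

Lemma is_derive_linear_form (F f : R -> R) (a b c : R) (z v : R * R) :
  (forall x : R, is_derive x (1 : R) F (f x)) ->
  is_derive z v (fun z : R * R => F (a * z.1 + b * z.2 + c))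
    ((a * v.1 + b * v.2) * f (a * z.1 + b * z.2 + c)).
Proof.
move=> Ff; apply: is_derive_direction.
have := is_derive_affine (a * v.1 + b * v.2) (a * z.1 + b * z.2 + c) 0 Ff.
rewrite mulr0 add0r; congr (is_derive _ _ _ _).
by apply/funext => h /=; congr F; rewrite /GRing.scale /=; ring.
Qed.

(** The products of cutoffs are sums and products of flat functions of linear
    forms; this class is closed under all directional derivatives. *)
Inductive flat_expr : (R * R -> R) -> Prop :=
| flat_expr_flat p a b c : flat_expr (fun z => flat p (a * z.1 + b * z.2 + c))
| flat_expr_scale k f : flat_expr f -> flat_expr (fun z => k * f z)
| flat_expr_mul f g : flat_expr f -> flat_expr g -> flat_expr (fun z => f z * g z)
| flat_expr_add f g : flat_expr f -> flat_expr g -> flat_expr (fun z => f z + g z).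

Lemma continuous_linear_form (a b c : R) : continuous (fun z : R * R => a * z.1 + b * z.2 + c).
Proof.
move=> z; apply: cvgD; last exact: cvg_cst.
by apply: cvgD; apply: cvgM; (exact: cvg_cst || exact: cvg_fst || exact: cvg_snd).
Qed.

Lemma continuous_ch : continuous (@ch R).
Proof.
move=> z; apply: (@cvg_pair _ _ _ (nbhs z) (nbhs ((z.1 + z.2) / 2)) (nbhs ((z.1 - z.2) / 2))).
  rewrite (_ : (fun x : R * R => _) = (fun z => 2^-1 * z.1 + 2^-1 * z.2 + 0)).
    rewrite (_ : (z.1 + z.2) / 2 = 2^-1 * z.1 + 2^-1 * z.2 + 0); first exact: continuous_linear_form.
    by field.
  by apply/funext => u; field.
rewrite (_ : (fun x : R * R => _) = (fun z => 2^-1 * z.1 + - 2^-1 * z.2 + 0)).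
  rewrite (_ : (z.1 - z.2) / 2 = 2^-1 * z.1 + - 2^-1 * z.2 + 0); first exact: continuous_linear_form.
  by field.
by apply/funext => u; field.
Qed.

Lemma flat_expr_continuous f : flat_expr f -> continuous f.
Proof.
elim=> {f} [p a b c|k f _ cf|f g _ cf _ cg|f g _ cf _ cg] z.
- by apply: (@continuous_comp _ _ _ (fun z : R * R => a * z.1 + b * z.2 + c) (flat p));
    [exact: continuous_linear_form|exact: continuous_flat].
- by apply: cvgM; [exact: cvg_cst|exact: cf].
- by apply: cvgM; [exact: cf|exact: cg].
- by apply: cvgD; [exact: cf|exact: cg].
Qed.

Lemma flat_expr_derive f v : flat_expr f ->
  exists2 g, flat_expr g & forall z, is_derive z v f (g z).
Proof.
elim=> {f} [p a b c|k f _ [f' ef' df]|f g ef [f' ef' df] eg [g' eg' dg]|f g _ [f' ef' df] _ [g' eg' dg]].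
- exists (fun z => (a * v.1 + b * v.2) * flat (dflat p) (a * z.1 + b * z.2 + c)).
    exact/flat_expr_scale/flat_expr_flat.
  by move=> z; apply: is_derive_linear_form => x; exact: is_derive_flat.
- exists (fun z => k * f' z); first exact: flat_expr_scale.
  by move=> z; exact: (is_deriveZ k (df z)).
- exists (fun z => f z * g' z + g z * f' z).
    by apply: flat_expr_add; apply: flat_expr_mul.
  by move=> z; exact: (is_deriveM (df z) (dg z)).
- exists (fun z => f' z + g' z); first exact: flat_expr_add.
  by move=> z; exact: (is_deriveD (df z) (dg z)).
Qed.

Lemma flat_expr_smooth f : flat_expr f -> smooth f.
Proof.
move=> ef l /=; have : flat_expr (foldr (fun v h => 'D_v h) f l).
  elim: l => [//|v l IH] /=; have [g eg dg] := flat_expr_derive v IH.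
  suff -> : 'D_v (foldr (fun v h => 'D_v h) f l) = g by [].
  by apply/funext => z; have [] := dg z.
move=> e; split; first exact: flat_expr_continuous.
by move=> p v; have [g _ dg] := flat_expr_derive v e; have [] := dg p.
Qed.

(** Spelled out in (t, x), to be visibly a product of flat functions of linear forms. *)
Definition cutoff2 (a b c d k : R) (z : R * R) :=
  cutoff a b k (z.2 + z.1) * cutoff c d k (z.1 - z.2).

Lemma is_derive_cutoff2 a b c d k (z v : R * R) : is_derive z v (cutoff2 a b c d k)
  (cutoff a b k (z.2 + z.1) * ((v.1 - v.2) * dcutoff c d k (z.1 - z.2)) +
   cutoff c d k (z.1 - z.2) * ((v.2 + v.1) * dcutoff a b k (z.2 + z.1))).
Proof.
have i1 := is_derive_linear_form 1 1 0 z v (is_derive_cutoff a b k).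
have i2 := is_derive_linear_form 1 (-1) 0 z v (is_derive_cutoff c d k).
have E1 (u : R * R) : 1 * u.1 + 1 * u.2 + 0 = u.2 + u.1 by ring.
have E2 (u : R * R) : 1 * u.1 + -1 * u.2 + 0 = u.1 - u.2 by ring.
have := is_deriveM i1 i2; rewrite !E1 !E2.
have -> : 1 * v.1 + 1 * v.2 = v.2 + v.1 by ring.
have -> : 1 * v.1 + -1 * v.2 = v.1 - v.2 by ring.
congr (is_derive _ _ _ _).
by apply/funext => u; rewrite /cutoff2 -E1 -E2.
Qed.

(** The support is the image of the rectangle [a, b] x [c, d] by [ch], and
    t = (xi + sigma) / 2 >= (a + c) / 2 on it. *)
Lemma test_cutoff2 a b c d k : 0 <= k -> 0 < a + c -> test_function (cutoff2 a b c d k).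
Proof.
move=> k0 ac.
pose K := ch @` (`[a, b]%classic `*` `[c, d]%classic : set (R * R)).
have cK : compact K.
  apply: continuous_compact; first by apply: continuous_subspaceT; exact: continuous_ch.
  by apply: compact_setX; exact: segment_compact.
have clK : closed K by apply: compact_closed => //; exact: norm_hausdorff.
have sub : closure [set p | cutoff2 a b c d k p != 0] `<=` K.
  have KE : closure K = K by apply/esym/closure_id.
  rewrite -[X in _ `<=` X]KE; apply: closureS => p /= p0.
  exists (hc p); last exact: hcK.
  move: p0; rewrite /cutoff2 mulf_eq0 negb_or => /andP[h1 h2]; split => /=; rewrite in_itv /=.
    have [/andP[/ltW -> /ltW ->]//|h] := boolP (a < p.2 + p.1 < b).
    by have [h3 _] := cutoff_out k0 h; rewrite h3 eqxx in h1.
  have [/andP[/ltW -> /ltW ->]//|h] := boolP (c < p.1 - p.2 < d).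
  by have [h3 _] := cutoff_out k0 h; rewrite h3 eqxx in h2.
split.
- apply: flat_expr_smooth.
  rewrite (_ : cutoff2 a b c d k = fun z =>
    (flat 1 (k * z.1 + k * z.2 + - (k * a)) * flat 1 (- k * z.1 + - k * z.2 + k * b)) *
    (flat 1 (k * z.1 + - k * z.2 + - (k * c)) * flat 1 (- k * z.1 + k * z.2 + k * d))); last first.
    by apply/funext => z; rewrite /cutoff2 /cutoff /step; congr (flat _ _ * flat _ _ * (flat _ _ * flat _ _)); ring.
  by apply: flat_expr_mul; apply: flat_expr_mul; exact: flat_expr_flat.
- apply: subclosed_compact cK sub; exact: closed_closure.
- move=> p /sub[[x y] [/= ]]; rewrite !in_itv /= => /andP[ax _] /andP[cy _] <- /=.
  by rewrite divr_gt0//; lra.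
Qed.

End test_functions.

(** * Increments along a characteristic *)
Section characteristic_increment.
Context {R : realType}.
Notation mu := (@lebesgue_measure R).
Notation mu2 := (mu \x mu)%E.

Lemma bounded_mul_integrable d (T : measurableType d) (m : {measure set T -> \bar R})
    (D : set T) (h f : T -> R) (K : R) : measurable D ->
  m.-integrable D (EFin \o f) -> measurable_fun D h -> (forall x, D x -> `|h x| <= K) ->
  m.-integrable D (EFin \o (fun x => h x * f x)).
Proof.
move=> mD fi mh hK; have /integrableP[/measurable_EFinP mf _] := fi.
apply: (le_integrable mD _ _ (integrableZl mD K (integrable_norm fi))).
  by apply/measurable_EFinP; exact: measurable_funM.
move=> x Dx /=; rewrite lee_fin normrM normrM normr_id ler_wpM2r//.
by apply: le_trans (hK x Dx) _; exact: ler_norm.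
Qed.

Lemma dcutoff_bounded (a b k : R) : 0 <= k -> a <= b -> exists K, forall x, `|dcutoff a b k x| <= K.
Proof.
move=> k0 ab; have [K K0 hK] := bounded_on_itv (@continuous_dcutoff R a b k) ab.
exists K => x; have [/andP[ax xb]|h] := boolP (a < x < b).
  by apply: hK; rewrite !ltW.
by have [_ ->] := cutoff_out k0 h; rewrite normr0.
Qed.

Lemma cutoff_norm (a b k x : R) : `|cutoff a b k x| <= 1.
Proof. by rewrite ger0_norm ?cutoff_ge0 ?cutoff_le1. Qed.

Lemma measurable_cutoff a b k : measurable_fun setT (@cutoff R a b k).
Proof. by apply: continuous_measurable_fun; exact: continuous_cutoff. Qed.

Lemma measurable_dcutoff a b k : measurable_fun setT (@dcutoff R a b k).
Proof. by apply: continuous_measurable_fun; exact: continuous_dcutoff. Qed.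

Lemma integrable_prodX (I J : set (measurableTypeR R)) (f g : R -> R) : measurable I -> measurable J ->
  mu.-integrable I (EFin \o f) -> mu.-integrable J (EFin \o g) ->
  mu2.-integrable (I `*` J) (EFin \o (fun z => f z.1 * g z.2)).
Proof.
move=> mI mJ fi gi.
have mIJ : measurable (I `*` J) by exact: measurableX.
have i12 := integrable_prod ((restrict_integrable mu _ mI).2 fi) ((restrict_integrable mu _ mJ).2 gi).
have := integrableS measurableT mIJ (@subsetT _ _) i12.
apply: eq_integrable => // z /set_mem[z1 z2].
by rewrite /= !patchE (mem_set z1) (mem_set z2).
Qed.

Lemma ae_neq (a : R) : {ae mu, forall x, x != a}.
Proof.
exists [set a]; split; [exact: measurable_set1|exact: lebesgue_measure_set1|].
by move=> x /= /negP; rewrite negbK => /eqP.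
Qed.

Lemma Rintegral_rect_oo (a b c d : R) (g : R * R -> R) :
  measurable_fun (`[a, b]%classic `*` `[c, d]%classic : set (measurableTypeR R * measurableTypeR R)) g ->
  \int[mu2]_(z in `]a, b[%classic `*` `]c, d[%classic) g z =
  \int[mu2]_(z in `[a, b]%classic `*` `[c, d]%classic) g z.
Proof.
move=> mg; rewrite Rintegral_mkcond [RHS]Rintegral_mkcond.
have mD : measurable (`[a, b]%classic `*` `[c, d]%classic : set (measurableTypeR R * measurableTypeR R)).
  exact: measurableX.
have mO : measurable (`]a, b[%classic `*` `]c, d[%classic : set (measurableTypeR R * measurableTypeR R)).
  exact: measurableX.
apply: ae_eq_Rintegral => //.
- apply/(measurable_restrictT _ _).1 => //; apply: measurable_funS mg => //.
  by move=> z [/= h1 h2]; split => /=; [move: h1|move: h2]; rewrite !in_itv /= => /andP[/ltW -> /ltW ->].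
- exact/(measurable_restrictT _ _).1.
have h1 := ae2_and (ae2_fst (ae_neq a)) (ae2_fst (ae_neq b)).
have h2 := ae2_and (ae2_snd (ae_neq c)) (ae2_snd (ae_neq d)).
apply: ae2S2 h1 h2 => -[x y] /= [xa xb] [yc yd] _; rewrite !patchE.
have Ex : (a < x < b) = (a <= x <= b) by rewrite !le_eqVlt (eq_sym a) (negbTE xa) (negbTE xb).
have Ey : (c < y < d) = (c <= y <= d) by rewrite !le_eqVlt (eq_sym c) (negbTE yc) (negbTE yd).
by congr (if _ then _ else _); apply/idP/idP => /set_mem[/= h1 h2]; apply/mem_set; split => /=;
  move: h1 h2; rewrite !in_itv /= ?Ex ?Ey.
Qed.

Variables (w : R -> R) (V Pr p : R * R -> R) (a b c d : R).
Hypotheses (ab : a < b) (cd : c < d) (cw : continuous w).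
Notation D := ((`[a, b]%classic : set (measurableTypeR R)) `*` (`[c, d]%classic : set (measurableTypeR R))).
Hypotheses (Vi : mu2.-integrable D (EFin \o V)) (Pi : mu2.-integrable D (EFin \o Pr))
  (pi : mu2.-integrable D (EFin \o p)).
Hypothesis Vprim : forall y, c <= y <= d -> is_primitive (fun x => V (x, y)) (fun x => 2^-1 * Pr (x, y)).
Hypothesis weak : forall n : nat,
  \int[mu2]_(z in D) (2 * (dcutoff a b n.+1%:R z.1 * cutoff c d n.+1%:R z.2) * (2^-1 * w z.1 + V z)) =
  - \int[mu2]_(z in D) (cutoff a b n.+1%:R z.1 * cutoff c d n.+1%:R z.2 * p z).

Let mD : measurable D. Proof. exact: measurableX. Qed.

Let ma n := @measurable_cutoff a b n.+1%:R.
Let mb n := @measurable_cutoff c d n.+1%:R.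

Let m2 n : measurable_fun D (fun z => cutoff a b n.+1%:R z.1 * cutoff c d n.+1%:R z.2).
Proof.
apply: measurable_funTS; apply: measurable_funM.
  exact: measurableT_comp (ma n) measurable_fst.
exact: measurableT_comp (mb n) measurable_snd.
Qed.

Let m2' n : measurable_fun D (fun z => 2 * (dcutoff a b n.+1%:R z.1 * cutoff c d n.+1%:R z.2)).
Proof.
apply: measurable_funTS; apply: measurable_funM; first exact: measurable_cst.
apply: measurable_funM.
  exact: measurableT_comp (@measurable_dcutoff a b n.+1%:R) measurable_fst.
exact: measurableT_comp (mb n) measurable_snd.
Qed.

Let cut_le n z : D z -> `|cutoff a b n.+1%:R z.1 * cutoff c d n.+1%:R z.2| <= 1.
Proof. by move=> _; rewrite normrM mulr_ile1 ?cutoff_norm. Qed.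

Let cutP n (f : R * R -> R) : mu2.-integrable D (EFin \o f) ->
  mu2.-integrable D (EFin \o (fun z => cutoff a b n.+1%:R z.1 * cutoff c d n.+1%:R z.2 * f z)).
Proof. by move=> fi; exact: (bounded_mul_integrable mD fi (m2 n) (cut_le n)). Qed.

Let VP n : \int[mu2]_(z in D) (2 * (dcutoff a b n.+1%:R z.1 * cutoff c d n.+1%:R z.2) * V z) =
  - \int[mu2]_(z in D) (cutoff a b n.+1%:R z.1 * cutoff c d n.+1%:R z.2 * Pr z).
Proof.
have n0 : 0 <= n.+1%:R :> R by [].
have [K hK] := dcutoff_bounded n0 (ltW ab).
have i1 : mu2.-integrable D (EFin \o (fun z => 2 * (dcutoff a b n.+1%:R z.1 * cutoff c d n.+1%:R z.2) * V z)).
  apply: (bounded_mul_integrable (K := 2 * K) mD Vi (m2' n)) => z _.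
  rewrite normrM ger0_norm// ler_wpM2l// normrM -[leRHS]mulr1.
  by apply: ler_pM => //; exact: cutoff_norm.
rewrite (RfubiniXC (measurable_itv _) (measurable_itv _) i1).
rewrite -mulN1r -RintegralZl; [|exact: mD|exact: (cutP n Pi)].
have i2 : mu2.-integrable D (EFin \o (fun z => -1 * (cutoff a b n.+1%:R z.1 * cutoff c d n.+1%:R z.2 * Pr z))).
  exact: (integrableZl mD (-1) (cutP n Pi)).
rewrite (RfubiniXC (measurable_itv _) (measurable_itv _) i2).
apply: eq_Rintegral => y /set_mem /=; rewrite in_itv /= => ycd.
have [va _] := cutoff_out (x := a) (a := a) (b := b) n0 (ltac:(by rewrite ltxx)).
have [vb _] := cutoff_out (x := b) (a := a) (b := b) n0 (ltac:(by rewrite ltxx andbF)).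
have E := primitive_by_parts (ltW ab) (Vprim ycd) (@continuous_dcutoff R a b n.+1%:R)
  (@is_derive_cutoff R a b n.+1%:R) va vb.
have [Vy _] := Vprim ycd.
pose I := `[a, b]%classic : set (measurableTypeR R).
have mI : measurable I by exact: measurable_itv.
have cV : continuous (fun x => V (x, y)) by exact: is_primitive_continuous (Vprim ycd).
have iV : mu.-integrable I (EFin \o (fun x => dcutoff a b n.+1%:R x * V (x, y))).
  apply: continuous_compact_integrable; first exact: segment_compact.
  apply: continuous_subspaceT => x; apply: cvgM; [exact: continuous_dcutoff|exact: cV].
have iP : mu.-integrable I (EFin \o (fun x => cutoff a b n.+1%:R x * (2^-1 * Pr (x, y)))).
  apply: (bounded_mul_integrable (K := 1) mI (Vy a b)) => [|x _]; last exact: cutoff_norm.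
  by apply: measurable_funTS; exact: measurable_cutoff.
transitivity (2 * cutoff c d n.+1%:R y * \int[mu]_(s in I) (dcutoff a b n.+1%:R s * V (s, y))).
  by rewrite -RintegralZl//; apply: eq_Rintegral => x _ /=; ring.
have -> : \int[mu]_(s in I) (dcutoff a b n.+1%:R s * V (s, y)) = _ := E.
rewrite mulrN -mulNr -RintegralZl//.
by apply: eq_Rintegral => x _ /=; field.
Qed.

Let wP n : \int[mu2]_(z in D) (2 * (dcutoff a b n.+1%:R z.1 * cutoff c d n.+1%:R z.2) * (2^-1 * w z.1)) =
  \int[mu]_(x in `[a, b]) (dcutoff a b n.+1%:R x * w x) * \int[mu]_(y in `[c, d]) cutoff c d n.+1%:R y.
Proof.
pose I := `[a, b]%classic : set (measurableTypeR R).
pose J := `[c, d]%classic : set (measurableTypeR R).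
have mI : measurable I by exact: measurable_itv.
have mJ : measurable J by exact: measurable_itv.
have i1 : mu.-integrable I (EFin \o (fun x => dcutoff a b n.+1%:R x * w x)).
  apply: continuous_compact_integrable; first exact: segment_compact.
  apply: continuous_subspaceT => x; apply: cvgM; [exact: continuous_dcutoff|exact: cw].
have i2 : mu.-integrable J (EFin \o cutoff c d n.+1%:R).
  apply: continuous_compact_integrable; first exact: segment_compact.
  by apply: continuous_subspaceT; exact: continuous_cutoff.
have i3 : mu2.-integrable D (EFin \o (fun z => 2 * (dcutoff a b n.+1%:R z.1 * cutoff c d n.+1%:R z.2) * (2^-1 * w z.1))).
  have := integrable_prodX mI mJ i1 i2.
  by apply: eq_integrable => // z _ /=; congr EFin; field.
rewrite (RfubiniX (measurable_itv _) (measurable_itv _) i3) mulrC -RintegralZl//.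
apply: eq_Rintegral => x _ /=; rewrite [RHS]mulrC -RintegralZl//.
by apply: eq_Rintegral => y _; field.
Qed.

(** Testing the weak identity with the cutoffs of [a, b] x [c, d]: the term with V
    is integrated by parts exactly, the term with w converges to its increment,
    and the others to integrals over the rectangle.  Hence w has a density in the
    sense of increments, w being no more than continuous to begin with. *)
Lemma characteristic_increment :
  (d - c) * (w b - w a) = \int[mu2]_(z in D) (p z - Pr z).
Proof.
have piD : mu2.-integrable D (EFin \o (fun z => p z - Pr z)).
  exact: (integrableB mD pi Pi).
have E n : \int[mu]_(x in `[a, b]) (dcutoff a b n.+1%:R x * w x) * \int[mu]_(y in `[c, d]) cutoff c d n.+1%:R y
    = - \int[mu2]_(z in D) (cutoff a b n.+1%:R z.1 * cutoff c d n.+1%:R z.2 * (p z - Pr z)).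
  have n0 : 0 <= n.+1%:R :> R by [].
  have [K hK] := dcutoff_bounded n0 (ltW ab).
  have [K' K'0 hK'] := bounded_on_itv cw (ltW ab).
  rewrite -wP.
  have bd z : D z -> `|2 * (dcutoff a b n.+1%:R z.1 * cutoff c d n.+1%:R z.2)| <= 2 * K.
    move=> _; rewrite normrM ger0_norm// ler_wpM2l// normrM -[leRHS]mulr1.
    by apply: ler_pM => //; exact: cutoff_norm.
  have iV := bounded_mul_integrable mD Vi (m2' n) bd.
  have wi : mu2.-integrable D (EFin \o (fun z => 2^-1 * w z.1)).
    have c1 : mu.-integrable `[a, b] (EFin \o (fun x => 2^-1 * w x)).
      apply: continuous_compact_integrable; first exact: segment_compact.
      apply: continuous_subspaceT => x; apply: cvgM; [exact: cvg_cst|exact: cw].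
    have c2 : mu.-integrable `[c, d] (EFin \o (cst 1 : R -> R)).
      apply: continuous_compact_integrable; first exact: segment_compact.
      by apply: continuous_subspaceT => x; exact: cvg_cst.
    have := integrable_prodX (measurable_itv _) (measurable_itv _) c1 c2.
    by apply: eq_integrable => // z _ /=; rewrite mulr1.
  have iw := bounded_mul_integrable mD wi (m2' n) bd.
  have := weak n.
  under eq_Rintegral do rewrite mulrDr.
  rewrite RintegralD// VP.
  have -> : \int[mu2]_(z in D) (cutoff a b n.+1%:R z.1 * cutoff c d n.+1%:R z.2 * (p z - Pr z)) =
      \int[mu2]_(z in D) (cutoff a b n.+1%:R z.1 * cutoff c d n.+1%:R z.2 * p z) -
      \int[mu2]_(z in D) (cutoff a b n.+1%:R z.1 * cutoff c d n.+1%:R z.2 * Pr z).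
    rewrite -RintegralB//; [|exact: cutP|exact: cutP].
    by apply: eq_Rintegral => z _; rewrite mulrBr.
  move=> /(canRL (addrK _)) ->; ring.
have cL : \int[mu]_(x in `[a, b]) (dcutoff a b n.+1%:R x * w x) * \int[mu]_(y in `[c, d]) cutoff c d n.+1%:R y
    @[n --> \oo] --> (w a - w b) * (d - c).
  apply: cvgM; first exact: dcutoff_cvg.
  pose O := `]c, d[%classic : set (measurableTypeR R).
  have mO : measurable O by exact: measurable_itv.
  have muO : mu O = (d - c)%:E by apply: (etrans (lebesgue_measure_itv _)); rewrite /= lte_fin cd.
  have -> : d - c = \int[mu]_(y in O) 1.
    by rewrite /Rintegral integral_cst// mul1e; exact: (congr1 fine (esym muO)).
  have Ei n : \int[mu]_(y in `[c, d]) cutoff c d n.+1%:R y = \int[mu]_(y in O) cutoff c d n.+1%:R y.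
    apply: eq_Rintegral_on => // y; rewrite /O /= !in_itv /= => h1 h2.
      by have [] := @cutoff_out R c d n.+1%:R y (ltac:(by [])) (introN idP h2).
    by case: h1; move/andP: h2 => [/ltW -> /ltW ->].
  under eq_fun do rewrite Ei.
  apply: (@dominated_cvg_Rintegral R _ (measurableTypeR R) mu O _ _ (cst 1)) => //.
  - by move=> n; apply: measurable_funTS; exact: measurable_cutoff.
  - by move=> y; rewrite /O /= in_itv /= => ycd; exact: cutoff_cvg.
  - apply/integrableP; split; first exact/measurable_EFinP/measurable_cst.
    under eq_integral do rewrite /= normr1.
    rewrite integral_cst// mul1e.
    by rewrite [ltLHS](_ : _ = (d - c)%:E) ?ltry.
  - by move=> n y _; exact: cutoff_norm.
have cR : (- \int[mu2]_(z in D) (cutoff a b n.+1%:R z.1 * cutoff c d n.+1%:R z.2 * (p z - Pr z)))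
    @[n --> \oo] --> (- \int[mu2]_(z in D) (p z - Pr z)).
  apply: cvgN.
  pose O := (`]a, b[%classic `*` `]c, d[%classic : set (measurableTypeR R * measurableTypeR R)).
  have mO : measurable O by exact: measurableX.
  have OD : O `<=` D.
    by move=> z [/= h1 h2]; split => /=; [move: h1|move: h2]; rewrite !in_itv /= => /andP[/ltW -> /ltW ->].
  have mf f : mu2.-integrable D (EFin \o f) -> measurable_fun D f.
    by move=> /integrableP[/measurable_EFinP].
  rewrite -Rintegral_rect_oo; last exact: mf.
  have EO n : \int[mu2]_(z in D) (cutoff a b n.+1%:R z.1 * cutoff c d n.+1%:R z.2 * (p z - Pr z)) =
      \int[mu2]_(z in O) (cutoff a b n.+1%:R z.1 * cutoff c d n.+1%:R z.2 * (p z - Pr z)).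
    by apply/esym/Rintegral_rect_oo; apply: mf; exact: (cutP n piD).
  under eq_fun do rewrite EO.
  apply: (@dominated_cvg_Rintegral R _ (measurableTypeR R * measurableTypeR R)%type mu2 O _ _
    (fun z => `|p z - Pr z|)) => //.
  - by move=> n; apply: measurable_funS (mf _ (cutP n piD)).
  - move=> z [/= z1 z2]; rewrite -[X in _ --> X]mul1r; apply: cvgM; last exact: cvg_cst.
    rewrite -[X in _ --> X]mul1r; apply: cvgM.
      by apply: cutoff_cvg; move: z1; rewrite in_itv.
    by apply: cutoff_cvg; move: z2; rewrite in_itv.
  - exact: (integrable_norm (integrableS mD mO OD piD)).
  - by move=> n z Oz; rewrite normrM ler_piMl//; apply: cut_le; exact: OD.
have : (w a - w b) * (d - c) = - \int[mu2]_(z in D) (p z - Pr z).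
  apply: (@cvg_unique _ (@Rhausdorff R) _ _ _ _ cL).
  by move: cR; under eq_fun do rewrite -E.
by move=> /eqP; rewrite -eqr_oppLR => /eqP <-; ring.
Qed.

End characteristic_increment.

(** * Functions with vanishing integrals over rectangles *)
Section rectangles.
Context {R : realType}.
Notation mu := (@lebesgue_measure R).
Notation mu2 := (mu \x mu)%E.
Notation lray x := (`]-oo, x]%classic : set (measurableTypeR R)).

(** The primitive is continuous and takes the same value at all rational points. *)
Lemma rat_segments_eq0 (f : R -> R) : mu.-integrable setT (EFin \o f) ->
  (forall a b : rat, ratr a <= ratr b :> R -> \int[mu]_(s in `[ratr a, ratr b]) f s = 0) ->
  {ae mu, forall x, f x = 0}.
Proof.
move=> fi f0.
have Gp := is_primitive_Ny fi; set G := (fun x => _) in Gp.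
have cG := is_primitive_continuous Gp.
have Gc (x y : R) : G x = G y.
  have Gr (a b : rat) : G (ratr a) = G (ratr b).
    wlog ab : a b / ratr a <= ratr b :> R.
      by move=> H; case/orP: (le_total (ratr a : R) (ratr b)) => h; [|apply/esym]; exact: H.
    by apply/esym/eqP; rewrite -subr_eq0 Gp.2// f0.
  have G0 z : G z = G (ratr 0).
    apply/eqP; apply: contrapT => /negP ne.
    have e0 : 0 < `|G z - G (ratr 0)| by rewrite normr_gt0 subr_eq0.
    have /cvgrPdist_lt/(_ _ e0) := cG z.
    move=> /nbhs_ballP[d /= d0 hd].
    have [q] := rat_in_itvoo (ltac:(by rewrite ltrDl) : z < z + d).
    rewrite in_itv /= => /andP[q1 q2].
    have : `|G z - G (ratr q)| < `|G z - G (ratr 0)|.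
      by apply: hd; rewrite /ball /= distrC gtr0_norm ?subr_gt0// ltrBlDl.
    by rewrite (Gr q 0) ltxx.
  by rewrite (G0 x) (G0 y).
apply: integral_itv_eq0_ae; first exact: integrable_seg.
by move=> a b ab; rewrite -Gp.2// (Gc b a) subrr.
Qed.

(** For fixed rational end points in x the integral vanishes for almost every y;
    countably many null sets later, almost every horizontal section has zero
    integrals over all rational segments. *)
Lemma rectangles_eq0_ae (h : R * R -> R) : mu2.-integrable setT (EFin \o h) ->
  (forall a b c d, a < b -> c < d -> \int[mu2]_(z in `[a, b]%classic `*` `[c, d]%classic) h z = 0) ->
  {ae mu2, forall z, h z = 0}.
Proof.
move=> hi h0.
have /integrableP[/measurable_EFinP mh _] := hi.
have rect a b c d : a <= b -> c <= d -> \int[mu]_(y in `[c, d]) \int[mu]_(x in `[a, b]) h (x, y) = 0.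
  rewrite le_eqVlt => /orP[/eqP<- _|ab].
    under eq_Rintegral do rewrite set_itv1 Rintegral_set1.
    by rewrite /Rintegral integral0.
  rewrite le_eqVlt => /orP[/eqP<-|cd]; first by rewrite set_itv1 Rintegral_set1.
  rewrite -RfubiniXC//; first exact: h0.
  by apply: integrableS hi => //; exact: measurableX.
have step1 (q : rat * rat) : {ae mu, forall y, ratr q.1 <= ratr q.2 :> R ->
    \int[mu]_(x in `[ratr q.1, ratr q.2]) h (x, y) = 0}.
  have [ab|ab] := boolP (ratr q.1 <= ratr q.2 :> R); last by apply: aeW => y.
  have gi : mu.-integrable setT (EFin \o (fun y => \int[mu]_(x in `[ratr q.1, ratr q.2]) h (x, y))).
    have mI : measurable (`[ratr q.1, ratr q.2]%classic `*` setT : set (measurableTypeR R * measurableTypeR R)).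
      exact: measurableX.
    have := integrable_Rfubini2 ((restrict_integrable mu2 h mI).2 (integrableS measurableT mI (@subsetT _ _) hi)).
    apply: eq_integrable => // y _; congr EFin => /=; rewrite [RHS]Rintegral_mkcond.
    apply: eq_Rintegral => x _; rewrite patch_setX !patchE.
    by case: ifP => // _; rewrite patchE mem_set.
  have := integral_itv_eq0_ae (integrable_seg gi) (fun c d cd => rect _ _ _ _ ab cd).
  by apply: ae1S.
have step2 : {ae mu, forall y, forall q : rat * rat, ratr q.1 <= ratr q.2 :> R ->
    \int[mu]_(x in `[ratr q.1, ratr q.2]) h (x, y) = 0}.
  have := ae_foralln (fun n => (match unpickle n as o return {ae mu, forall y, match o with
     Some q => ratr (q : rat * rat).1 <= ratr q.2 :> R -> \int[mu]_(x in `[ratr q.1, ratr q.2]) h (x, y) = 0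
     | None => True end} with Some q => step1 q | None => aeW mu (fun y => I) end)).
  by apply: ae1S => y hy q; have := hy (pickle q); rewrite pickleK.
have sec : {ae mu, forall y, mu.-integrable setT (fun x => (h (x, y))%:E)} by exact: (ae_integrable2 hi).
have step3 : {ae mu, forall y, \int[mu]_x `|h (x, y)|%:E = 0}%E.
  apply: ae1S2 step2 sec => y hy iy.
  have /integrableP[my _] := iy.
  apply: (ae_eq_integral_abs mu measurableT my).2.
  have := rat_segments_eq0 iy (fun a b => hy (a, b)).
  by apply: ae1S => x -> _.
have E : (\int[mu2]_z `|(h z)%:E| = 0)%E.
  have mah : measurable_fun setT (fun z => `|(h z)%:E|)%E.
    by apply: measurableT_comp => //; exact/measurable_EFinP.
  rewrite (tonelli21 mah (fun z => abse_ge0 _)).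
  rewrite (ae_eq_integral (cst 0%E))//.
  - by rewrite integral0.
  - exact: (measurable_tonelli2 mah (fun z => abse_ge0 _)).
  - by apply: ae1S step3 => y hy _.
have mEh : measurable_fun setT (fun z => (h z)%:E) by exact/measurable_EFinP.
have /(ae_eq_integral_abs mu2 measurableT mEh) := E.
by apply: ae2S => z /(_ I) [].
Qed.

End rectangles.

Lemma ae_null_Rintegral d (T : measurableType d) (R : realType) (m : {measure set T -> \bar R})
    (D : set T) (f : T -> R) : measurable D -> m.-integrable D (EFin \o f) ->
  {ae m, forall x, ~ D x} -> \int[m]_(x in D) f x = 0.
Proof.
move=> mD fi nD; have /integrableP[/measurable_EFinP mf _] := fi.
rewrite (ae_eq_Rintegral (g := cst 0) mD mf) //; first by rewrite /Rintegral integral0.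
by apply: filterS nD => x nDx Dx.
Qed.

(** * Densities along one family of characteristics *)
Section characteristic_side.
Context {R : realType}.
Notation mu := (@lebesgue_measure R).
Notation mu2 := (mu \x mu)%E.
Notation lray x := (`]-oo, x]%classic : set (measurableTypeR R)).
Notation rect a b c d := ((`[a, b]%classic : set (measurableTypeR R)) `*` (`[c, d]%classic : set (measurableTypeR R))).

Variables (W ph Phi : R * R -> R) (u0 N v0 : R -> R).
Hypothesis cu0 : continuous u0.
Hypothesis Np : is_primitive N v0.
Hypothesis Phii : forall M, mu2.-integrable (lray M `*` lray M) (EFin \o Phi).
Hypothesis WE : forall x y, 0 <= x + y -> W (x, y) =
  2^-1 * (u0 x + u0 (- y)) + 2^-1 * (N x - N (- y)) + 4^-1 * \int[mu2]_(z in lray x `*` lray y) Phi z.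
Hypothesis Wi : forall a b c d, a < b -> c < d -> 0 < a + c -> mu2.-integrable (rect a b c d) (EFin \o W).
Hypothesis phi : forall a b c d, a < b -> c < d -> 0 < a + c -> mu2.-integrable (rect a b c d) (EFin \o ph).
Hypothesis weak : forall a b c d (n : nat), a < b -> c < d -> 0 < a + c ->
  \int[mu2]_(z in rect a b c d) (2 * (dcutoff a b n.+1%:R z.1 * cutoff c d n.+1%:R z.2) * W z) =
  - \int[mu2]_(z in rect a b c d) (cutoff a b n.+1%:R z.1 * cutoff c d n.+1%:R z.2 * ph z).

(** The characteristic derivative predicted by the representation formula, up to
    the contribution of the derivative of u0. *)
Definition incoming (z : R * R) := v0 z.1 + 2^-1 * \int[mu]_(s in lray z.2) Phi (z.1, s).

Let mrect a b c d : measurable (rect a b c d). Proof. exact: measurableX. Qed.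

Let Phicut M := Phi \_ (lray M `*` lray M).
Let Phicuti M : mu2.-integrable setT (EFin \o Phicut M).
Proof. by apply/(restrict_integrable mu2); [exact: measurableX|exact: Phii]. Qed.

Lemma incoming_integrable a b c d : mu2.-integrable (rect a b c d) (EFin \o incoming).
Proof.
pose M := Num.max b d.
have i1 : mu2.-integrable (rect a b c d) (EFin \o (fun z => v0 z.1 * 1)).
  apply: (@integrable_prodX _ `[a, b] `[c, d] v0 (fun=> 1)) => //; first exact: (Np.1 a b).
  apply: continuous_compact_integrable; first exact: segment_compact.
  by apply: continuous_subspaceT => x; exact: cvg_cst.
have mPhi : measurable_fun setT Phi by exact: quadrant_integrable_measurable.
pose X x := \int[mu]_s `|Phicut M (x, s)|.
have Xi : mu.-integrable setT (EFin \o X) by exact: (integrable_Rfubini1 (integrable_norm (Phicuti M))).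
have i2 : mu2.-integrable (rect a b c d) (EFin \o (fun z => X z.1 * 1)).
  apply: (@integrable_prodX _ `[a, b] `[c, d] X (fun=> 1)) => //.
    exact: (integrable_seg Xi).
  apply: continuous_compact_integrable; first exact: segment_compact.
  by apply: continuous_subspaceT => x; exact: cvg_cst.
have sec : {ae mu2, forall z, mu.-integrable setT (fun y => (Phicut M (z.1, y))%:E)}.
  exact: (ae2_fst (P := fun x => mu.-integrable setT (fun y => (Phicut M (x, y))%:E)) (ae_integrable1 (Phicuti M))).
pose J z := \int[mu]_(s in lray z.2) Phi (z.1, s).
have mJ : measurable_fun setT J by exact: measurable_partial.
have i3 : mu2.-integrable (rect a b c d) (EFin \o J).
  have mJ' : measurable_fun (rect a b c d) (EFin \o J) by apply/measurable_EFinP; exact: measurable_funTS.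
  apply/integrableP; split => //.
  have /integrableP[_] := i2; apply: le_lt_trans.
  apply: ae_ge0_le_integral => //.
  - exact: measurableT_comp.
  - by apply: measurableT_comp => //; have /integrableP[] := i2.
  apply: ae2S sec => -[x y] /= iy [/= xab ycd]; rewrite lee_fin mulr1.
  have xM : x <= M by move: xab; rewrite in_itv /= => /andP[_ h]; rewrite /M le_max h.
  have yM : y <= M by move: ycd; rewrite in_itv /= => /andP[_ h]; rewrite /M le_max h orbT.
  have my : measurable (lray y) by exact: measurable_itv.
  have -> : J (x, y) = \int[mu]_(s in lray y) Phicut M (x, s).
    apply: eq_Rintegral => s /set_mem /=; rewrite in_itv /= => sy.
    by rewrite /Phicut patchE mem_set//; split => /=; rewrite in_itv //= (le_trans sy).
  apply: le_trans (le_normr_Rintegral my (integrableS measurableT my (@subsetT _ _) iy)) _.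
  apply: le_trans (ler_norm _).
  rewrite [leLHS]Rintegral_mkcond; apply: le_Rintegral => //.
  - apply/(restrict_integrable mu) => //; apply: integrableS (integrable_norm iy) => //.
  - exact: (integrable_norm iy).
  - by move=> s _; rewrite patchE; case: ifP => // _; exact: normr_ge0.
have := integrableD (mrect a b c d) i1 (integrableZl (mrect a b c d) 2^-1 i3).
by apply: eq_integrable => // z _ /=; rewrite mulr1.
Qed.

(** By the representation formula, W is u0 / 2 plus a function with an explicit
    density along the characteristic, so the weak derivative ph determines the
    increments of u0. *)
Lemma side_increment a b c d : a < b -> c < d -> 0 < a + c ->
  (d - c) * (u0 b - u0 a) = \int[mu2]_(z in rect a b c d) (ph z - incoming z).
Proof.
move=> ab cd ac; pose M := Num.max b d.
pose V z := 2^-1 * u0 (- z.2) + 2^-1 * (N z.1 - N (- z.2)) + 4^-1 * \int[mu2]_(w in lray z.1 `*` lray z.2) Phicut M w.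
pose Pr z := v0 z.1 + 2^-1 * \int[mu]_(s in lray z.2) Phicut M (z.1, s).
have inM z : rect a b c d z -> z.1 <= M /\ z.2 <= M /\ 0 <= z.1 + z.2.
  move=> [/=]; rewrite !in_itv /= => /andP[az zb] /andP[cz zd].
  by rewrite /M !le_max zb zd orbT; split => //; split => //; lra.
have WV z : rect a b c d z -> W z = 2^-1 * u0 z.1 + V z.
  case: z => x y /inM[/= xM [yM xy]]; rewrite WE// /V /=.
  have -> : \int[mu2]_(z in lray x `*` lray y) Phi z = \int[mu2]_(z in lray x `*` lray y) Phicut M z.
    apply: eq_Rintegral => z /set_mem[/=]; rewrite !in_itv /= => h1 h2.
    by rewrite /Phicut patchE mem_set//; split => /=; rewrite in_itv /= ?(le_trans h1) ?(le_trans h2).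
  ring.
have PrE z : rect a b c d z -> incoming z = Pr z.
  move=> /inM[xM [yM _]]; rewrite /incoming /Pr; congr (_ + _ * _).
  apply: eq_Rintegral => s /set_mem /=; rewrite in_itv /= => sy.
  by rewrite /Phicut patchE mem_set//; split => /=; rewrite in_itv //= (le_trans sy).
have Vi : mu2.-integrable (rect a b c d) (EFin \o V).
  have c1 : mu.-integrable `[a, b] (EFin \o (fun x => 2^-1 * u0 x)).
    apply: continuous_compact_integrable; first exact: segment_compact.
    apply: continuous_subspaceT => x; apply: cvgM; [exact: cvg_cst|exact: cu0].
  have c2 : mu.-integrable `[c, d] (EFin \o (cst 1 : R -> R)).
    apply: continuous_compact_integrable; first exact: segment_compact.
    by apply: continuous_subspaceT => x; exact: cvg_cst.
  have := integrableB (mrect a b c d) (Wi ab cd ac) (integrable_prodX (measurable_itv _) (measurable_itv _) c1 c2).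
  apply: eq_integrable => // z /set_mem Dz /=; congr EFin.
  by rewrite mulr1 (WV z Dz) addrC addKr.
have -> : \int[mu2]_(z in rect a b c d) (ph z - incoming z) = \int[mu2]_(z in rect a b c d) (ph z - Pr z).
  by apply: eq_Rintegral => z /set_mem Dz; rewrite PrE.
apply: (@characteristic_increment R u0 V Pr ph a b c d ab cd cu0 Vi).
- have := incoming_integrable a b c d; apply: eq_integrable => // z /set_mem Dz /=.
  by rewrite PrE.
- exact: (phi ab cd ac).
- move=> y _; rewrite /V /Pr /=.
  have p1 := is_primitiveZ 2^-1 Np.
  have p2 := is_primitiveZ 4^-1 (is_primitive_plane1 (S := lray y) (measurable_itv _) (Phicuti M)).
  have := is_primitive_shift (2^-1 * u0 (- y) - 2^-1 * N (- y)) (is_primitiveD p1 p2).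
  by congr is_primitive; apply/funext => x; field.
- move=> n; rewrite -(weak n ab cd ac); apply: eq_Rintegral => z /set_mem Dz.
  by rewrite WV.
Qed.

(** The weak derivative of the solution thus exhibits u0 as an integral, which
    replaces the fundamental theorem of calculus for absolutely continuous
    functions. *)
Lemma side_local_primitive a b : a < b ->
  exists G h, is_primitive G h /\ forall x, a <= x <= b -> G x = u0 x.
Proof.
(* a rectangle of unit height above [a, b], inside the half plane: 0 < a + c = 1 *)
move=> ab; pose c := 1 - a; pose d := c + 1.
have cd : c < d by rewrite ltrDl.
have ac : 0 < a + c by rewrite /c addrC subrK.
pose D := rect a b c d.
have iD : mu2.-integrable D (EFin \o (fun z => ph z - incoming z)).
  exact: (integrableB (mrect a b c d) (phi ab cd ac) (incoming_integrable a b c d)).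
have iT := (restrict_integrable mu2 _ (mrect a b c d)).2 iD.
have gi := integrable_Rfubini1 iT; set g := (fun x => _) in gi.
have Gp := is_primitive_Ny gi; set G := (fun x => _) in Gp.
exists (fun x => G x + (u0 a - G a)), g; split; first exact: is_primitive_shift.
move=> x /andP[ax xb].
suff : G x - G a = u0 x - u0 a by move=> h; rewrite addrCA h addrC subrK.
move: ax; rewrite le_eqVlt => /orP[/eqP<-|ax]; first by rewrite !subrr.
rewrite Gp.2; last exact: ltW.
have := side_increment ax cd ac; rewrite {1}/d addrC addKr mul1r => ->.
have sub : rect a x c d `<=` D.
  move=> z [/= h1 h2]; split => //=; move: h1; rewrite !in_itv /= => /andP[-> h] /=.
  exact: le_trans xb.
rewrite (RfubiniX (measurable_itv _) (measurable_itv _) (integrableS (mrect a b c d) (mrect a x c d) sub iD)).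
apply: eq_Rintegral => s /set_mem /=; rewrite in_itv /= => /andP[as_ sx].
rewrite [RHS]Rintegral_mkcond; apply: eq_Rintegral => y _.
rewrite patch_setX !patchE mem_set ?patchE//=.
by rewrite in_itv /= as_ (le_trans sx).
Qed.

(** Once u0 has a density g, the increments identify the integrals of ph over all
    rectangles, hence ph itself; countably many rectangles with rational corners
    cover the open half plane. *)
Lemma side_density g : is_primitive u0 g ->
  {ae mu2, forall z, 0 < z.1 + z.2 -> ph z = g z.1 + incoming z}.
Proof.
move=> u0g.
have gi a b c d : mu2.-integrable (rect a b c d) (EFin \o (fun z => g z.1)).
  have c2 : mu.-integrable `[c, d] (EFin \o (cst 1 : R -> R)).
    apply: continuous_compact_integrable; first exact: segment_compact.
    by apply: continuous_subspaceT => x; exact: cvg_cst.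
  have := integrable_prodX (measurable_itv _) (measurable_itv _) (u0g.1 a b) c2.
  by apply: eq_integrable => // z _ /=; rewrite mulr1.
pose h z := ph z - incoming z - g z.1.
have hi a b c d : a < b -> c < d -> 0 < a + c -> mu2.-integrable (rect a b c d) (EFin \o h).
  move=> ab cd ac; have mD := mrect a b c d.
  exact: (integrableB mD (integrableB mD (phi ab cd ac) (incoming_integrable a b c d)) (gi a b c d)).
have h0 a b c d : a < b -> c < d -> 0 < a + c -> \int[mu2]_(z in rect a b c d) h z = 0.
  move=> ab cd ac; have mD := mrect a b c d.
  rewrite RintegralB//; last first.
    exact: (integrableB mD (phi ab cd ac) (incoming_integrable a b c d)).
  rewrite -side_increment// RfubiniX//=.
  rewrite u0g.2 ?ltW// mulrC -RintegralZr//; last exact: (u0g.1 a b).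
  apply/eqP; rewrite subr_eq0; apply/eqP; apply: eq_Rintegral => x _.
  rewrite /Rintegral integral_cst//.
  have -> : g x * (d - c) = fine ((g x)%:E * (d - c)%:E)%E by [].
  congr (fine (_ * _)%E); apply/esym; apply: (etrans (lebesgue_measure_itv _)).
  by rewrite /= lte_fin cd.
have local a0 b0 c0 d0 : a0 < b0 -> c0 < d0 -> 0 < a0 + c0 ->
    {ae mu2, forall z, rect a0 b0 c0 d0 z -> h z = 0}.
  move=> ab0 cd0 ac0; pose D0 := rect a0 b0 c0 d0.
  have iT := (restrict_integrable mu2 _ (mrect a0 b0 c0 d0)).2 (hi _ _ _ _ ab0 cd0 ac0).
  have := rectangles_eq0_ae iT (h := h \_ D0).
  have H : forall a b c d, a < b -> c < d -> \int[mu2]_(z in `[a, b]%classic `*` `[c, d]%classic) (h \_ D0) z = 0.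
    move=> a b c d ab cd.
    pose a' := Num.max a a0; pose b' := Num.min b b0; pose c' := Num.max c c0; pose d' := Num.min d d0.
    have a'0 : a0 <= a' by rewrite /a' le_max lexx orbT.
    have c'0 : c0 <= c' by rewrite /c' le_max lexx orbT.
    have -> : \int[mu2]_(z in `[a, b]%classic `*` `[c, d]%classic) (h \_ D0) z = \int[mu2]_(z in rect a' b' c' d') h z.
      have memI z : rect a' b' c' d' z <-> (rect a b c d z /\ D0 z).
        rewrite /D0 /= !in_itv /= /a' /b' /c' /d' !ge_max !le_min.
        split=> [[/andP[/andP[-> ->] /andP[-> ->]] /andP[/andP[-> ->] /andP[-> ->]]]//|].
        by move=> [[/andP[-> ->] /andP[-> ->]] [/andP[-> ->] /andP[-> ->]]].
      apply: eq_Rintegral_on => z.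
      - by move=> _ /memI[_ h1]; rewrite patchE mem_set.
      - move=> h1 h2; rewrite patchE memNset// => h3; apply: h2; exact/memI.
      - by move=> h1 /memI[].
    have iD' : mu2.-integrable (rect a' b' c' d') (EFin \o h).
      apply: integrableS (hi _ _ _ _ ab0 cd0 ac0); [exact: mrect|exact: mrect|].
      move=> z [/=]; rewrite /a' /b' /c' /d' !in_itv /= !ge_max !le_min.
      by move=> /andP[/andP[_ h1] /andP[_ h2]] /andP[/andP[_ h3] /andP[_ h4]]; split; apply/andP; split.
    have [a'b'|b'a'] := ltP a' b'; last first.
      apply: (ae_null_Rintegral (mrect a' b' c' d') iD').
      apply: ae2S (ae2_fst (ae_neq a')) => z /negP ne [/=]; rewrite in_itv /= => /andP[h1 h2] _.
      by apply: ne; rewrite eq_le h1 (le_trans h2).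
    have [c'd'|d'c'] := ltP c' d'; last first.
      apply: (ae_null_Rintegral (mrect a' b' c' d') iD').
      apply: ae2S (ae2_snd (ae_neq c')) => z /negP ne [_ /=]; rewrite in_itv /= => /andP[h1 h2].
      by apply: ne; rewrite eq_le h1 (le_trans h2).
    by apply: h0 => //; lra.
  move=> /(_ H); apply: ae2S => z hz Dz; move: hz; rewrite patchE mem_set//.
pose ok (q : (rat * rat) * nat) := [/\ (ratr q.1.1 : R) < q.2%:R, (ratr q.1.2 : R) < q.2%:R & 0 < ratr q.1.1 + ratr q.1.2 :> R].
have loc2 (q : (rat * rat) * nat) : {ae mu2, forall z,
    ok q -> rect (ratr q.1.1) q.2%:R (ratr q.1.2) q.2%:R z -> h z = 0}.
  have [[h1 h2 h3]|nok] := pselect (ok q); last by apply: aeW => z.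
  by apply: ae2S (local _ _ _ _ h1 h2 h3).
have loc3 := ae_foralln (fun n => (match unpickle n as o return {ae mu2, forall z, match o with
     Some q => ok q -> rect (ratr (q : (rat * rat) * nat).1.1) q.2%:R (ratr q.1.2) q.2%:R z -> h z = 0
     | None => True end} with Some q => loc2 q | None => aeW mu2 (fun y => I) end)).
apply: ae2S loc3 => -[x y] hz /= xy.
have [q1] := rat_in_itvoo (ltac:(lra) : (x - y) / 2 < x).
have [q2] := rat_in_itvoo (ltac:(lra) : (y - x) / 2 < y).
rewrite !in_itv /= => /andP[q21 q2y] /andP[q11 q1x].
pose m := maxn (Num.bound `|x|) (Num.bound `|y|).
have xm : x <= m%:R.
  apply: le_trans (ler_norm _) _; apply: le_trans (ltW (archi_boundP _)) _ => //.
  by rewrite ler_nat leq_maxl.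
have ym : y <= m%:R.
  apply: le_trans (ler_norm _) _; apply: le_trans (ltW (archi_boundP _)) _ => //.
  by rewrite ler_nat leq_maxr.
have := hz (pickle ((q1, q2), m)); rewrite pickleK => H.
have : h (x, y) = 0.
  apply: H; first by split => /=; [exact: lt_le_trans xm|exact: lt_le_trans ym|lra].
  by split => /=; rewrite in_itv /= ?xm ?ym ?(ltW q1x) ?(ltW q2y).
rewrite /h => /eqP; rewrite subr_eq0 => /eqP h1.
by have := h1 => /= /(canRL (subrK _)) ->.
Qed.

End characteristic_side.

(** * Weak derivatives in characteristic coordinates *)
Section weak_identities.
Context {R : realType}.
Notation mu := (@lebesgue_measure R).
Notation mu2 := (mu \x mu)%E.
Notation lray x := (`]-oo, x]%classic : set (measurableTypeR R)).
Notation rect a b c d := ((`[a, b]%classic : set (measurableTypeR R)) `*` (`[c, d]%classic : set (measurableTypeR R))).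

Definition locally_integrable_half (f : R * R -> R) := forall C : set (R * R), compact C ->
  C `<=` @halfplane R -> mu2.-integrable (C : set (measurableTypeR R * measurableTypeR R)) (EFin \o f).

Let mrect a b c d : measurable (rect a b c d). Proof. exact: measurableX. Qed.

(** The support of a product of cutoffs, a compact rhombus in the (t, x) plane. *)
Definition diamond (a b c d : R) : set (measurableTypeR R * measurableTypeR R) := hc @^-1` rect a b c d.

Lemma measurable_diamond a b c d : measurable (diamond a b c d).
Proof. by rewrite -[X in measurable X]setTI; apply: (measurable_hc _ (mrect a b c d)). Qed.

Lemma compact_diamond a b c d : compact (diamond a b c d : set (R * R)).
Proof.
have -> : diamond a b c d = ch @` (rect a b c d : set (R * R)).
  apply/seteqP; split => [z h|_ [z h <-]]; first by exists (hc z) => //; exact: hcK.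
  by change (rect a b c d (hc (ch z))); rewrite chK.
apply: continuous_compact; first by apply: continuous_subspaceT; exact: continuous_ch.
by apply: compact_setX; exact: segment_compact.
Qed.

Lemma diamond_half a b c d : 0 < a + c -> diamond a b c d `<=` @halfplane R.
Proof.
move=> ac [t x] [/=]; rewrite !in_itv /= /halfplane /= => /andP[h1 _] /andP[h2 _]; lra.
Qed.

Lemma restrict_ch (f : R * R -> R) a b c d z : (f \_ (diamond a b c d)) (ch z) = ((f \o ch) \_ (rect a b c d)) z.
Proof.
have E : diamond a b c d (ch z) = rect a b c d z.
  by change (rect a b c d (hc (ch z)) = rect a b c d z); rewrite chK.
by rewrite !patchE; congr (if _ then _ else _); apply/idP/idP => /set_mem h; apply/mem_set; move: h; rewrite E.
Qed.

Lemma diamond_integrable (f : R * R -> R) a b c d : mu2.-integrable (diamond a b c d) (EFin \o f) ->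
  mu2.-integrable (rect a b c d) (EFin \o (f \o ch)).
Proof.
move=> fi; apply/(restrict_integrable mu2) => //.
have i1 := (restrict_integrable mu2 f (measurable_diamond a b c d)).2 fi.
have mf : measurable_fun setT (f \_ (diamond a b c d)) by have /integrableP[/measurable_EFinP] := i1.
have := (integrable_chP mf).2 i1; congr (mu2.-integrable setT).
by apply/funext => z; rewrite /= restrict_ch.
Qed.

Lemma Rintegral_diamond (f : R * R -> R) a b c d : 0 < a + c ->
  mu2.-integrable (diamond a b c d) (EFin \o f) -> (forall p, ~ diamond a b c d p -> f p = 0) ->
  \int[mu2]_(p in @halfplane R) f p = 2^-1 * \int[mu2]_(z in rect a b c d) f (ch z).
Proof.
move=> ac fi f0.
have -> : \int[mu2]_(p in @halfplane R) f p = \int[mu2]_(p in diamond a b c d) f p.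
  apply: eq_Rintegral_on => // p; first by move=> _ /f0.
  by move=> h1 /(diamond_half ac).
have i1 := (restrict_integrable mu2 f (measurable_diamond a b c d)).2 fi.
rewrite Rintegral_mkcond [in RHS]Rintegral_mkcond.
have -> : \int[mu2]_z ((fun z => f (ch z)) \_ (rect a b c d)) z = \int[mu2]_z (f \_ (diamond a b c d)) (ch z).
  by apply: eq_Rintegral => z _; rewrite restrict_ch.
by rewrite Rintegral_ch// mulrA mulVf// mul1r.
Qed.

Variables (U pt px : R * R -> R).
Hypotheses (Ul : locally_integrable_half U) (ptl : locally_integrable_half pt)
  (pxl : locally_integrable_half px).
Hypothesis weakt : forall phi, test_function phi ->
  \int[mu2]_(p in @halfplane R) ('D_((1, 0) : R * R) phi p * U p) = - \int[mu2]_(p in @halfplane R) (phi p * pt p).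
Hypothesis weakx : forall phi, test_function phi ->
  \int[mu2]_(p in @halfplane R) ('D_((0, 1) : R * R) phi p * U p) = - \int[mu2]_(p in @halfplane R) (phi p * px p).

Section on_rectangle.
Variables (a b c d : R) (n : nat).
Hypotheses (ab : a < b) (cd : c < d) (ac : 0 < a + c).
Notation D := (rect a b c d).
Notation A z := (cutoff a b n.+1%:R z.1).
Notation A' z := (dcutoff a b n.+1%:R z.1).
Notation B z := (cutoff c d n.+1%:R z.2).
Notation B' z := (dcutoff c d n.+1%:R z.2).
Notation phi := (cutoff2 a b c d n.+1%:R).

Let n0 : 0 <= n.+1%:R :> R. Proof. by []. Qed.

Let on_diamond f : locally_integrable_half f -> mu2.-integrable (diamond a b c d) (EFin \o f).
Proof. by move=> fl; apply: fl; [exact: compact_diamond|exact: diamond_half]. Qed.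

Let on_rect f : locally_integrable_half f -> mu2.-integrable D (EFin \o (f \o ch)).
Proof. by move=> /on_diamond/diamond_integrable. Qed.

Let m1 (F : R -> R) : continuous F -> measurable_fun setT (fun z : R * R => F z.1).
Proof. by move=> cF; apply: measurableT_comp measurable_fst; exact: continuous_measurable_fun. Qed.
Let m2 (F : R -> R) : continuous F -> measurable_fun setT (fun z : R * R => F z.2).
Proof. by move=> cF; apply: measurableT_comp measurable_snd; exact: continuous_measurable_fun. Qed.

Let cA := @continuous_cutoff R a b n.+1%:R.
Let cA' := @continuous_dcutoff R a b n.+1%:R.
Let cB := @continuous_cutoff R c d n.+1%:R.
Let cB' := @continuous_dcutoff R c d n.+1%:R.

(** Cutoff factors paired with a locally integrable function, in characteristic
    coordinates: every integral below has this shape. *)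
Let int_prod (F G : R -> R) (f : R * R -> R) : continuous F -> continuous G ->
  locally_integrable_half f ->
  mu2.-integrable D (EFin \o (fun z => F z.1 * G z.2 * f (ch z))).
Proof.
move=> cF cG /on_rect fi.
have [K K0 hK] := bounded_on_itv cF (ltW ab); have [L L0 hL] := bounded_on_itv cG (ltW cd).
apply: (bounded_mul_integrable (K := K * L) (mrect a b c d) fi).
  by apply: measurable_funTS; apply: measurable_funM; [exact: m1|exact: m2].
move=> z [/=]; rewrite !in_itv /= => z1 z2; rewrite normrM; apply: ler_pM => //; [exact: hK|exact: hL].
Qed.

Let to_rect (F G : R -> R) (h f : R * R -> R) : continuous F -> continuous G ->
  locally_integrable_half f ->
  (forall x y, ~~ (a < x < b) || ~~ (c < y < d) -> F x * G y = 0) ->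
  (forall z, h (ch z) = F z.1 * G z.2) ->
  \int[mu2]_(p in @halfplane R) (h p * f p) = 2^-1 * \int[mu2]_(z in D) (F z.1 * G z.2 * f (ch z)).
Proof.
move=> cF cG fl F0 hE.
have hE' p : h p = F (hc p).1 * G (hc p).2 by rewrite -hE hcK.
rewrite (@Rintegral_diamond (fun p => h p * f p) a b c d ac).
- by congr (_ * _); apply: eq_Rintegral => z _; rewrite hE.
- have [K K0 hK] := bounded_on_itv cF (ltW ab); have [L L0 hL] := bounded_on_itv cG (ltW cd).
  apply: (bounded_mul_integrable (K := K * L) (measurable_diamond a b c d) (on_diamond fl)).
    rewrite (_ : h = (fun z => F z.1 * G z.2) \o hc); last by apply/funext => p; rewrite hE'.
    apply: measurable_funTS; apply: measurableT_comp measurable_hc.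
    by apply: measurable_funM; [exact: m1|exact: m2].
  move=> p [/=]; rewrite !in_itv /= => z1 z2; rewrite hE' normrM; apply: ler_pM => //; [exact: hK|exact: hL].
move=> p np; rewrite hE' F0 ?mul0r//.
rewrite -negb_and; apply/negP => /andP[/andP[h1 h2] /andP[h3 h4]]; apply: np.
by split; rewrite /= in_itv /= !ltW.
Qed.

Let zero_out (F : R -> R) (G : R -> R) :
  (forall x, ~~ (a < x < b) -> F x = 0) -> (forall y, ~~ (c < y < d) -> G y = 0) ->
  forall x y, ~~ (a < x < b) || ~~ (c < y < d) -> F x * G y = 0.
Proof. by move=> hF hG x y /orP[/hF|/hG] ->; rewrite ?mul0r ?mulr0. Qed.

Let A0 x : ~~ (a < x < b) -> cutoff a b n.+1%:R x = 0. Proof. by move/(cutoff_out n0)=> []. Qed.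
Let A'0 x : ~~ (a < x < b) -> dcutoff a b n.+1%:R x = 0. Proof. by move/(cutoff_out n0)=> []. Qed.
Let B0 x : ~~ (c < x < d) -> cutoff c d n.+1%:R x = 0. Proof. by move/(cutoff_out n0)=> []. Qed.
Let B'0 x : ~~ (c < x < d) -> dcutoff c d n.+1%:R x = 0. Proof. by move/(cutoff_out n0)=> []. Qed.

Let phiE z : phi (ch z) = A z * B z.
Proof. by rewrite /cutoff2 /ch /=; congr (cutoff _ _ _ _ * cutoff _ _ _ _); field. Qed.

Let rhs f : locally_integrable_half f ->
  \int[mu2]_(p in @halfplane R) (phi p * f p) = 2^-1 * \int[mu2]_(z in D) (A z * B z * f (ch z)).
Proof. by move=> fl; apply: to_rect => //; exact: zero_out. Qed.

(** The two parts of a directional derivative of the product cutoff: I1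
    differentiates the factor in xi and I2 the one in sigma. *)
Let I1 := \int[mu2]_(z in D) (A' z * B z * U (ch z)).
Let I2 := \int[mu2]_(z in D) (A z * B' z * U (ch z)).

Let lhs (v : R * R) : \int[mu2]_(p in @halfplane R) ('D_v phi p * U p) =
  2^-1 * ((v.2 + v.1) * I1 + (v.1 - v.2) * I2).
Proof.
pose h1 (p : R * R) := A' (hc p) * B (hc p).
pose h2 (p : R * R) := A (hc p) * B' (hc p).
have E1 : \int[mu2]_(p in @halfplane R) (h1 p * U p) = 2^-1 * I1.
  by apply: to_rect => //; [exact: zero_out|move=> z; rewrite /h1 chK].
have E2 : \int[mu2]_(p in @halfplane R) (h2 p * U p) = 2^-1 * I2.
  by apply: to_rect => //; [exact: zero_out|move=> z; rewrite /h2 chK].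
have dE p : 'D_v phi p = (v.2 + v.1) * h1 p + (v.1 - v.2) * h2 p.
  have [_ ->] := is_derive_cutoff2 a b c d n.+1%:R p v.
  by rewrite /h1 /h2 /hc /=; ring.
have supp (h : R * R -> R) : (forall p, ~ diamond a b c d p -> h p = 0) ->
    \int[mu2]_(p in @halfplane R) (h p * U p) = \int[mu2]_(p in diamond a b c d) (h p * U p).
  move=> h0; apply: eq_Rintegral_on => // p; first by move=> _ /h0 ->; rewrite mul0r.
  by move=> g1 /(diamond_half ac).
have out p : ~ diamond a b c d p -> ~~ (a < (hc p).1 < b) || ~~ (c < (hc p).2 < d).
  move=> np; rewrite -negb_and; apply/negP => /andP[/andP[g1 g2] /andP[g3 g4]]; apply: np.
  by split; rewrite /= in_itv /= !ltW.
have z1 p : ~ diamond a b c d p -> h1 p = 0 by move=> /out; exact: zero_out.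
have z2 p : ~ diamond a b c d p -> h2 p = 0 by move=> /out; exact: zero_out.
have i (F G : R -> R) : continuous F -> continuous G -> mu2.-integrable (diamond a b c d)
    (EFin \o (fun p => F (hc p).1 * G (hc p).2 * U p)).
  move=> cF cG.
  have [K K0 hK] := bounded_on_itv cF (ltW ab); have [L L0 hL] := bounded_on_itv cG (ltW cd).
  apply: (bounded_mul_integrable (K := K * L) (measurable_diamond a b c d) (on_diamond Ul)).
    apply: measurable_funTS; apply: (measurableT_comp (f := fun z => F z.1 * G z.2)) measurable_hc.
    by apply: measurable_funM; [exact: m1|exact: m2].
  move=> p [/=]; rewrite !in_itv /= => y1 y2; rewrite normrM; apply: ler_pM => //; [exact: hK|exact: hL].
have mD := measurable_diamond a b c d.
rewrite mulrDr !(mulrCA 2^-1) -E1 -E2 !supp//; last first.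
  by move=> p np; rewrite dE z1// z2// !mulr0 addr0.
rewrite -!RintegralZl//; [|exact: i|exact: i].
rewrite -RintegralD//; [|exact: (integrableZl mD _ (i _ _ cA' cB))|exact: (integrableZl mD _ (i _ _ cA cB'))].
by apply: eq_Rintegral => p _; rewrite dE; ring.
Qed.

Let ab0 : test_function phi. Proof. exact: test_cutoff2. Qed.

Let solve (i1 i2 j1 j2 : R) : 2^-1 * ((0 + 1) * i1 + (1 - 0) * i2) = - (2^-1 * j1) ->
  2^-1 * ((1 + 0) * i1 + (0 - 1) * i2) = - (2^-1 * j2) -> 2 * i1 = - (j1 + j2) /\ 2 * i2 = - (j1 - j2).
Proof. by split; lra. Qed.

Let solved := solve (etrans (esym (lhs (1, 0))) (etrans (weakt ab0) (congr1 -%R (rhs ptl))))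
  (etrans (esym (lhs (0, 1))) (etrans (weakx ab0) (congr1 -%R (rhs pxl)))).

(** In characteristic coordinates d_t + d_x is twice the derivative in xi, and
    adding the weak identities in t and in x removes the derivative in sigma. *)
Lemma weak_incoming :
  \int[mu2]_(z in D) (2 * (A' z * B z) * U (ch z)) =
  - \int[mu2]_(z in D) (A z * B z * (pt (ch z) + px (ch z))).
Proof.
transitivity (2 * I1).
  by rewrite -RintegralZl//; [apply: eq_Rintegral => z _; ring|exact: int_prod].
transitivity (- (\int[mu2]_(z in D) (A z * B z * pt (ch z)) + \int[mu2]_(z in D) (A z * B z * px (ch z)))).
  exact: solved.1.
rewrite -RintegralD//; [|exact: int_prod|exact: int_prod].
by congr (- _); apply: eq_Rintegral => z _; rewrite mulrDr.
Qed.

Lemma weak_outgoing :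
  \int[mu2]_(z in D) (2 * (A z * B' z) * U (ch z)) =
  - \int[mu2]_(z in D) (A z * B z * (pt (ch z) - px (ch z))).
Proof.
transitivity (2 * I2).
  by rewrite -RintegralZl//; [apply: eq_Rintegral => z _; ring|exact: int_prod].
transitivity (- (\int[mu2]_(z in D) (A z * B z * pt (ch z)) - \int[mu2]_(z in D) (A z * B z * px (ch z)))).
  exact: solved.2.
rewrite -RintegralB//; [|exact: int_prod|exact: int_prod].
by congr (- _); apply: eq_Rintegral => z _; rewrite mulrBr.
Qed.

End on_rectangle.

End weak_identities.

(** * Both characteristic derivatives of a scalar wave *)
Section wave_densities.
Context {R : realType}.
Notation mu := (@lebesgue_measure R).
Notation mu2 := (mu \x mu)%E.
Notation lray x := (`]-oo, x]%classic : set (measurableTypeR R)).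
Notation rect a b c d := ((`[a, b]%classic : set (measurableTypeR R)) `*` (`[c, d]%classic : set (measurableTypeR R))).

Lemma Rintegral_swp (f : R * R -> R) (A : set (R * R)) :
  mu2.-integrable (A : set (measurableTypeR R * measurableTypeR R)) (EFin \o f) ->
  measurable (A : set (measurableTypeR R * measurableTypeR R)) ->
  \int[mu2]_(z in swp @^-1` A) f (swp z) = \int[mu2]_(z in A) f z.
Proof.
move=> fi mA; have i1 := (restrict_integrable mu2 f mA).2 fi.
rewrite Rintegral_mkcond [RHS]Rintegral_mkcond.
rewrite (Rfubini12 i1) (_ : \int[mu2]_z _ = \int[mu2]_z ((f \_ A) \o swp) z); last first.
  by apply: eq_Rintegral => z _; rewrite /= !patchE.
by rewrite (Rfubini21 (integrable_swp i1)).
Qed.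

Variables (U pt px Phi : R * R -> R) (u0 N v0 : R -> R).
Hypotheses (Ul : locally_integrable_half U) (ptl : locally_integrable_half pt)
  (pxl : locally_integrable_half px).
Hypothesis weakt : forall phi, test_function phi ->
  \int[mu2]_(p in @halfplane R) ('D_((1, 0) : R * R) phi p * U p) = - \int[mu2]_(p in @halfplane R) (phi p * pt p).
Hypothesis weakx : forall phi, test_function phi ->
  \int[mu2]_(p in @halfplane R) ('D_((0, 1) : R * R) phi p * U p) = - \int[mu2]_(p in @halfplane R) (phi p * px p).
Hypothesis cu0 : continuous u0.
Hypothesis Np : is_primitive N v0.
Hypothesis Phii : forall M, mu2.-integrable (lray M `*` lray M) (EFin \o Phi).
Hypothesis mild : forall x y, 0 <= x + y -> U (ch (x, y)) =
  2^-1 * (u0 x + u0 (- y)) + 2^-1 * (N x - N (- y)) + 4^-1 * \int[mu2]_(z in lray x `*` lray y) Phi z.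

Let rect_int f : locally_integrable_half f -> forall a b c d, 0 < a + c ->
  mu2.-integrable (rect a b c d) (EFin \o (f \o ch)).
Proof.
move=> fl a b c d ac; apply: diamond_integrable.
by apply: fl; [exact: compact_diamond|exact: diamond_half].
Qed.

Let rectD f g : locally_integrable_half f -> locally_integrable_half g -> forall a b c d, 0 < a + c ->
  mu2.-integrable (rect a b c d) (EFin \o (fun z => f (ch z) + g (ch z))).
Proof.
move=> fl gl a b c d ac; have mD : measurable (rect a b c d) by exact: measurableX.
exact: (integrableD mD (rect_int fl b d ac) (rect_int gl b d ac)).
Qed.

Let rectB f g : locally_integrable_half f -> locally_integrable_half g -> forall a b c d, 0 < a + c ->
  mu2.-integrable (rect a b c d) (EFin \o (fun z => f (ch z) - g (ch z))).
Proof.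
move=> fl gl a b c d ac; have mD : measurable (rect a b c d) by exact: measurableX.
exact: (integrableB mD (rect_int fl b d ac) (rect_int gl b d ac)).
Qed.

Let W z := U (ch z).
Let ph z := pt (ch z) + px (ch z).
Let Wi a b c d (ab : a < b) (cd : c < d) (ac : 0 < a + c) : mu2.-integrable (rect a b c d) (EFin \o W).
Proof. exact: rect_int. Qed.
Let phi a b c d (ab : a < b) (cd : c < d) (ac : 0 < a + c) : mu2.-integrable (rect a b c d) (EFin \o ph).
Proof. exact: rectD. Qed.
Let weakp a b c d n (ab : a < b) (cd : c < d) (ac : 0 < a + c) :=
  weak_incoming Ul ptl pxl weakt weakx n ab cd ac.

Lemma wave_local_primitive a b : a < b ->
  exists G h, is_primitive G h /\ forall x, a <= x <= b -> G x = u0 x.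
Proof. exact: (side_local_primitive cu0 Np Phii mild Wi phi weakp). Qed.

Lemma wave_density_incoming g : is_primitive u0 g ->
  {ae mu2, forall z, 0 < z.1 + z.2 -> pt (ch z) + px (ch z) =
    g z.1 + v0 z.1 + 2^-1 * \int[mu]_(s in lray z.2) Phi (z.1, s)}.
Proof.
move=> u0g; have := side_density cu0 Np Phii mild Wi phi weakp u0g.
by apply: ae2S => z h /h; rewrite /ph => ->; rewrite /incoming addrA.
Qed.

Let swp_rect a b c d : swp @^-1` (rect a b c d) = rect c d a b.
Proof. by apply/seteqP; split => z [h1 h2]; split. Qed.

Let swp_int f a b c d : mu2.-integrable (rect a b c d) (EFin \o f) ->
  mu2.-integrable (rect c d a b) (EFin \o (f \o swp)).
Proof.
move=> fi; have mD : measurable (rect a b c d) by exact: measurableX.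
have mD' : measurable (rect c d a b) by exact: measurableX.
apply/(restrict_integrable mu2) => //.
have := integrable_swp ((restrict_integrable mu2 f mD).2 fi); congr (mu2.-integrable setT).
apply/funext => z; rewrite /= !patchE; congr (EFin (if _ then _ else _)).
by rewrite -swp_rect; apply/idP/idP => /set_mem h; apply/mem_set.
Qed.

(** The reflection of x exchanges xi and sigma and changes the sign of the mass
    function N and of its argument; the incoming case applies to the reflected
    solution. *)
Lemma wave_density_outgoing g : is_primitive u0 g ->
  {ae mu2, forall z, 0 < z.1 + z.2 -> pt (ch z) - px (ch z) =
    - g (- z.2) + v0 (- z.2) + 2^-1 * \int[mu]_(s in lray z.1) Phi (s, z.2)}.
Proof.
move=> u0g.
pose W' z := W (swp z); pose q z := pt (ch (swp z)) - px (ch (swp z)).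
have n1 : (-1 : R) != 0 by rewrite oppr_eq0 oner_eq0.
have cu0' : continuous (fun x => u0 (- x)).
  by move=> x; apply: (@continuous_comp _ _ _ -%R u0); [exact: opp_continuous|exact: cu0].
have Np' : is_primitive (fun x => - N (- x)) (fun x => v0 (- x)).
  have := is_primitiveZ (-1) (is_primitive_affine 0 n1 Np).
  by congr is_primitive; apply/funext => x; rewrite !addr0 !mulN1r ?opprK.
have u0g' : is_primitive (fun x => u0 (- x)) (fun x => - g (- x)).
  have := is_primitive_affine 0 n1 u0g.
  by congr is_primitive; apply/funext => x; rewrite !addr0 !mulN1r.
have Phii' M : mu2.-integrable (lray M `*` lray M) (EFin \o (Phi \o swp)).
  have mN : measurable (lray M `*` lray M : set (measurableTypeR R * measurableTypeR R)) by exact: measurableX.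
  apply/(restrict_integrable mu2) => //.
  have := integrable_swp ((restrict_integrable mu2 Phi mN).2 (Phii M)).
  congr (mu2.-integrable setT); apply/funext => z; congr EFin; rewrite /= !patchE.
  by congr (if _ then _ else _); apply/idP/idP => /set_mem[h1 h2]; apply/mem_set; split.
have mild' x y : 0 <= x + y -> W' (x, y) = 2^-1 * (u0 (- x) + u0 (- - y)) +
    2^-1 * (- N (- x) - - N (- - y)) + 4^-1 * \int[mu2]_(z in lray x `*` lray y) (Phi \o swp) z.
  rewrite addrC => xy; rewrite /W' /W /swp /= mild// !opprK.
  have -> : \int[mu2]_(z in lray x `*` lray y) (Phi \o swp) z = \int[mu2]_(z in lray y `*` lray x) Phi z.
    rewrite -(@Rintegral_swp Phi (lray y `*` lray x)); last 2 first.
    - pose M := Num.max x y; apply: integrableS (Phii M); [exact: measurableX|exact: measurableX|].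
      move=> z [/=]; rewrite !in_itv /= => h1 h2; by rewrite /M !le_max h1 h2 orbT.
    - exact: measurableX.
    by congr Rintegral; apply/seteqP; split => z [h1 h2]; split.
  ring.
have W'i a b c d : a < b -> c < d -> 0 < a + c -> mu2.-integrable (rect a b c d) (EFin \o W').
  by move=> ab cd; rewrite addrC => ac; exact: (swp_int (Wi cd ab ac)).
have qi a b c d : a < b -> c < d -> 0 < a + c -> mu2.-integrable (rect a b c d) (EFin \o q).
  by move=> ab cd; rewrite addrC => ac; exact: (swp_int (rectB ptl pxl d b ac)).
have weakq a b c d (n : nat) : a < b -> c < d -> 0 < a + c ->
  \int[mu2]_(z in rect a b c d) (2 * (dcutoff a b n.+1%:R z.1 * cutoff c d n.+1%:R z.2) * W' z) =
  - \int[mu2]_(z in rect a b c d) (cutoff a b n.+1%:R z.1 * cutoff c d n.+1%:R z.2 * q z).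
  move=> ab cd; rewrite addrC => ac.
  have mD : measurable (rect c d a b) by exact: measurableX.
  have bnd (F G : R -> R) (f : R * R -> R) : continuous F -> continuous G ->
    mu2.-integrable (rect c d a b) (EFin \o f) ->
    mu2.-integrable (rect c d a b) (EFin \o (fun z => F z.1 * G z.2 * f z)).
    move=> cF cG fi.
    have [K K0 hK] := bounded_on_itv cF (ltW cd); have [L L0 hL] := bounded_on_itv cG (ltW ab).
    apply: (bounded_mul_integrable (K := K * L) mD fi).
      apply: measurable_funTS; apply: measurable_funM; apply: measurableT_comp => //;
        exact: continuous_measurable_fun.
    move=> z [/=]; rewrite !in_itv /= => z1 z2; rewrite normrM; apply: ler_pM => //; [exact: hK|exact: hL].
  have i1 : mu2.-integrable (rect c d a b) (EFin \o (fun z => 2 * (cutoff c d n.+1%:R z.1 * dcutoff a b n.+1%:R z.2) * W z)).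
    have := integrableZl mD 2 (bnd _ _ _ (@continuous_cutoff R c d n.+1%:R) (@continuous_dcutoff R a b n.+1%:R) (Wi cd ab ac)).
    by apply: eq_integrable => // z _; rewrite /= -EFinM; congr EFin; ring.
  have i2 := bnd _ _ _ (@continuous_cutoff R c d n.+1%:R) (@continuous_cutoff R a b n.+1%:R) (rectB ptl pxl d b ac).
  transitivity (\int[mu2]_(z in rect c d a b) (2 * (cutoff c d n.+1%:R z.1 * dcutoff a b n.+1%:R z.2) * W z)).
    rewrite -(Rintegral_swp i1 mD) swp_rect; apply: eq_Rintegral => z _.
    by rewrite /W' /=; ring.
  rewrite (weak_outgoing Ul ptl pxl weakt weakx n cd ab ac); congr (- _).
  rewrite -(Rintegral_swp i2 mD) swp_rect; apply: eq_Rintegral => z _.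
  by rewrite /q /=; ring.
have := side_density cu0' Np' Phii' mild' W'i qi weakq u0g'.
move=> /ae2_swp; apply: ae2S => -[x y] /= h; rewrite addrC => xy.
have := h xy; rewrite /q /swp /= => ->.
by rewrite /incoming /= addrA.
Qed.

End wave_densities.

(** * Vector-valued absolutely continuous functions *)
Section vector_tools.
Context {R : realType}.
Notation mu := (@lebesgue_measure R).
Notation mu2 := (mu \x mu)%E.
Notation lray x := (`]-oo, x]%classic : set (measurableTypeR R)).

Lemma loc_abs_continuous_continuous n (v : R -> 'cV[R]_n) i : loc_abs_continuous v ->
  continuous (fun x => v x i ord0).
Proof.
move=> va x; apply/cvgrPdist_lt => e e0.
have [d d0 hd] := va (x - 1) (x + 1) e e0.
have inc y z : x - 1 <= y -> y <= z -> z <= x + 1 -> z - y < d -> `|v z i ord0 - v y i ord0| < e.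
  move=> xy yz zx zyd.
  have := hd 1%N (fun=> y) (fun=> z); rewrite !big_ord1 => H.
  have := H _ _ zyd; rewrite (_ : v z i ord0 - v y i ord0 = (v z - v y) i ord0); last by rewrite !mxE.
  move=> H'; apply: le_lt_trans (ler_coord_norm _ _) (H' _ _) => [j|]; first by split.
  by move=> j k _ _ _; rewrite (ord1 j) (ord1 k).
apply/nbhs_ballP; exists (Num.min 1 d); first by rewrite /= lt_min ltr01.
move=> y; rewrite /ball /= lt_min => /andP[y1 yd].
have [xy|yx] := leP x y.
  rewrite distrC; apply: inc => //.
  - by rewrite gerBl.
  - by move: y1; rewrite distrC ger0_norm ?subr_ge0//; lra.
  - by move: yd; rewrite distrC ger0_norm ?subr_ge0//; lra.
apply: inc; [|exact: ltW| |].
- by move: y1; rewrite gtr0_norm ?subr_gt0//; lra.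
- by rewrite lerDl.
- by move: yd; rewrite gtr0_norm ?subr_gt0//; lra.
Qed.

(** A local primitive of v differentiates to its density almost everywhere, so any
    local density is [derive1 v]; the end points of the segment are excluded, since
    the derivative at them depends on v outside of it. *)
Lemma locally_primitive_derive1 n (v : R -> 'cV[R]_n) :
  (forall i a b, a < b -> exists G h, is_primitive G h /\ forall x, a <= x <= b -> G x = v x i ord0) ->
  vintegrable mu setT (derive1 v) ->
  forall i, is_primitive (fun x => v x i ord0) (fun x => derive1 v x i ord0).
Proof.
move=> loc dvi i; split; first exact: integrable_seg (dvi i).
move=> a b; rewrite le_eqVlt => /orP[/eqP<-|ab]; first by rewrite subrr set_itv1 Rintegral_set1.
have [G /choice[h hGh]] := choice (fun j => loc j a b ab) => {loc}.
pose w x : 'cV[R]_n := \col_j G j x.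
have wE j : (fun x => w x j ord0) = G j by apply/funext => x; rewrite mxE.
have wp j : is_primitive (fun x => w x j ord0) (h j) by rewrite wE; have [] := hGh j.
have wv x : a <= x <= b -> w x = v x.
  by move=> xab; apply/colP => j; rewrite mxE; have [_ ->] := hGh j.
rewrite -!wv ?lexx ?(ltW ab)// (wp i).2 ?ltW//.
have mab : measurable (`[a, b]%classic : set (measurableTypeR R)) by exact: measurable_itv.
apply: ae_eq_Rintegral => //.
- by have /integrableP[/measurable_EFinP] := (wp i).1 a b.
- by apply: measurable_funTS; have /integrableP[/measurable_EFinP] := dvi i.
have := derive1_components wp; have h2 := ae1_and (ae_neq a) (ae_neq b).
move=> h1; apply: ae1S2 h1 h2 => x hx [xa xb] /=; rewrite in_itv /= => /andP[ax xb'].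
have ax' : a < x by rewrite lt_neqAle eq_sym xa.
have xb'' : x < b by rewrite lt_neqAle xb.
have E : {near x, w =1 v}.
  near=> y; apply: wv; apply/andP; split; apply: ltW.
    by near: y; exact: lt_nbhsr.
  by near: y; exact: lt_nbhsl.
by rewrite -hx !derive1E (near_eq_derive _ E)// oner_neq0.
Unshelve. all: by end_near.
Qed.

End vector_tools.

(** * The source in characteristic coordinates *)
Section solution.
Context {R : realType}.
Notation mu := (@lebesgue_measure R).
Notation mu2 := (mu \x mu)%E.
Notation lray x := (`]-oo, x]%classic : set (measurableTypeR R)).
Variables (n : nat) (F : R * R -> 'cV[R]_n).

(** The extension by zero below the initial line turns integrals over backward
    triangles into integrals over full quadrants. *)
Definition source i (z : R * R) := if 0 <= z.1 + z.2 then F (ch z) i ord0 else 0.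

Hypothesis Fi : forall t x, 0 <= t -> vintegrable (leb2 R) (backward_triangle t x) F.

Lemma measurable_triangle t x : measurable (backward_triangle t x : set (measurableTypeR R * measurableTypeR R)).
Proof.
have -> : backward_triangle t x =
    ((fst : R * R -> R) @^-1` `[0, t]) `&` (((fun p : R * R => p.2 - p.1) @^-1` `[x - t, +oo[) `&`
    ((fun p : R * R => p.2 + p.1) @^-1` `]-oo, x + t])).
  apply/seteqP; split => p; rewrite /backward_triangle /= !in_itv /= ?andbT.
    by move=> [-> /andP[h1 h2]]; split => //; split; lra.
  by move=> [-> [h1 h2]]; split => //; apply/andP; split; lra.
apply: measurableI; last apply: measurableI.
- by rewrite -[X in measurable X]setTI; apply: measurable_fst => //; exact: measurable_itv.
- by rewrite -[X in measurable X]setTI; apply: measurable_funB => //; exact: measurable_itv.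
- by rewrite -[X in measurable X]setTI; apply: measurable_funD => //; exact: measurable_itv.
Qed.

Lemma source_triangle i t x z : 0 <= t ->
  ((fun p => F p i ord0) \_ (backward_triangle t x)) (ch z) =
  (source i \_ (lray (x + t) `*` lray (t - x))) z.
Proof.
move=> t0; rewrite !patchE /source; case: z => a b.
have E : (ch (a, b) \in backward_triangle t x) =
    (((a, b) \in lray (x + t) `*` lray (t - x)) && (0 <= a + b)).
  apply/idP/andP => [/set_mem|[/set_mem[/= ]]]; rewrite /backward_triangle /ch /=.
    move=> [/andP[h1 h2] /andP[h3 h4]]; split; last by lra.
    by apply/mem_set; split; rewrite /= in_itv /=; lra.
  rewrite !in_itv /= => h1 h2 h3; apply/mem_set; split; apply/andP; split => /=; lra.
by rewrite E; case: ((a, b) \in _) => //=; case: ifP.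
Qed.

Lemma source_quadrant i N : mu2.-integrable (lray N `*` lray N) (EFin \o source i).
Proof.
wlog N0 : N / 0 <= N.
  move=> H; pose M := Num.max 0 N; have M0 : 0 <= M by rewrite /M le_max lexx.
  apply: integrableS (H M M0); [exact: measurableX|exact: measurableX|].
  by move=> z [/=]; rewrite !in_itv /= /M !le_max => -> ->; rewrite !orbT.
have mT := measurable_triangle N 0.
have i1 := (restrict_integrable mu2 _ mT).2 (Fi 0 N0 i).
have mf : measurable_fun setT ((fun p => F p i ord0) \_ (backward_triangle N 0)).
  by have /integrableP[/measurable_EFinP] := i1.
have := (integrable_chP mf).2 i1 => i2.
apply/(restrict_integrable mu2); first exact: measurableX.
move: i2; congr (mu2.-integrable setT); apply/funext => z /=.
by rewrite source_triangle// add0r subr0.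
Qed.

(** The backward triangle with vertex (t, x) is a quadrant in characteristic
    coordinates, and 2 is the Jacobian of [ch]. *)
Lemma triangle_Rintegral i t x : 0 <= t ->
  \int[mu]_(tau in `[0, t]) \int[mu]_(y in `[x - t + tau, x + t - tau]) F (tau, y) i ord0 =
  2^-1 * \int[mu2]_(z in lray (x + t) `*` lray (t - x)) source i z.
Proof.
move=> t0; have mT := measurable_triangle t x.
have i1 := (restrict_integrable mu2 _ mT).2 (Fi x t0 i).
have E := Rintegral_ch i1.
transitivity (\int[mu2]_p ((fun p => F p i ord0) \_ (backward_triangle t x)) p).
  rewrite (Rfubini12 i1) [LHS]Rintegral_mkcond; apply: eq_Rintegral => tau _.
  rewrite patchE; case: ifPn => [/set_mem|].
    rewrite /= in_itv /= => tau0; rewrite [LHS]Rintegral_mkcond; apply: eq_Rintegral => y _.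
    rewrite !patchE; congr (if _ then _ else _).
    apply/idP/idP => /set_mem; rewrite /backward_triangle /= ?in_itv /= => h; apply/mem_set; rewrite /= ?in_itv //=.
    by case: h.
  rewrite notin_setE /= in_itv /= => ntau.
  rewrite (_ : (fun y => _) = cst 0); first by rewrite /Rintegral integral0.
  by apply/funext => y; rewrite patchE memNset//; move=> [].
rewrite -[LHS](mulKf (_ : 2 != 0 :> R))// -E; congr (_ * _).
rewrite [RHS]Rintegral_mkcond; apply: eq_Rintegral => z _; exact: source_triangle.
Qed.

End solution.

(** * Characteristic derivatives of the solution *)
Section solution_facts.
Context {R : realType}.
Notation mu := (@lebesgue_measure R).
Notation mu2 := (mu \x mu)%E.
Notation lray x := (`]-oo, x]%classic : set (measurableTypeR R)).
Variables (n : nat) (u0 v0 : R -> 'cV[R]_n) (F u ut ux : R * R -> 'cV[R]_n).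
Hypothesis data : L11 u0 v0.
Hypotheses (wt : weak_dt u ut) (wx : weak_dx u ux).
Hypothesis mild : forall t x, 0 <= t -> vintegrable (leb2 R) (backward_triangle t x) F /\
  u (t, x) = dAlembert u0 v0 (t, x) + 2^-1 *: vint (leb R) `[0, t]%classic (fun tau =>
    vint (leb R) `[x - t + tau, x + t - tau]%classic (fun y => F (tau, y))).

Definition mass i x := \int[mu]_(s in lray x) v0 s i ord0.

Lemma F_triangle t x : 0 <= t -> vintegrable (leb2 R) (backward_triangle t x) F.
Proof. by move=> t0; have [] := mild x t0. Qed.

Lemma v0_integrable i : mu.-integrable setT (EFin \o (fun x => v0 x i ord0)).
Proof. by have [_ h] := data; exact: (h i). Qed.

Lemma du0_integrable i : mu.-integrable setT (EFin \o (fun x => derive1 u0 x i ord0)).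
Proof. by have [[_ [_ h]] _] := data; exact: (h i). Qed.

Lemma mass_primitive i : is_primitive (mass i) (fun x => v0 x i ord0).
Proof. exact: is_primitive_Ny (v0_integrable i). Qed.

Lemma u0_continuous i : continuous (fun x => u0 x i ord0).
Proof. by have [[_ [h _]] _] := data; exact: loc_abs_continuous_continuous. Qed.

(** The double integral over the quadrant with corner (x + t, t - x) makes the mild
    formula a sum of functions of the characteristic coordinates, apart from the
    source. *)
Lemma mild_component i t x : 0 <= t -> u (t, x) i ord0 =
  2^-1 * (u0 (x + t) i ord0 + u0 (x - t) i ord0) + 2^-1 * (mass i (x + t) - mass i (x - t))
  + 4^-1 * \int[mu2]_(z in lray (x + t) `*` lray (t - x)) source F i z.
Proof.
move=> t0; have [_ ->] := mild x t0; rewrite /dAlembert !mxE.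
rewrite (mass_primitive i).2; last by lra.
congr (_ + _ + _).
have -> : \int[mu]_(tau in `[0, t]) vint (leb R) `[x - t + tau, x + t - tau] (fun y => F (tau, y)) i ord0 =
    \int[mu]_(tau in `[0, t]) \int[mu]_(y in `[x - t + tau, x + t - tau]) F (tau, y) i ord0.
  by apply: eq_Rintegral => tau _; rewrite mxE.
by rewrite (triangle_Rintegral F_triangle)//; field.
Qed.

Lemma mild_characteristic i x y : 0 <= x + y -> u (ch (x, y)) i ord0 =
  2^-1 * (u0 x i ord0 + u0 (- y) i ord0) + 2^-1 * (mass i x - mass i (- y))
  + 4^-1 * \int[mu2]_(z in lray x `*` lray y) source F i z.
Proof.
move=> xy; have t0 : 0 <= (x + y) / 2 by rewrite divr_ge0.
rewrite /ch /= mild_component//.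
have -> : (x - y) / 2 + (x + y) / 2 = x by field.
have -> : (x - y) / 2 - (x + y) / 2 = - y by field.
by have -> : (x + y) / 2 - (x - y) / 2 = y by field.
Qed.

Let loc (g : R * R -> 'cV[R]_n) i : loc_integrable g -> locally_integrable_half (fun p => g p i ord0).
Proof. by move=> gl C cC CH; exact: (gl C cC CH i). Qed.

Let ul i : locally_integrable_half (fun p => u p i ord0). Proof. by have [h _ _] := wt; exact: loc. Qed.
Let utl i : locally_integrable_half (fun p => ut p i ord0). Proof. by have [_ h _] := wt; exact: loc. Qed.
Let uxl i : locally_integrable_half (fun p => ux p i ord0). Proof. by have [_ h _] := wx; exact: loc. Qed.

Let weak_component e (w : R * R -> 'cV[R]_n) i : weak_derivative e u w -> forall phi, test_function phi ->
  \int[mu2]_(p in @halfplane R) ('D_e phi p * u p i ord0) = - \int[mu2]_(p in @halfplane R) (phi p * w p i ord0).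
Proof.
move=> [_ _ h] phi tphi; have := congr1 (fun m : 'cV[R]_n => m i ord0) (h phi tphi).
rewrite /vint !mxE => E.
have e1 : \int[mu2]_(p in @halfplane R) ('D_e phi p * u p i ord0) =
   \int[mu2]_(p in @halfplane R) ('D_e phi p *: u p) i ord0.
  by apply: eq_Rintegral => p _; rewrite mxE.
have e2 : \int[mu2]_(p in @halfplane R) (phi p * w p i ord0) =
   \int[mu2]_(p in @halfplane R) (phi p *: w p) i ord0.
  by apply: eq_Rintegral => p _; rewrite mxE.
by rewrite e1 e2; exact: E.
Qed.

(** The local primitives come from the weak derivatives of the solution, not from
    the absolute continuity of u0 alone. *)
Lemma u0_primitive i : is_primitive (fun x => u0 x i ord0) (fun x => derive1 u0 x i ord0).
Proof.
apply: locally_primitive_derive1; last by have [[_ [_ h]] _] := data.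
move=> j a b ab.
exact: (wave_local_primitive (ul j) (utl j) (uxl j) (weak_component j wt) (weak_component j wx)
  (@u0_continuous j) (mass_primitive j) (source_quadrant F_triangle j) (mild_characteristic j) ab).
Qed.

Definition incoming0 i x := derive1 u0 x i ord0 + v0 x i ord0.
Definition outgoing0 i y := - derive1 u0 (- y) i ord0 + v0 (- y) i ord0.

(** The weak derivatives of a mild solution are those obtained by differentiating
    the representation formula along characteristics. *)
Lemma incoming_density i : {ae mu2, forall z, 0 < z.1 + z.2 ->
  ut (ch z) i ord0 + ux (ch z) i ord0 = P_of (source F) incoming0 i z}.
Proof.
exact: (wave_density_incoming (ul i) (utl i) (uxl i) (weak_component i wt) (weak_component i wx)
  (@u0_continuous i) (mass_primitive i) (source_quadrant F_triangle i) (mild_characteristic i) (u0_primitive i)).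
Qed.

Lemma outgoing_density i : {ae mu2, forall z, 0 < z.1 + z.2 ->
  ut (ch z) i ord0 - ux (ch z) i ord0 = Q_of (source F) outgoing0 i z}.
Proof.
exact: (wave_density_outgoing (ul i) (utl i) (uxl i) (weak_component i wt) (weak_component i wx)
  (@u0_continuous i) (mass_primitive i) (source_quadrant F_triangle i) (mild_characteristic i) (u0_primitive i)).
Qed.

(** The space derivative of the solution on the time slice t, as half the
    difference of the two characteristic derivatives. *)
Definition slope i t x := 2^-1 * (P_of (source F) incoming0 i (x + t, t - x) -
   Q_of (source F) outgoing0 i (x + t, t - x)).

Lemma dAlembert_primitive (U V du v : R -> R) t : is_primitive U du -> is_primitive V v ->
  is_primitive (fun x => 2^-1 * (U (x + t) + U (x - t)) + 2^-1 * (V (x + t) - V (x - t)))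
    (fun x => 2^-1 * (du (x + t) + v (x + t)) - 2^-1 * (- du (x - t) + v (x - t))).
Proof.
move=> Up Vp; have n1 : (1 : R) != 0 by exact: oner_neq0.
have h1 := is_primitiveZ 2^-1 (is_primitive_affine t n1 Up).
have h2 := is_primitiveZ 2^-1 (is_primitive_affine (- t) n1 Up).
have h3 := is_primitiveZ 2^-1 (is_primitive_affine t n1 Vp).
have h4 := is_primitiveZ (- 2^-1) (is_primitive_affine (- t) n1 Vp).
have := is_primitiveD (is_primitiveD h1 h2) (is_primitiveD h3 h4).
by congr is_primitive; apply/funext => x; rewrite !mul1r; ring.
Qed.

(** Valid for every t >= 0, unlike the statements on weak derivatives, because the
    mild formula holds at every point. *)
Lemma u_slope i t : 0 <= t -> is_primitive (fun x => u (t, x) i ord0) (slope i t).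
Proof.
move=> t0.
(* on a segment of the slice only the source in a large quadrant matters, which is integrable *)
have local a b : a <= b -> exists G g, [/\ is_primitive G g,
    forall x, a <= x <= b -> G x = u (t, x) i ord0 & forall x, a <= x <= b -> g x = slope i t x].
  move=> ab; pose M := Num.max (b + t) (t - a).
  have cutE x : a <= x <= b -> lray (x + t) `*` lray (t - x) `<=` lray M `*` lray M.
    move=> /andP[ax xb] z [/=]; rewrite !in_itv /= /M !le_max => h1 h2; split; apply/orP; [left|right]; lra.
  pose Phi := (source F i) \_ (lray M `*` lray M).
  have Phii : mu2.-integrable setT (EFin \o Phi).
    by apply/(restrict_integrable mu2); [exact: measurableX|exact: (source_quadrant F_triangle)].
  have h1 := dAlembert_primitive t (u0_primitive i) (mass_primitive i).
  have h2 := is_primitiveZ 4^-1 (past_cone_primitive t Phii).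
  exists (fun x => 2^-1 * (u0 (x + t) i ord0 + u0 (x - t) i ord0) + 2^-1 * (mass i (x + t) - mass i (x - t))
    + 4^-1 * \int[mu2]_(z in lray (x + t) `*` lray (t - x)) Phi z).
  eexists; split; first exact: (is_primitiveD h1 h2).
    move=> x xab; rewrite mild_component//; congr (_ + _ * _).
    by apply: eq_Rintegral => z /set_mem h; rewrite /Phi patchE mem_set//; exact: cutE xab _ h.
  move=> x xab; rewrite /slope /P_of /Q_of /incoming0 /outgoing0 /= opprB.
  have -> : \int[mu]_(s in lray (t - x)) Phi (x + t, s) = \int[mu]_(s in lray (t - x)) source F i (x + t, s).
    apply: eq_Rintegral => s /set_mem h; rewrite /Phi patchE mem_set//; apply: (cutE _ xab); split => //=.
    by rewrite in_itv /=.
  have -> : \int[mu]_(s in lray (x + t)) Phi (s, t - x) = \int[mu]_(s in lray (x + t)) source F i (s, t - x).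
    apply: eq_Rintegral => s /set_mem h; rewrite /Phi patchE mem_set//; apply: (cutE _ xab); split => //=.
    by rewrite in_itv /=.
  by field.
split=> [a b|a b ab].
  have [ab|ba] := leP a b; last first.
    rewrite set_itv_ge; first exact: integrable_set0 || by rewrite -leNgt.
    by rewrite bnd_simp -ltNge.
  have [G [g [Gg _ gE]]] := local a b ab.
  have := Gg.1 a b; apply: eq_integrable => // x /set_mem /=; rewrite in_itv /= => xab.
  by rewrite gE.
have [G [g [Gg GE gE]]] := local a b ab.
rewrite -!GE ?lexx ?ab// Gg.2//; apply: eq_Rintegral => x /set_mem /=; rewrite in_itv /= => xab.
by rewrite gE.
Qed.

Lemma derive1_u t : 0 <= t ->
  {ae mu, forall x, forall i, derive1 (fun y => u (t, y)) x i ord0 = slope i t x}.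
Proof. by move=> t0; apply: derive1_components => i; exact: u_slope. Qed.

End solution_facts.

(** * Norms and averages over strips *)
Section norms.
Context {R : realType}.
Notation mu := (@lebesgue_measure R).
Notation mu2 := (mu \x mu)%E.

Lemma measurable_norm_cV n (g : R -> 'cV[R]_n) : (forall i, measurable_fun setT (fun x => g x i ord0)) ->
  measurable_fun setT (fun x => `|g x|).
Proof.
move=> mg; rewrite (_ : (fun x => _) = fun x => \big[Num.max/0]_(ij : 'I_n * 'I_1) `|g x ij.1 ij.2|); last first.
  by apply/funext => x; exact: mx_normrE.
elim: (index_enum _) => [|ij s IH].
  by rewrite (_ : (fun x => _) = cst 0) //; apply/funext => x; rewrite big_nil.
rewrite (_ : (fun x => _) = fun x => Num.max `|g x ij.1 ij.2| (\big[Num.max/0]_(k <- s) `|g x k.1 k.2|)).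
  apply: measurable_maxr => //; apply: measurableT_comp => //.
  by case: ij => i j /=; rewrite (ord1 j).
by apply/funext => x; rewrite big_cons.
Qed.

Lemma vintegrable_measurable n (g : R -> 'cV[R]_n) : vintegrable mu setT g ->
  forall i, measurable_fun setT (fun x => g x i ord0).
Proof. by move=> gi i; have /integrableP[/measurable_EFinP] := gi i. Qed.

Lemma L1_normE n (g : R -> 'cV[R]_n) : (L1_norm g = \int[mu]_x `|g x|%:E)%E.
Proof. by rewrite /L1_norm Lnorm1; apply: eq_integral => x _; rewrite /= normr_id. Qed.

Lemma coord_le_L1_norm n (g : R -> 'cV[R]_n) i : vintegrable mu setT g ->
  (\int[mu]_x `|g x i ord0|%:E <= L1_norm g)%E.
Proof.
move=> gi; have mg := vintegrable_measurable gi; rewrite L1_normE.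
apply: ge0_le_integral => //.
- by apply/measurable_EFinP; apply: measurableT_comp => //; exact: mg.
- by apply/measurable_EFinP; exact: measurable_norm_cV.
- by move=> x _; rewrite lee_fin; exact: ler_coord_norm.
Qed.

Lemma L1_norm_le n (g : R -> 'cV[R]_n) : (forall i, measurable_fun setT (fun x => g x i ord0)) ->
  (L1_norm g <= \sum_i \int[mu]_x `|g x i ord0|%:E)%E.
Proof.
move=> mg; have mE i : measurable_fun setT (fun x => (`|g x i ord0|)%:E).
  by apply/measurable_EFinP; apply: measurableT_comp => //; exact: mg.
rewrite L1_normE -ge0_integral_sum//.
apply: ge0_le_integral => //.
- by apply/measurable_EFinP; exact: measurable_norm_cV.
- exact: emeasurable_sum.
- by move=> x _; rewrite sumEFin lee_fin; exact: ler_norm_cV.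
Qed.

(** A bound on almost every time slice, integrated over 0 <= t <= T / 2; the
    Jacobian 2 gives the factor T. *)
Lemma strip_integral_le (H : R * R -> R) (B T : R) : 0 < T -> 0 <= B -> measurable_fun setT H ->
  (forall z, 0 <= H z) ->
  {ae mu, forall t, 0 < t -> (\int[mu]_x (H ((x + t)%R, (t - x)%R))%:E <= B%:E)%E} ->
  (\int[mu2]_(z in strip T) (H z)%:E <= (B * T)%:E)%E.
Proof.
move=> T0 B0 mH H0 HB.
pose A := `[0, T / 2]%classic : set (measurableTypeR R).
pose g (p : R * R) := if (0 <= p.1) && (p.1 <= T / 2) then (H (hc p))%:E else 0%E.
have mg : measurable_fun setT g.
  apply: measurable_fun_ifT => //; last by apply/measurable_EFinP; exact: (measurableT_comp mH measurable_hc).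
  by apply: measurable_and; apply: measurable_fun_ler => //; exact: measurable_fst.
have g0 p : (0 <= g p)%E by rewrite /g; case: ifP; rewrite ?lee_fin.
have -> : (\int[mu2]_(z in strip T) (H z)%:E = \int[mu2]_z g (ch z))%E.
  rewrite integral_mkcond; apply: eq_integral => z _; rewrite patchE /g chK.
  congr (if _ then _ else _); apply/idP/idP => [/set_mem|]; rewrite /strip /ch /= => /andP[h1 h2]; [|apply/mem_set]; apply/andP; rewrite /=; split; lra.
rewrite (ge0_integral_ch mg g0) (tonelli12 mg g0).
apply: (@le_trans _ _ (2%:E * \int[mu]_(t in A) B%:E)%E).
  apply: lee_wpmul2l => //; rewrite [leRHS]integral_mkcond.
  apply: ae_ge0_le_integral => //.
  - by move=> t _; exact: integral_ge0.
  - exact: (measurable_tonelli1 mg g0).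
  - by move=> t _; rewrite patchE; case: ifP.
  - by apply/(measurable_restrictT _ _).1; [exact: measurable_itv|exact: measurable_cst].
  apply: ae1S2 HB (ae_neq 0) => t ht t0 _; rewrite patchE /g /=.
  have -> : (t \in A) = (0 <= t <= T / 2).
    by apply/idP/idP => [/set_mem|h]; [|apply/mem_set]; rewrite /A /= in_itv.
  case: ifPn => [/andP[t1 _]|_]; last by rewrite integral0.
  apply: le_trans (ht _); last by rewrite lt_neqAle eq_sym t0.
  by [].
have muA : mu A = (T / 2)%:E.
  by apply: (etrans (lebesgue_measure_itv _)); rewrite /= lte_fin divr_gt0// oppr0 adde0.
rewrite integral_cst//; last exact: measurable_itv.
rewrite [X in (2%:E * (_ * X))%E](_ : _ = (T / 2)%:E)// -!EFinM lee_fin.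
by rewrite le_eqVlt; apply/orP; left; apply/eqP; field.
Qed.

End norms.

(** * The null form *)
Section null_form.
Context {R : realType}.
Notation mu := (@lebesgue_measure R).
Notation mu2 := (mu \x mu)%E.

Lemma bounded_matrix m p (T : Type) (g : T -> 'M[R]_(m, p)) :
  [bounded g y | y in setT] -> exists2 K : R, 0 <= K & forall y i j, `|g y i j| <= K.
Proof.
move=> [M [Mr hM]]; exists (`|M| + 1); first by rewrite addr_ge0.
move=> y i j; apply: le_trans (_ : `|g y| <= _).
  by rewrite [leRHS]mx_normrE; exact: (le_bigmax _ (fun ij => `|g y ij.1 ij.2|) (i, j)).
apply: hM => //; apply: le_lt_trans (ler_norm _) _; by rewrite ltrDl.
Qed.

(** The null structure: with a = d_t u + d_x u and b = d_t u - d_x u, the form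
    d_t u_j d_t u_k - d_x u_j d_x u_k is (a_j b_k + a_k b_j) / 2, in which no product of
    two derivatives along the same family of characteristics occurs. *)
Lemma nonlinearity_bound n (Gamma : 'I_n -> 'I_n -> 'cV[R]_n -> 'cV[R]_n) (P : 'cV[R]_n -> 'M[R]_n) :
  (forall j k, [bounded Gamma j k y | y in setT]) -> [bounded P y | y in setT] ->
  exists2 K : R, 0 < K & forall (f u ut ux : R * R -> 'cV[R]_n) p i,
    `|nonlinearity Gamma P f u ut ux p i ord0| <=
      K * (\sum_j `|ut p j ord0 + ux p j ord0|) * (\sum_j `|ut p j ord0 - ux p j ord0|)
      + K * \sum_j `|f p j ord0|.
Proof.
move=> Gb Pb.
have [KP KP0 hKP] := bounded_matrix Pb.
have /choice[KG hKG] (jk : 'I_n * 'I_n) : exists K : R, 0 <= K /\ forall y i j, `|Gamma jk.1 jk.2 y i j| <= K.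
  by have [K K0 hK] := bounded_matrix (Gb jk.1 jk.2); exists K.
pose S := \sum_jk KG jk.
have S0 : 0 <= S by apply: sumr_ge0 => jk _; exact: (hKG jk).1.
have GS j k y i : `|Gamma j k y i ord0| <= S.
  apply: le_trans ((hKG (j, k)).2 y i ord0) _.
  by rewrite /S (bigD1 (j, k))//= lerDl sumr_ge0// => jk _; exact: (hKG jk).1.
pose K := S + KP + 1.
have K0 : 0 < K by rewrite ltr_wpDl// addr_ge0.
exists K => // f u ut ux p i.
pose a j := ut p j ord0 + ux p j ord0; pose b j := ut p j ord0 - ux p j ord0.
rewrite /nonlinearity !mxE summxE.
apply: le_trans (ler_normD _ _) _; apply: lerD; last first.
  rewrite mulr_sumr; apply: le_trans (ler_norm_sum _ _ _) _; apply: ler_sum => j _.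
  rewrite normrM ler_wpM2r//; apply: le_trans (hKP _ _ _) _.
  by rewrite /K; lra.
apply: le_trans (ler_norm_sum _ _ _) _.
apply: (@le_trans _ _ (\sum_j \sum_k (K * (2^-1 * (`|a j| * `|b k| + `|a k| * `|b j|))))).
  apply: ler_sum => j _; rewrite summxE; apply: le_trans (ler_norm_sum _ _ _) _.
  apply: ler_sum => k _; rewrite !mxE normrM mulrC; apply: ler_pM => //.
    by apply: le_trans (GS j k _ _) _; rewrite /K; lra.
  have -> : ut p j ord0 * ut p k ord0 - ux p j ord0 * ux p k ord0 = 2^-1 * (a j * b k + a k * b j).
    by rewrite /a /b; field.
  rewrite normrM gtr0_norm ?invr_gt0// ler_wpM2l ?invr_ge0//.
  by apply: le_trans (ler_normD _ _) _; rewrite !normrM.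
have E : \sum_j \sum_k `|a j| * `|b k| = (\sum_j `|a j|) * (\sum_k `|b k|).
  by rewrite mulr_suml; apply: eq_bigr => j _; rewrite mulr_sumr.
have E' : \sum_j \sum_k `|a k| * `|b j| = (\sum_j `|a j|) * (\sum_k `|b k|).
  by rewrite exchange_big.
under eq_bigr do rewrite -mulr_sumr -mulr_sumr big_split /=.
rewrite -mulr_sumr -mulr_sumr big_split /= E E' -mulrA.
by rewrite ler_wpM2l ?(ltW K0)// le_eqVlt; apply/orP; left; apply/eqP; field.
Qed.

End null_form.

(** * The source of a global solution is integrable *)
Section source_L1.
Context {R : realType}.
Notation mu := (@lebesgue_measure R).
Notation mu2 := (mu \x mu)%E.
Notation lray x := (`]-oo, x]%classic : set (measurableTypeR R)).
Variables (n : nat) (u0 v0 : R -> 'cV[R]_n) (F f u ut ux : R * R -> 'cV[R]_n).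
Hypothesis data : L11 u0 v0.
Hypotheses (wt : weak_dt u ut) (wx : weak_dx u ux).
Hypothesis mild : forall t x, 0 <= t -> vintegrable (leb2 R) (backward_triangle t x) F /\
  u (t, x) = dAlembert u0 v0 (t, x) + 2^-1 *: vint (leb R) `[0, t]%classic (fun tau =>
    vint (leb R) `[x - t + tau, x + t - tau]%classic (fun y => F (tau, y))).
Hypothesis fi : vintegrable (leb2 R) (@halfplane R) f.
Hypothesis uH : in_H u ut.
Variable K : R.
Hypothesis K0 : 0 < K.
Hypothesis FK : forall p i, `|F p i ord0| <=
  K * (\sum_j `|ut p j ord0 + ux p j ord0|) * (\sum_j `|ut p j ord0 - ux p j ord0|)
  + K * \sum_j `|f p j ord0|.

Local Notation Phi := (source F).
Local Notation p0 := (incoming0 u0 v0).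
Local Notation q0 := (outgoing0 u0 v0).
Local Notation P := (P_of Phi p0).
Local Notation Q := (Q_of Phi q0).

Lemma source_quadrants i M : mu2.-integrable (lray M `*` lray M) (EFin \o Phi i).
Proof. exact: (source_quadrant (F_triangle mild)). Qed.

Lemma incoming0_integrable i : mu.-integrable setT (EFin \o p0 i).
Proof. exact: (integrableD measurableT (du0_integrable data i) (v0_integrable data i)). Qed.

Lemma outgoing0_integrable i : mu.-integrable setT (EFin \o q0 i).
Proof.
have [h1 _] := Rintegral_reflect (du0_integrable data i).
have [h2 _] := Rintegral_reflect (v0_integrable data i).
have := integrableB measurableT h2 h1.
by apply: eq_integrable => // x _; rewrite /outgoing0 /= addrC.
Qed.

Lemma measurable_source i : measurable_fun setT (Phi i).
Proof. exact: quadrant_integrable_measurable (source_quadrants i). Qed.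

Lemma measurable_P i : measurable_fun setT (P i).
Proof.
apply: measurable_funD.
  apply: measurableT_comp; last exact: measurable_fst.
  by have /integrableP[/measurable_EFinP] := incoming0_integrable i.
by apply: measurable_funM => //; exact: measurable_partial (measurable_source i).
Qed.

Lemma measurable_Q i : measurable_fun setT (Q i).
Proof.
apply: measurable_funD.
  apply: measurableT_comp; last exact: measurable_snd.
  by have /integrableP[/measurable_EFinP] := outgoing0_integrable i.
by apply: measurable_funM => //; exact: measurable_partial2 (measurable_source i).
Qed.

Lemma ae_ut : {ae mu, forall t, {ae mu, forall x, 0 < t -> forall i,
  ut (t, x) i ord0 = 2^-1 * (P i (x + t, t - x) + Q i (x + t, t - x))}}.
Proof.
have h1 := ae2_fin (incoming_density data wt wx mild).
have h2 := ae2_fin (outgoing_density data wt wx mild).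
have := ae2_hc (ae2_and h1 h2); move=> /ae_section1; apply: ae1S => t; apply: ae1S => x /=.
rewrite hcK /hc /= => -[g1 g2] t0 i.
have t2 : 0 < x + t + (t - x) by lra.
by rewrite -(g1 i t2) -(g2 i t2); field.
Qed.

(** Membership in the solution space provides bounds uniform in time. *)
Lemma energy : exists2 B : R, 0 <= B & forall t i, 0 <= t ->
  (\int[mu]_x `|ut (t, x) i ord0|%:E <= B%:E)%E /\
  (\int[mu]_x `|derive1 (fun y => u (t, y)) x i ord0|%:E <= B%:E)%E.
Proof.
have [[uX [C1 hC1] _] [_ [utX [C2 hC2] _]]] := uH.
exists (`|C1| + `|C2|); first by rewrite addr_ge0.
move=> t i t0; split.
  apply: le_trans (coord_le_L1_norm i (utX t t0)) _; apply: le_trans (hC2 t t0) _.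
  by rewrite lee_fin; apply: le_trans (ler_norm _) _; rewrite lerDr.
have [_ [_ du]] := uX t t0.
apply: le_trans (coord_le_L1_norm i du) _.
apply: (@le_trans _ _ (Linf_homW11_norm (curry u t))).
  by rewrite /Linf_homW11_norm leeDr// Lnorm_ge0.
apply: le_trans (hC1 t t0) _.
by rewrite lee_fin; apply: le_trans (ler_norm _) _; rewrite lerDl.
Qed.

(** With s = 1 the function H is the incoming derivative on the slice, and with
    s = -1 the outgoing one. *)
Let slope_energy (s : R) (B : R) : `|s| = 1 -> 0 <= B ->
  (forall t i, 0 <= t -> (\int[mu]_x `|ut (t, x) i ord0|%:E <= B%:E)%E /\
    (\int[mu]_x `|derive1 (fun y => u (t, y)) x i ord0|%:E <= B%:E)%E) ->
  {ae mu, forall t, 0 < t -> forall H : 'I_n -> R -> R, (forall i, measurable_fun setT (H i)) ->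
    {ae mu, forall x, forall i, H i x = ut (t, x) i ord0 + s * slope u0 v0 F i t x} ->
    (\int[mu]_x (\sum_i `|H i x|)%:E <= (n%:R * (2 * B))%:E)%E}.
Proof.
move=> s1 B0 hB; apply: ae1S ae_ut => t _ t0 H mH HE.
have [[uX _ _] [_ [utX _ _]]] := uH.
have du := derive1_u data wt wx mild (ltW t0).
have mut i : measurable_fun setT (fun x => ut (t, x) i ord0).
  exact: (vintegrable_measurable (utX t (ltW t0))).
have mdu i : measurable_fun setT (fun x => derive1 (fun y => u (t, y)) x i ord0).
  by have [_ [_ h]] := uX t (ltW t0); exact: (vintegrable_measurable h).
have mE (G : R -> R) : measurable_fun setT G -> measurable_fun setT (fun x => `|G x|%:E).
  by move=> mG; apply/measurable_EFinP; exact: measurableT_comp.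
under eq_integral do rewrite -sumEFin.
rewrite ge0_integral_sum//; last by move=> i; exact: (mE _ (mH i)).
apply: (@le_trans _ _ (\sum_(i < n) (2 * B)%:E)%E); last first.
  by rewrite sumEFin lee_fin sumr_const card_ord -[leLHS]mulr_natl.
apply: lee_sum => i _.
apply: (@le_trans _ _ (\int[mu]_x (`|ut (t, x) i ord0|%:E + `|derive1 (fun y => u (t, y)) x i ord0|%:E))%E).
  apply: ae_ge0_le_integral => //.
  - exact: (mE _ (mH i)).
  - by move=> x _; rewrite adde_ge0.
  - by apply: emeasurable_funD; apply: mE; [exact: mut|exact: mdu].
  apply: ae1S2 HE du => x /(_ i) -> /(_ i) -> _; rewrite -EFinD lee_fin.
  by apply: le_trans (ler_normD _ _) _; rewrite normrM s1 mul1r.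
have [b1 b2] := hB t i (ltW t0).
rewrite ge0_integralD//; [|exact: (mE _ (mut i))|exact: (mE _ (mdu i))].
by rewrite mulrDl mul1r EFinD; exact: leeD.
Qed.

Lemma strip_energy : exists2 M : R, 0 < M & forall T, 0 < T ->
  (\int[mu2]_(z in strip T) (\sum_i `|P i z|)%:E <= (M * T)%:E)%E /\
  (\int[mu2]_(z in strip T) (\sum_i `|Q i z|)%:E <= (M * T)%:E)%E.
Proof.
have [B B0 hB] := energy.
have nB : 0 <= n%:R * (2 * B) by rewrite !mulr_ge0.
have M0 : 0 < n%:R * (2 * B) + 1 by rewrite ltr_wpDl.
exists (n%:R * (2 * B) + 1) => // T T0.
have n1 : `|-1| = 1 :> R by rewrite normrN normr1.
have msum (G : 'I_n -> R * R -> R) : (forall i, measurable_fun setT (G i)) ->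
    measurable_fun setT (fun z => \sum_i `|G i z|).
  by move=> mG; apply: measurable_sum => i; apply: measurableT_comp.
have ge0 (G : 'I_n -> R * R -> R) z : 0 <= \sum_i `|G i z| by exact: sumr_ge0.
have mline (G : R * R -> R) (t : R) : measurable_fun setT G -> measurable_fun setT (fun x : R => G (x + t, t - x)).
  move=> mG; have mt := measurable_pair1 t; apply: measurableT_comp mG _.
  by apply: measurable_fun_pair; [apply: measurable_funD|apply: measurable_funB].
split; apply: (strip_integral_le T0 (ltW M0)).
- exact: msum measurable_P.
- exact: ge0.
- apply: ae1S2 ae_ut (slope_energy (normr1 _) B0 hB) => t h1 h2 t0.
  apply: le_trans (h2 t0 (fun i x => P i (x + t, t - x)) _ _) _.
  + by move=> i; apply: mline; exact: measurable_P.
  + by apply: ae1S h1 => x /(_ t0) h i; rewrite h mul1r /slope; field.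
  + by rewrite lee_fin lerDl.
- exact: msum measurable_Q.
- exact: ge0.
- apply: ae1S2 ae_ut (slope_energy n1 B0 hB) => t h1 h2 t0.
  apply: le_trans (h2 t0 (fun i x => Q i (x + t, t - x)) _ _) _.
  + by move=> i; apply: mline; exact: measurable_Q.
  + by apply: ae1S h1 => x /(_ t0) h i; rewrite h /slope; field.
  + by rewrite lee_fin lerDl.
Qed.

Lemma ae_off_axis : {ae mu2, forall z : R * R, z.1 + z.2 != 0}.
Proof.
apply: ae2S (ae2_ch (ae2_fst (ae_neq (0 : R)))) => z /=; apply: contra => /eqP ->.
by rewrite mul0r.
Qed.

(** A global solution with bounded energy has an integrable nonlinearity, without
    any smallness: the null structure bounds the source by a product of an
    incoming and an outgoing derivative, whose strip integrals grow linearly. *)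
Lemma source_integrable i : mu2.-integrable setT (EFin \o Phi i).
Proof.
have [M M0 hM] := strip_energy.
pose fp j := (fun p => f p j ord0) \_ (@halfplane R).
have mhalf : measurable (@halfplane R : set (measurableTypeR R * measurableTypeR R)).
  rewrite (_ : @halfplane R = (fst : R * R -> R) @^-1` `[0, +oo[); last first.
    by apply/seteqP; split => p; rewrite /halfplane /= in_itv /= andbT.
  by rewrite -[X in measurable X]setTI; apply: measurable_fst => //; exact: measurable_itv.
have fpi j : mu2.-integrable setT (EFin \o fp j).
  by apply/(restrict_integrable mu2) => //; exact: fi.
have fchi j : mu2.-integrable setT (EFin \o (fp j \o ch)).
  have mf : measurable_fun setT (fp j) by have /integrableP[/measurable_EFinP] := fpi j.
  exact: ((integrable_chP mf).2 (fpi j)).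
pose g z := n%:R * K * \sum_j `|fp j (ch z)|.
have gi : mu2.-integrable setT (EFin \o g).
  have s : mu2.-integrable setT (EFin \o (fun z => \sum_j `|fp j (ch z)|)).
    rewrite (_ : EFin \o _ = fun z => (\sum_(j <- index_enum 'I_n) (`|fp j (ch z)|)%:E)%E); last first.
      by apply/funext => z; rewrite /= sumEFin.
    by apply: integrable_sum => // j _; exact: (integrable_norm (fchi j)).
  exact: (integrableZl measurableT (n%:R * K) s).
have C0 : 0 < n%:R * K + 1 by rewrite ltr_wpDl// mulr_ge0// ltW.
apply: (goursat_integrable (g := g) C0 M0 _ source_quadrants incoming0_integrable outgoing0_integrable gi).
- by move=> j z z0; rewrite /source leNgt z0.
- by move=> z; rewrite mulr_ge0 ?mulr_ge0 ?sumr_ge0// ltW.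
- have h1 := ae2_fin (incoming_density data wt wx mild).
  have h2 := ae2_fin (outgoing_density data wt wx mild).
  apply: ae2S2 (ae2_and h1 h2) ae_off_axis => z [g1 g2] z0 zge.
  have zgt : 0 < z.1 + z.2 by rewrite lt_neqAle eq_sym z0.
  set a := \sum_j `|P j z|; set b := \sum_j `|Q j z|.
  have a0 : 0 <= a by exact: sumr_ge0.
  have b0 : 0 <= b by exact: sumr_ge0.
  have aE : \sum_j `|ut (ch z) j ord0 + ux (ch z) j ord0| = a.
    by apply: eq_bigr => j _; rewrite g1.
  have bE : \sum_j `|ut (ch z) j ord0 - ux (ch z) j ord0| = b.
    by apply: eq_bigr => j _; rewrite g2.
  apply: (@le_trans _ _ (\sum_(j < n) (K * a * b + K * \sum_j `|fp j (ch z)|))).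
    apply: ler_sum => j _; rewrite /source zge.
    apply: le_trans (FK _ _) _; rewrite aE bE lerD2l ler_wpM2l ?(ltW K0)//.
    apply: ler_sum => k _; rewrite /fp patchE mem_set//.
    by rewrite /halfplane /ch /= divr_ge0.
  rewrite /g; set S := \sum_j `|fp j (ch z)|; rewrite sumr_const card_ord -[leLHS]mulr_natl.
  by rewrite -subr_ge0 (_ : _ - _ = a * b) ?mulr_ge0//; ring.
- by move=> T T0; have [] := hM T T0.
- by move=> T T0; have [] := hM T T0.
Qed.

End source_L1.

(** * Continuity of translations in L1 *)
Section translations.
Context {R : realType}.
Notation mu := (@lebesgue_measure R).
Notation mu2 := (mu \x mu)%E.

(** An open set is the union of the open squares with rational centre and
    inverse-integer radius that it contains. *)
Lemma open_measurable_plane (U : set (R * R)) : open U ->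
  measurable (U : set (measurableTypeR R * measurableTypeR R)).
Proof.
move=> oU.
pose box (q : (rat * rat) * nat) : set (measurableTypeR R * measurableTypeR R) :=
  `](ratr q.1.1 - q.2.+1%:R^-1)%R, (ratr q.1.1 + q.2.+1%:R^-1)%R[%classic `*`
  `](ratr q.1.2 - q.2.+1%:R^-1)%R, (ratr q.1.2 + q.2.+1%:R^-1)%R[%classic.
pose T (m : nat) : set (measurableTypeR R * measurableTypeR R) :=
  if unpickle m is Some q then (if `[< box q `<=` U >] then box q else set0) else set0.
have mT m : measurable (T m).
  rewrite /T; case: (unpickle m) => [q|]; last exact: measurable0.
  by case: ifP => _; [exact: measurableX|exact: measurable0].
rewrite (_ : U = \bigcup_m T m); first exact: bigcupT_measurable.
apply/seteqP; split => [[x y] Uxy|z [m _]]; last first.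
  by rewrite /T; case: (unpickle m) => [q|//]; case: ifPn => // /asboolP sub /sub.
have /nbhs_ballP[r /= r0 hr] : nbhs (x, y) U by exact: open_nbhs_nbhs.
have [k hk] : exists k : nat, k.+1%:R^-1 < r / 2.
  exists (Num.bound (2 / r)); rewrite invf_plt ?posrE ?divr_gt0// invf_div.
  apply: lt_trans (archi_boundP _) _; first by rewrite divr_ge0// ltW.
  by rewrite ltr_nat.
have k0 : 0 < k.+1%:R^-1 :> R by rewrite invr_gt0.
have rt (z : R) : exists q : rat, z - k.+1%:R^-1 < ratr q < z + k.+1%:R^-1.
  have zk : z - k.+1%:R^-1 < z + k.+1%:R^-1 by move: (k.+1%:R^-1) k0 => d d0; lra.
  by have [q] := rat_in_itvoo zk; rewrite in_itv /=; exists q.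
have [q1 /andP[q11 q12]] := rt x; have [q2 /andP[q21 q22]] := rt y.
have [m mE] : exists m, unpickle m = Some ((q1, q2), k).
  by exists (pickle ((q1, q2), k)); exact: pickleK.
exists m; first by [].
rewrite /T mE.
have sub : box (q1, q2, k) `<=` U.
  move=> [a b] [/=]; rewrite !in_itv /= => /andP[a1 a2] /andP[b1 b2]; apply: hr.
  move: (k.+1%:R^-1) hk k0 q11 q12 q21 q22 a1 a2 b1 b2 => d *.
  by split => /=; rewrite /ball /= ltr_norml; apply/andP; split; lra.
rewrite (introT (asboolP _) sub).
by split; rewrite /= in_itv /=; move: (k.+1%:R^-1) q11 q12 q21 q22 => d *; apply/andP; split; lra.
Qed.

Lemma compact_measurable_plane (C : set (R * R)) : compact C ->
  measurable (C : set (measurableTypeR R * measurableTypeR R)).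
Proof.
move=> cC; have clC : closed C by apply: compact_closed => //; exact: norm_hausdorff.
rewrite -[X in measurable X]setCK; apply: measurableC; apply: open_measurable_plane.
exact: closed_openC.
Qed.

Lemma continuous_translation_L1 (g : R -> R) (M : R) (h_ : nat -> R) : continuous g ->
  (forall x, M < `|x| -> g x = 0) -> (forall n, `|h_ n| <= 1) -> h_ n @[n --> \oo] --> (0 : R) ->
  \int[mu]_x `|g (x + h_ n) - g x| @[n --> \oo] --> (0 : R).
Proof.
move=> cg g0 h1 h0.
pose L := `|M| + 1; have L0 : 0 <= L by rewrite addr_ge0.
have [K K0 hK] := bounded_on_itv cg (ltac:(lra) : - L <= L).
have gK x : `|g x| <= K.
  have [xM|xM] := ltP M `|x|; first by rewrite g0// normr0.
  apply: hK; rewrite -ler_norml; apply: le_trans xM _; apply: le_trans (ler_norm _) _.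
  by rewrite lerDl.
pose D := `[- (L + 1), L + 1]%classic : set (measurableTypeR R).
have mD : measurable D by exact: measurable_itv.
have -> : (0 : R) = \int[mu]_(x in D) cst 0 x by rewrite /Rintegral integral0.
have E n : \int[mu]_x `|g (x + h_ n) - g x| = \int[mu]_(x in D) `|g (x + h_ n) - g x|.
  apply: eq_Rintegral_on => // x; last by move=> nT; exfalso; apply: nT.
  move=> _ nD.
  have xL : L + 1 < `|x|.
    by rewrite ltNge; apply/negP => h; apply: nD; rewrite /D /= in_itv /= -ler_norml.
  have xM : M < `|x| by move: xL (ler_norm M); rewrite /L; lra.
  have hn : `|x| - 1 <= `|x + h_ n|.
    have := ler_normB (x + h_ n) (h_ n); rewrite addrK; have := h1 n; lra.
  rewrite (g0 x xM) (g0 (x + h_ n)) ?subr0 ?normr0//.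
  by move: xL hn (ler_norm M); rewrite /L; lra.
under eq_fun do rewrite E.
apply: (@dominated_cvg_Rintegral R _ (measurableTypeR R) mu D _ _ (cst (K + K))) => //.
- move=> n; apply: measurable_funTS; apply: continuous_measurable_fun => x.
  apply: cvg_norm; apply: cvgB; last exact: cg.
  apply: continuous_comp; last exact: cg.
  by apply: cvgD; [exact: cvg_id|exact: cvg_cst].
- move=> x _; rewrite -[X in _ --> X](normr0 R); apply: cvg_norm.
  rewrite -[X in _ --> X](subrr (g x)); apply: cvgB; last exact: cvg_cst.
  apply: continuous_cvg; first exact: cg.
  rewrite -[X in _ --> X]addr0; apply: cvgD => //; exact: cvg_cst.
- apply: continuous_compact_integrable; first exact: segment_compact.
  by apply: continuous_subspaceT => x; exact: cvg_cst.
- move=> n x _; rewrite normr_id; apply: le_trans (ler_normB _ _) _.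
  by apply: lerD; exact: gK.
Qed.

(** Integrable functions are approximated on a large segment by continuous ones,
    which are then multiplied by a continuous cutoff; the cutoff costs at most the
    tail of f. *)
Lemma compact_approximation (f : R -> R) (e : R) : mu.-integrable setT (EFin \o f) -> 0 < e ->
  exists g M, [/\ continuous g, forall x, M < `|x| -> g x = 0,
    mu.-integrable setT (EFin \o g) & \int[mu]_x `|f x - g x| < e].
Proof.
move=> fi e0; have e2 : 0 < e / 2 by rewrite divr_gt0.
have [M M0 hM] := integrable_tail fi e2.
pose E := `[- (M + 1), M + 1]%classic : set (measurableTypeR R).
have mE : measurable E by exact: measurable_itv.
have muE : (mu E < +oo)%E.
  by rewrite [ltLHS](lebesgue_measure_itv _) /=; case: ifP => _; rewrite ?ltry.
have iE : mu.-integrable E (EFin \o f) by exact: integrableS fi.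
have [g_ [cg gi g0]] := approximation_continuous_integrable mE muE iE.
have [n hn] : exists n, \int[mu]_(z in E) `|f z - g_ n z| < e / 2.
  have /fine_cvgP[_ /cvgrPdist_lt/(_ _ e2)[n _ h]] := g0; exists n.
  by apply: le_lt_trans (h n (leqnn n)); rewrite sub0r normrN; exact: ler_norm.
(* equal to 1 on [- M, M] and to 0 off [- M - 1, M + 1] *)
pose c (x : R) := Num.max 0 (Num.min 1 (M + 1 - `|x|)).
have cc : continuous c.
  have c1 : continuous (fun x : R => M + 1 - `|x|).
    by move=> x; apply: cvgB; [exact: cvg_cst|apply: cvg_norm; exact: cvg_id].
  have c2 : continuous (fun x : R => Num.min 1 (M + 1 - `|x|)).
    by move=> x; exact: (@continuous_min _ _ (fun=> 1) _ x (cvg_cst _) (c1 x)).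
  by move=> x; exact: (@continuous_max _ _ (fun=> 0) _ x (cvg_cst _) (c2 x)).
have c01 x : 0 <= c x <= 1 by rewrite /c le_max lexx /= ge_max ler01 /= ge_min lexx.
have c1 x : `|x| <= M -> c x = 1.
  move=> xM; have h : 1 <= M + 1 - `|x| by lra.
  by rewrite /c (min_idPl h) (max_idPr ler01).
have c0 x : M + 1 < `|x| -> c x = 0.
  move=> xM; apply/max_idPl; rewrite ge_min; apply/orP; right; lra.
have icg : mu.-integrable setT (EFin \o (fun x => c x * g_ n x)).
  have cgn : continuous (fun x => c x * g_ n x) by move=> x; apply: cvgM; [exact: cc|exact: cg].
  have h : mu.-integrable setT (EFin \o ((fun x => c x * g_ n x) \_ E)).
    apply/(restrict_integrable mu) => //.
    by apply: continuous_compact_integrable; [exact: segment_compact|exact: continuous_subspaceT].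
  apply: eq_integrable h => // x _; rewrite /= patchE; case: ifPn => //.
  rewrite notin_setE /E /= in_itv /= -ler_norml => /negP; rewrite -ltNge => xM.
  by rewrite c0// mul0r.
exists (fun x => c x * g_ n x), (M + 1); split.
- by move=> x; apply: cvgM; [exact: cc|exact: cg].
- by move=> x /c0 ->; rewrite mul0r.
- exact: icg.
have mcE : measurable (~` `[- M, M]%classic : set (measurableTypeR R)) by apply: measurableC; exact: measurable_itv.
have mEf := measurable_itv.
have b1 : mu.-integrable setT (EFin \o ((fun x => `|f x - g_ n x|) \_ E)).
  apply/(restrict_integrable mu) => //; exact: (integrable_norm (integrableB mE iE (gi n))).
have b2 : mu.-integrable setT (EFin \o ((fun x => `|f x|) \_ (~` `[- M, M]))).
  by apply/(restrict_integrable mu) => //; apply: integrableS (integrable_norm fi).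
apply: (@le_lt_trans _ _ (\int[mu]_x (((fun x => `|f x - g_ n x|) \_ E) x + ((fun x => `|f x|) \_ (~` `[- M, M])) x))).
  apply: le_Rintegral => //.
  - exact: (integrable_norm (integrableB measurableT fi icg)).
  - exact: (integrableD measurableT b1 b2).
  move=> x _; rewrite !patchE.
  have [xM|xM] := leP `|x| M.
    rewrite c1// mul1r mem_set; last by rewrite /E /= in_itv /= -ler_norml; lra.
    by rewrite lerDl; case: ifP.
  rewrite [X in _ <= _ + X]ifT; last first.
    by apply/mem_set => /=; rewrite in_itv /= -ler_norml => h; move: xM; rewrite ltNge h.
  have [xM1|xM1] := ltP (M + 1) `|x|.
    by rewrite c0// mul0r subr0 lerDr; case: ifP.
  rewrite mem_set; last by rewrite /E /= in_itv /= -ler_norml.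
  have /andP[c0x c1x] := c01 x.
  (* in the transition zone the error is a convex combination of both *)
  rewrite (_ : f x - c x * g_ n x = c x * (f x - g_ n x) + (1 - c x) * f x); last by ring.
  apply: le_trans (ler_normD _ _) _; rewrite !normrM (ger0_norm c0x) (@ger0_norm _ (1 - c x)) ?subr_ge0//.
  apply: lerD; first by rewrite ler_piMl.
  by rewrite ler_piMl// gerBl.
rewrite RintegralD// -[X in X + _]Rintegral_mkcond -[X in _ + X]Rintegral_mkcond.
by rewrite (splitr e); apply: ltrD.
Qed.

Lemma L1_translation_continuous (f : R -> R) (e : R) : mu.-integrable setT (EFin \o f) -> 0 < e ->
  exists2 d : R, 0 < d & forall h, `|h| < d -> \int[mu]_x `|f (x + h) - f x| < e.
Proof.
move=> fi e0; apply: contrapT => nd.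
have /choice[h_ hh] (n : nat) : exists h : R, `|h| < n.+1%:R^-1 /\ e <= \int[mu]_x `|f (x + h) - f x|.
  apply: contrapT => nh; apply: nd; exists n.+1%:R^-1; first by rewrite invr_gt0.
  by move=> h hn; rewrite ltNge; apply/negP => eh; apply: nh; exists h.
have e3 : 0 < e / 3 by rewrite divr_gt0.
have [g [M [cg g0 gi fg]]] := compact_approximation fi e3.
have h1 n : `|h_ n| <= 1.
  by have [/ltW h _] := hh n; apply: le_trans h _; rewrite invf_le1 ?ltr0n// ler1n.
have h0 : h_ n @[n --> \oo] --> (0 : R).
  apply/cvgrPdist_lt => e' e'0; near=> n; rewrite sub0r normrN.
  have [h _] := hh n; apply: lt_trans h _.
  near: n; exact: near_infty_natSinv_lt (PosNum e'0).
have := continuous_translation_L1 cg g0 h1 h0.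
move=> /cvgrPdist_lt/(_ _ e3)[n _ /(_ n (leqnn n))].
rewrite sub0r normrN => hn.
have [_] := hh n; apply/negP; rewrite -ltNge.
set h := h_ n in hn *.
have i1 := integrableB_norm fi gi.
have i2 := integrable_translate h i1.
have i3 := integrableB_norm (integrable_translate h gi) gi.
apply: (@le_lt_trans _ _ (\int[mu]_x (`|f (x + h) - g (x + h)| + (`|g (x + h) - g x| + `|f x - g x|)))).
  apply: le_Rintegral => //.
  - exact: (integrableB_norm (integrable_translate h fi) fi).
  - exact: (integrableD measurableT i2 (integrableD measurableT i3 i1)).
  move=> x _; rewrite (_ : f (x + h) - f x = (f (x + h) - g (x + h)) + ((g (x + h) - g x) - (f x - g x))); last by ring.
  by apply: le_trans (ler_normD _ _) _; rewrite lerD2l; exact: ler_normB.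
rewrite RintegralD//; last exact: (integrableD measurableT i3 i1).
rewrite (RintegralD _ i3 i1)//.
rewrite (Rintegral_translate h i1).
have E : \int[mu]_x `|g (x + h) - g x| < e / 3 by apply: le_lt_trans hn; exact: ler_norm.
by move: fg E; lra.
Unshelve. all: by end_near.
Qed.

End translations.

(** * Travelling waves *)
Lemma cvg_to_zero (R : realType) (T : Type) (N : T -> \bar R) (F : set_system T) : Filter F ->
  (forall t, 0 <= N t)%E -> (forall e : R, 0 < e -> \forall t \near F, (N t <= e%:E)%E) ->
  N t @[t --> F] --> 0%E.
Proof.
move=> FF N0 h; apply/fine_cvgP; split.
  apply: filterS (h 1 ltr01) => t Nt; rewrite ge0_fin_numE//.
  exact: le_lt_trans Nt (ltry _).
apply/cvgrPdist_le => e e0; apply: filterS (h e e0) => t Nt /=.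
rewrite sub0r normrN ger0_norm; last exact: fine_ge0.
by rewrite -lee_fin fineK// ge0_fin_numE//; exact: le_lt_trans Nt (ltry _).
Qed.

Section travelling_wave.
Context {R : realType}.
Notation mu := (@lebesgue_measure R).
Notation mu2 := (mu \x mu)%E.

Lemma measurable_continuous_plane (f : R * R -> R) : continuous f -> measurable_fun setT f.
Proof.
move=> cf; apply: (measurability _ (RGenOInfty.measurableE R)) => _ [_ [r ->] <-].
rewrite setTI; apply: open_measurable_plane; move/continuousP: cf; apply.
exact: interval_open.
Qed.

Lemma bounded_on_compact (f : R * R -> R) (C : set (R * R)) : continuous f -> compact C ->
  exists2 K : R, 0 <= K & forall p, C p -> `|f p| <= K.
Proof.
move=> cf cC.
have /compact_bounded[M [Mr hM]] : compact (f @` C).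
  by apply: continuous_compact => //; exact: continuous_subspaceT.
exists (`|M| + 1); first by rewrite addr_ge0.
move=> p Cp; apply: hM; last by exists p.
by apply: le_lt_trans (ler_norm _) _; rewrite ltrDl.
Qed.

Definition box (T : R) : set (measurableTypeR R * measurableTypeR R) :=
  (`[0, T]%classic : set (measurableTypeR R)) `*` (`[- T, T]%classic : set (measurableTypeR R)).

Lemma measurable_box T : measurable (box T). Proof. exact: measurableX. Qed.

Lemma compact_sub_box (C : set (R * R)) : compact C -> C `<=` @halfplane R ->
  exists2 T : R, 0 < T & forall p, C p -> box T p /\ p.1 < T.
Proof.
move=> /compact_bounded[M [Mr hM]] CH; exists (`|M| + 2); first by rewrite ltr_wpDl.
move=> p Cp.
have pM : `|p| <= `|M| + 1 by apply: hM => //; apply: le_lt_trans (ler_norm _) _; rewrite ltrDl.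
have p1 : `|p.1| <= `|M| + 1 by apply: le_trans pM; rewrite prod_normE /= le_max lexx.
have p2 : `|p.2| <= `|M| + 1 by apply: le_trans pM; rewrite prod_normE /= le_max lexx orbT.
have := CH p Cp; rewrite /halfplane /= => p0.
have := ler_norm p.1; move: p2; rewrite ler_norml => /andP[g1 g2] g3.
by split; [split; rewrite /= in_itv /=; apply/andP; split; lra|lra].
Qed.

Lemma continuous_box_integrable (f : R * R -> R) T : continuous f -> mu2.-integrable (box T) (EFin \o f).
Proof.
move=> cf.
have cb : compact (box T : set (R * R)) by apply: compact_setX; exact: segment_compact.
have [K K0 hK] := bounded_on_compact cf cb.
have c1 (a b : R) : mu.-integrable `[a, b] (EFin \o (cst 1 : R -> R)).
  apply: continuous_compact_integrable; first exact: segment_compact.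
  by apply: continuous_subspaceT => x; exact: cvg_cst.
have i1 := integrable_prodX (measurable_itv _) (measurable_itv _) (c1 0 T) (c1 (- T) T).
have mf : measurable_fun (box T) f by apply: measurable_funTS; exact: measurable_continuous_plane.
have := bounded_mul_integrable (measurable_box T) i1 mf hK.
by apply: eq_integrable => //; [exact: measurable_box|move=> z _; rewrite /= !mulr1].
Qed.

Lemma travelling_integrable (g : R -> R) (c T : R) : mu.-integrable setT (EFin \o g) ->
  mu2.-integrable (box T) (EFin \o (fun p => g (p.2 + c * p.1))).
Proof.
move=> gi; have /integrableP[/measurable_EFinP mg gfin] := gi.
pose A := `[0, T]%classic : set (measurableTypeR R).
have mA : measurable A by exact: measurable_itv.
have mAT : measurable (A `*` setT : set (measurableTypeR R * measurableTypeR R)) by exact: measurableX.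
have mG : measurable_fun setT (fun p : R * R => g (p.2 + c * p.1)).
  apply: (measurableT_comp mg); apply: measurable_funD => //.
  by apply: measurable_funM => //; exact: measurable_cst.
suff h : mu2.-integrable (A `*` setT) (EFin \o (fun p => g (p.2 + c * p.1))).
  apply: integrableS h => //; first exact: measurable_box.
  by move=> p [h1 _].
apply/(restrict_integrable mu2) => //.
have mr : measurable_fun setT ((fun p => g (p.2 + c * p.1)) \_ (A `*` setT)).
  by apply/(measurable_restrictT _ _).1 => //; exact: measurable_funTS.
apply/integrableP; split; first exact/measurable_EFinP.
have mar : measurable_fun setT (fun p => `|(((fun p => g (p.2 + c * p.1)) \_ (A `*` setT)) p)%:E|)%E.
  by apply: measurableT_comp => //; exact/measurable_EFinP.
rewrite (tonelli12 mar (fun z => abse_ge0 _)).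
apply: (@le_lt_trans _ _ (\int[mu]_(t in A) (\int[mu]_x `|(g x)%:E|))%E).
  rewrite [leRHS]integral_mkcond; apply: ge0_le_integral => //.
  - by move=> t _; exact: integral_ge0.
  - exact: (measurable_tonelli1 mar).
  - by apply/(measurable_restrictT _ _).1 => //; exact: measurable_cst.
  move=> t _; rewrite patchE; case: ifPn => tA.
    rewrite le_eqVlt; apply/orP; left; apply/eqP.
    have mga : measurable_fun setT (fun x => `|(g x)%:E|)%E.
      by apply: measurableT_comp => //; exact/measurable_EFinP.
    rewrite [RHS](_ : _ = \int[mu]_x `|(g (x + c * t))%:E|)%E.
      apply: eq_integral => x _; rewrite patchE mem_set//.
      by split => //; exact: set_mem.
    have := @ge0_integral_affine R 1 (c * t) _ (oner_neq0 R) mga (fun x => abse_ge0 _).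
    by rewrite normr1 mul1e => ->; apply: eq_integral => x _; rewrite mul1r.
  rewrite [X in (X <= _)%E](_ : _ = 0%E)//.
  rewrite -[RHS](integral0 mu setT); apply: eq_integral => x _; rewrite patchE memNset; first by rewrite /= /point /= normr0.
  by move=> [/= h _]; move/negP: tA; apply; exact/mem_set.
rewrite integral_cst//.
have muA : mu A = (if 0 < T then T else 0)%:E.
  apply: (etrans (lebesgue_measure_itv _)); rewrite /= lte_fin; case: ifP => //.
  by rewrite oppr0 adde0.
apply: lte_mul_pinfty => //; first exact: integral_ge0.
  by rewrite ge0_fin_numE//; exact: integral_ge0.
by rewrite [ltLHS]muA ltry.
Qed.

Lemma slice_derive (phi : R * R -> R) (t x : R) : derivable phi (t, x) (1, 0) ->
  is_derive t (1 : R) (fun s => phi (s, x)) ('D_((1, 0) : R * R) phi (t, x)).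
Proof.
move=> d.
have E : (fun h : R => h^-1 *: (((fun s => phi (s, x)) \o shift t) (h *: (1 : R)) - phi (t, x))) =
    (fun h : R => h^-1 *: ((phi \o shift (t, x)) (h *: ((1, 0) : R * R)) - phi (t, x))).
  apply/funext => h /=; congr (_ *: (phi _ - _)).
  rewrite [RHS](_ : _ = (h *: (1 : R) + t, h *: (0 : R) + x))//.
  by rewrite scaler0 add0r.
apply: DeriveDef; first by rewrite /derivable E.
by rewrite /derive E.
Qed.

Lemma test_function_vanish (phi : R * R -> R) (e p : R * R) : test_function phi ->
  ~ closure [set p | phi p != 0] p -> phi p = 0 /\ 'D_e phi p = 0.
Proof.
move=> [sphi _ _] np.
have near0 : \forall q \near p, cst 0 q = phi q.
  have : open (~` closure [set p | phi p != 0]) by apply: closed_openC; exact: closed_closure.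
  rewrite openE => /(_ p np); apply: filterS => q nq; apply/esym/eqP.
  by apply: contrapT => /negP h; apply: nq; exact: subset_closure.
split; first by have := nbhs_singleton near0.
by rewrite -(near_eq_derive _ near0)// derive_cst.
Qed.

Lemma primitive_bounded (G g : R -> R) : mu.-integrable setT (EFin \o g) -> is_primitive G g ->
  exists2 B : R, 0 <= B & forall x, `|G x| <= B.
Proof.
move=> gi [_ Gg]; pose N := \int[mu]_x `|g x|.
have gi' : mu.-integrable setT (EFin \o (fun x => `|g x|)) by exact: integrable_norm.
have N0 : 0 <= N by exact: Rintegral_ge0.
have inc a b : a <= b -> `|G b - G a| <= N.
  move=> ab; rewrite Gg//; pose I := `[a, b]%classic : set (measurableTypeR R).
  have mI : measurable I by exact: measurable_itv.
  apply: le_trans (le_normr_Rintegral mI (integrableS measurableT mI (@subsetT _ _) gi)) _.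
  rewrite Rintegral_mkcond; apply: le_Rintegral => //.
    by apply/(restrict_integrable mu) => //; exact: integrableS gi'.
  by move=> x _; rewrite patchE; case: ifP => // _; exact: normr_ge0.
exists (`|G 0| + N); first by rewrite addr_ge0.
move=> x; rewrite -[G x](subrK (G 0)) addrC.
apply: le_trans (ler_normD _ _) _; rewrite lerD2l.
by have [x0|x0] := leP 0 x; [exact: inc|rewrite distrC; apply: inc; exact: ltW].
Qed.

Section profiles.
Variables (n : nat) (G1 G2 g1 g2 : 'I_n -> R -> R).
Hypothesis p1 : forall i, is_primitive (G1 i) (g1 i).
Hypothesis p2 : forall i, is_primitive (G2 i) (g2 i).
Hypothesis i1 : forall i, mu.-integrable setT (EFin \o g1 i).
Hypothesis i2 : forall i, mu.-integrable setT (EFin \o g2 i).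
Variable w wt : R * R -> 'cV[R]_n.
(** Only t >= 0 is assumed: the formula of d'Alembert integrates over the segment
    [x - t, x + t], which is empty for t < 0. *)
Hypothesis wE : forall t x i, 0 <= t -> w (t, x) i ord0 = G1 i (x + t) + G2 i (x - t).
Hypothesis wtE : forall t x i, wt (t, x) i ord0 = g1 i (x + t) - g2 i (x - t).

(** The continuation of the formula to the whole plane, where continuity and
    compactness arguments apply; it agrees with w on the half plane. *)
Let ext i (p : R * R) := G1 i (1 * p.1 + 1 * p.2 + 0) + G2 i (-1 * p.1 + 1 * p.2 + 0).

Let ext_w i p : @halfplane R p -> ext i p = w p i ord0.
Proof.
by case: p => t x t0; rewrite wE// /ext; congr (G1 i _ + G2 i _); rewrite /=; ring.
Qed.

Let ext_continuous i : continuous (ext i).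
Proof.
move=> p; apply: cvgD.
  apply: (@continuous_comp _ _ _ (fun z : R * R => 1 * z.1 + 1 * z.2 + 0) (G1 i)).
    exact: continuous_linear_form.
  exact: is_primitive_continuous (p1 i) _.
apply: (@continuous_comp _ _ _ (fun z : R * R => -1 * z.1 + 1 * z.2 + 0) (G2 i)).
  exact: continuous_linear_form.
exact: is_primitive_continuous (p2 i) _.
Qed.

Let wt_box i T : mu2.-integrable (box T) (EFin \o (fun p => wt p i ord0)).
Proof.
have h1 := travelling_integrable 1 T (i1 i); have h2 := travelling_integrable (-1) T (i2 i).
have mB := measurable_box T; have := integrableB mB h1 h2.
by apply: eq_integrable => // -[t x] _ /=; rewrite wtE mul1r mulN1r.
Qed.

Let on_compact (f : R * R -> R) (C : set (R * R)) : (forall T, mu2.-integrable (box T) (EFin \o f)) ->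
  compact C -> C `<=` @halfplane R -> mu2.-integrable (C : set (measurableTypeR R * measurableTypeR R)) (EFin \o f).
Proof.
move=> fi cC CH; have [T T0 hT] := compact_sub_box cC CH.
apply: integrableS (fi T); [exact: measurable_box|exact: compact_measurable_plane|].
by move=> p /hT[].
Qed.

(** For each x, s |-> G1 (x + s) + G2 (x - s) is a primitive of g1 (x + s) - g2 (x - s), so the
    weak identity is an integration by parts in time for each x; a box
    around the support of the test function makes all integrals finite. *)
Lemma travelling_wave_weak_dt : weak_dt w wt.
Proof.
split.
- move=> C cC CH i.
  have := on_compact (fun T => continuous_box_integrable T (@ext_continuous i)) cC CH.
  apply: eq_integrable; first exact: compact_measurable_plane.
  by move=> p /set_mem/CH pH; rewrite /= ext_w.
- by move=> C cC CH i; apply: on_compact => // T; exact: wt_box.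
move=> phi tphi; have [sphi cphi sub] := tphi; apply/colP => i; rewrite /vint !mxE.
set S := closure _ in cphi sub.
have subH : S `<=` @halfplane R by move=> p /sub /ltW.
have [T T0 hT] := compact_sub_box cphi subH.
pose e : R * R := (1, 0).
have out p : ~ S p -> phi p = 0 /\ 'D_e phi p = 0 by exact: test_function_vanish.
have boxH p : ~ box T p -> ~ S p by move=> nb /hT[].
have [cp _] := sphi [::]; have [cdp _] := sphi [:: e].
have {}cp : continuous phi := cp; have {}cdp : continuous ('D_e phi) := cdp.
have cb : compact (box T : set (R * R)) by apply: compact_setX; exact: segment_compact.
have mB := measurable_box T.
have prod_i (f h : R * R -> R) : continuous h -> mu2.-integrable (box T) (EFin \o f) ->
    mu2.-integrable (box T) (EFin \o (fun p => h p * f p)).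
  move=> ch fi; have [K K0 hK] := bounded_on_compact ch cb.
  apply: (bounded_mul_integrable mB fi _ hK).
  by apply: measurable_funTS; exact: measurable_continuous_plane.
have j1 := prod_i _ _ cdp (continuous_box_integrable T (@ext_continuous i)).
have j2 := prod_i _ _ cp (wt_box i T).
have boxsub p : box T p -> @halfplane R p.
  by move=> [/= h _]; move: h; rewrite in_itv /= => /andP[].
have -> : \int[leb2 R]_(p in @halfplane R) ('D_e phi p *: w p) i ord0 =
    \int[mu2]_(p in box T) ('D_e phi p * ext i p).
  apply: eq_Rintegral_on => p; first by move=> pH _; rewrite mxE ext_w.
    by move=> _ /boxH/out[_ h]; rewrite mxE h mul0r.
  by move=> nH /boxsub.
have -> : \int[leb2 R]_(p in @halfplane R) (phi p *: wt p) i ord0 =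
    \int[mu2]_(p in box T) (phi p * wt p i ord0).
  apply: eq_Rintegral_on => p; first by rewrite mxE.
    by move=> _ /boxH/out[h _]; rewrite mxE h mul0r.
  by move=> nH /boxsub.
rewrite -mulN1r -RintegralZl//.
have j3 : mu2.-integrable (box T) (EFin \o (fun p => -1 * (phi p * wt p i ord0))).
  exact: (integrableZl mB (-1) j2).
rewrite (RfubiniXC (measurable_itv _) (measurable_itv _) j1).
rewrite (RfubiniXC (measurable_itv _) (measurable_itv _) j3).
apply: eq_Rintegral => x _.
have n1 : (1 : R) != 0 by exact: oner_neq0.
have nn1 : (-1 : R) != 0 by rewrite oppr_eq0.
have Gp := is_primitiveD (is_primitive_affine x n1 (p1 i)) (is_primitive_affine x nn1 (p2 i)).
pose A := `[0, T]%classic : set (measurableTypeR R).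
have mA : measurable A by exact: measurable_itv.
have cs (f : R * R -> R) : continuous f -> continuous (fun s : R => f (s, x)).
  move=> cf s; apply: (@continuous_comp _ _ _ (fun s : R => (s, x)) f); last exact: cf.
  by apply: (@cvg_pair _ _ _ (nbhs s) (nbhs s) (nbhs x)); [exact: cvg_id|exact: cvg_cst].
have der s : is_derive s (1 : R) (fun s => phi (s, x)) ('D_e phi (s, x)).
  by apply: slice_derive; have [_ h] := sphi [::]; exact: h.
have end0 : phi (0, x) = 0.
  by have [] := out (0, x) (ltac:(by move=> /sub /=; rewrite ltxx)).
have endT : phi (T, x) = 0.
  by have [] := out (T, x) (ltac:(by move=> /hT[_] /=; rewrite ltxx)).
have := primitive_by_parts (ltW T0) Gp (cs _ cdp) der end0 endT => E.
transitivity (\int[mu]_(s in A) ('D_e phi (s, x) * (G1 i (1 * s + x) + G2 i (-1 * s + x)))).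
  apply: eq_Rintegral => s _; rewrite /ext; congr (_ * (G1 i _ + G2 i _)); rewrite /=; ring.
rewrite [LHS]E -[LHS]mulN1r -[LHS]RintegralZl//.
  apply: eq_Rintegral => s _; rewrite wtE; congr (_ * (_ * _)).
  by rewrite !mul1r !mulN1r (addrC s) (addrC (- s)).
have [K K0 hK] := bounded_on_itv (cs _ cp) (ltW T0).
apply: (bounded_mul_integrable (K := K) mA (Gp.1 0 T)).
  by apply: measurable_funTS; apply: continuous_measurable_fun; exact: cs.
by move=> s; rewrite /A /= in_itv /=; exact: hK.
Qed.

(** Time translations of integrable profiles are continuous in L1 and preserve the
    norm. *)
Lemma travelling_wave_Cb : Cb (vintegrable (leb R) setT) (@L1_norm R n) (curry wt).
Proof.
have wti t : vintegrable mu setT (fun x => wt (t, x)).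
  move=> i; have := integrableB measurableT (integrable_translate t (i1 i)) (integrable_translate (- t) (i2 i)).
  by apply: eq_integrable => // x _; rewrite /= wtE.
split.
- by move=> t _; exact: wti.
- exists (\sum_i (\int[mu]_x `|g1 i x| + \int[mu]_x `|g2 i x|)) => t _.
  apply: le_trans (L1_norm_le (vintegrable_measurable (wti t))) _.
  rewrite -sumEFin; apply: lee_sum => i _.
  have a1 := integrable_translate t (integrable_norm (i1 i)).
  have a2 := integrable_translate (- t) (integrable_norm (i2 i)).
  rewrite -Rintegral_EFin//; last exact: (integrable_norm (wti t i)).
  rewrite lee_fin -(Rintegral_translate t (integrable_norm (i1 i))) -(Rintegral_translate (- t) (integrable_norm (i2 i))).
  rewrite -RintegralD//; apply: le_Rintegral => //.
  + exact: (integrable_norm (wti t i)).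
  + exact: (integrableD measurableT a1 a2).
  + by move=> x _; rewrite /= wtE; exact: ler_normB.
move=> t0 _; apply: cvg_to_zero => [t|e e0]; first exact: Lnorm_ge0.
(* two profiles and at most n + 1 components share the error e *)
pose d := e / (2 * n.+1%:R).
have d0 : 0 < d by rewrite divr_gt0// mulr_gt0.
have near_i (i : 'I_n) : \forall t \near nbhs t0, \int[mu]_x `|g1 i (x + t) - g1 i (x + t0)| <= d /\
    \int[mu]_x `|g2 i (x - t) - g2 i (x - t0)| <= d.
  have [r1 r10 hr1] := L1_translation_continuous (i1 i) d0.
  have [r2 r20 hr2] := L1_translation_continuous (i2 i) d0.
  have tr (f : R -> R) a b : mu.-integrable setT (EFin \o f) ->
      \int[mu]_x `|f (x + a) - f (x + b)| = \int[mu]_x `|f (x + (a - b)) - f x|.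
    move=> fi; have fi' := integrableB_norm (integrable_translate (a - b) fi) fi.
    rewrite -(Rintegral_translate b fi'); apply: eq_Rintegral => x _.
    by congr (`|f _ - _|); ring.
  apply/nbhs_ballP; exists (Num.min r1 r2); first by rewrite /= lt_min r10.
  move=> t; rewrite /ball /= lt_min => /andP[t1 t2]; split.
    by rewrite tr//; apply/ltW/hr1; rewrite distrC.
  rewrite tr//; apply/ltW/hr2; rewrite opprK addrC; exact: t2.
have near_all : \forall t \near nbhs t0, forall i, \int[mu]_x `|g1 i (x + t) - g1 i (x + t0)| <= d /\
    \int[mu]_x `|g2 i (x - t) - g2 i (x - t0)| <= d by exact: filter_forall.
rewrite /within /=; apply: filterS near_all => t ht _.
have mw : forall i, measurable_fun setT (fun x => (curry wt t x - curry wt t0 x) i ord0).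
  move=> i; rewrite (_ : (fun x => _) = (fun x => wt (t, x) i ord0 - wt (t0, x) i ord0)).
    apply: measurable_funB; exact: (vintegrable_measurable (wti _)).
  by apply/funext => x; rewrite !mxE.
apply: le_trans (L1_norm_le mw) _.
apply: (@le_trans _ _ (\sum_(i < n) (d + d)%:E)%E); last first.
  rewrite sumEFin lee_fin sumr_const card_ord -[leLHS]mulr_natl.
  have n1 : n%:R <= n.+1%:R :> R by rewrite ler_nat.
  have -> : e = n.+1%:R * (d + d) by rewrite /d; field.
  by rewrite ler_wpM2r// addr_ge0// ltW.
apply: lee_sum => i _; have [h1 h2] := ht i.
have a1 := integrableB_norm (integrable_translate t (i1 i)) (integrable_translate t0 (i1 i)).
have a2 := integrableB_norm (integrable_translate (- t) (i2 i)) (integrable_translate (- t0) (i2 i)).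
have ai : mu.-integrable setT (EFin \o (fun x => `|(curry wt t x - curry wt t0 x) i ord0|)).
  have := integrableB_norm (wti t i) (wti t0 i).
  by apply: eq_integrable => // x _; rewrite /= !mxE.
rewrite -Rintegral_EFin// lee_fin; apply: le_trans (lerD h1 h2).
rewrite -RintegralD//; apply: le_Rintegral => //; first exact: (integrableD measurableT a1 a2).
move=> x _; rewrite !mxE /curry !wtE.
rewrite (_ : _ - _ = (g1 i (x + t) - g1 i (x + t0)) - (g2 i (x - t) - g2 i (x - t0))); last by ring.
exact: ler_normB.
Qed.

Lemma travelling_wave_Cb_dt : Cb_dt w wt.
Proof. by split; [exact: travelling_wave_weak_dt|exact: travelling_wave_Cb]. Qed.

End profiles.

End travelling_wave.

(** * Slices of an integrable source *)
Section norm_bounds.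
Context {R : realType}.
Notation mu := (@lebesgue_measure R).
Notation mu2 := (mu \x mu)%E.

Lemma Linf_norm_le n (v : R -> 'cV[R]_n) (K : R) : (forall x, `|v x| <= K) ->
  (Linf_norm v <= K%:E)%E.
Proof.
move=> vK; have K0 : 0 <= K by apply: le_trans (vK 0).
rewrite /Linf_norm unlock; case: ifP => _; last by rewrite lee_fin.
by apply/ess_supP; apply: filterE => x; rewrite /= lee_fin normr_id.
Qed.

Lemma L1_normD n (a b : R -> 'cV[R]_n) : vintegrable mu setT a -> vintegrable mu setT b ->
  (L1_norm (fun x => a x + b x)%R <= L1_norm a + L1_norm b)%E.
Proof.
move=> ai bi; rewrite !L1_normE.
have ma := measurable_norm_cV (vintegrable_measurable ai).
have mb := measurable_norm_cV (vintegrable_measurable bi).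
have mab : measurable_fun setT (fun x => `|a x + b x|).
  apply: measurable_norm_cV => i.
  rewrite (_ : (fun x => _) = (fun x => a x i ord0 + b x i ord0)).
    by apply: measurable_funD; exact: vintegrable_measurable.
  by apply/funext => x; rewrite mxE.
rewrite -ge0_integralD//; [|exact/measurable_EFinP|exact/measurable_EFinP].
apply: ge0_le_integral => //.
- exact/measurable_EFinP.
- by apply/measurable_EFinP; exact: measurable_funD.
- by move=> x _; rewrite -EFinD lee_fin; exact: ler_normD.
Qed.

Lemma norm_Rintegral_le (f : R -> R) : measurable_fun setT f ->
  (`|\int[mu]_x f x|%:E <= \int[mu]_x `|f x|%:E)%E.
Proof.
move=> mf; apply: (@le_trans _ _ `|\int[mu]_x (f x)%:E|%E); last first.
  by apply: le_abse_integral => //; exact/measurable_EFinP.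
rewrite /Rintegral; set I := (\int[mu]_x (f x)%:E)%E.
by case: I => [r||] //=; rewrite ?leey ?normr0.
Qed.

Lemma Rintegral_ray (g : R -> R) (r : R) : mu.-integrable setT (EFin \o g) ->
  \int[mu]_s g s = \int[mu]_(s in `]-oo, r]) g s + \int[mu]_(s in `]r, +oo[) g s.
Proof.
move=> gi; rewrite -Rintegral_setU ?itv_setU_setT//.
by apply/disj_setPS => x [/=]; rewrite !in_itv /= andbT => h1 h2; have := lt_le_trans h2 h1; rewrite ltxx.
Qed.

(** A slice integral that diverges has real value 0, so the marginal is
    dominated on every line. *)
Lemma slices_le (f : R * R -> R) : mu2.-integrable setT (EFin \o f) ->
  \int[mu]_x `|\int[mu]_y f (x, y)| <= \int[mu2]_z `|f z| /\
  \int[mu]_y `|\int[mu]_x f (x, y)| <= \int[mu2]_z `|f z|.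
Proof.
move=> fi; have /integrableP[/measurable_EFinP mf _] := fi.
have fa := integrable_norm fi.
have mE : measurable_fun setT (fun z => `|f z|%:E).
  by apply/measurable_EFinP; exact: measurableT_comp.
have E0 z : (0 <= `|f z|%:E)%E by rewrite lee_fin.
have i1 := integrable_norm (integrable_Rfubini1 fi).
have i2 := integrable_norm (integrable_Rfubini2 fi).
split; rewrite -lee_fin !Rintegral_EFin//.
  rewrite (tonelli12 mE E0); apply: ge0_le_integral => //.
  - by have /integrableP[] := i1.
  - exact: (measurable_tonelli1 mE E0).
  - by move=> x _; apply: norm_Rintegral_le; apply: (measurableT_comp mf); exact: measurable_pair1.
rewrite (tonelli21 mE E0); apply: ge0_le_integral => //.
- by have /integrableP[] := i2.
- exact: (measurable_tonelli2 mE E0).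
- by move=> x _; apply: norm_Rintegral_le; apply: (measurableT_comp mf); exact: measurable_pair2.
Qed.

(** Along a time slice x + t and t - x run over the line with unit speed, so both
    slice integrals have the L1 norm of a marginal. *)
Lemma characteristic_slices_le (f : R * R -> R) (t c c' : R) : mu2.-integrable setT (EFin \o f) ->
  let h x := c * \int[mu]_s f (x + t, s) + c' * \int[mu]_s f (s, t - x) in
  mu.-integrable setT (EFin \o h) /\
  (\int[mu]_x `|h x|%:E <= ((`|c| + `|c'|) * \int[mu2]_z `|f z|)%:E)%E.
Proof.
move=> fi h; have [le1 le2] := slices_le fi.
have j1 := integrable_translate t (integrable_Rfubini1 fi).
have [r2 _] := Rintegral_reflect (integrable_Rfubini2 fi).
have j2 : mu.-integrable setT (EFin \o (fun x => \int[mu]_s f (s, t - x))).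
  have := integrable_translate (- t) r2.
  by apply: eq_integrable => // x _; rewrite /= opprD opprK addrC.
have hi : mu.-integrable setT (EFin \o h).
  exact: (integrableD measurableT (integrableZl measurableT c j1) (integrableZl measurableT c' j2)).
split=> //; have hn := integrable_norm hi.
rewrite -(Rintegral_EFin measurableT hn) lee_fin.
have e1 : \int[mu]_x `|\int[mu]_s f (x + t, s)| = \int[mu]_x `|\int[mu]_s f (x, s)|.
  exact: (Rintegral_translate t (integrable_norm (integrable_Rfubini1 fi))).
have e2 : \int[mu]_x `|\int[mu]_s f (s, t - x)| = \int[mu]_x `|\int[mu]_s f (s, x)|.
  have [r3 <-] := Rintegral_reflect (integrable_norm (integrable_Rfubini2 fi)).
  rewrite -(Rintegral_translate (- t) r3); apply: eq_Rintegral => x _.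
  by rewrite opprD opprK addrC.
have k1 := integrable_norm j1; have k2 := integrable_norm j2.
have z1 : mu.-integrable setT (EFin \o (fun x => `|c| * `|\int[mu]_s f (x + t, s)|)).
  exact: (integrableZl measurableT `|c| k1).
have z2 : mu.-integrable setT (EFin \o (fun x => `|c'| * `|\int[mu]_s f (s, t - x)|)).
  exact: (integrableZl measurableT `|c'| k2).
apply: (@le_trans _ _ (\int[mu]_x (`|c| * `|\int[mu]_s f (x + t, s)| + `|c'| * `|\int[mu]_s f (s, t - x)|))).
  apply: le_Rintegral => //; first exact: (integrableD measurableT z1 z2).
  by move=> x _; rewrite -!normrM; exact: ler_normD.
rewrite (RintegralD measurableT z1 z2) (RintegralZl _ measurableT k1) (RintegralZl _ measurableT k2).
rewrite [\int[mu]_x `|_|]e1 [X in _ + _ * X]e2 mulrDl.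
by apply: lerD; apply: ler_wpM2l => //; exact: normr_ge0.
Qed.

Lemma integral_sumgt_vanishing (f : R * R -> R) (e : R) : mu2.-integrable setT (EFin \o f) -> 0 < e ->
  exists c : R, forall r, c <= r -> \int[mu2]_z `|(f \_ (sumgt r)) z| < e.
Proof.
move=> fi e0; have fa := integrable_norm fi.
have mA (k : nat) : measurable (sumgt k%:R : set (R * R)) by exact: measurable_sum_gt.
have A0 (z : R * R) : \forall k \near \oo, ~ (sumgt k%:R : set (R * R)) z.
  have [N hN] : exists N : nat, z.1 + z.2 <= N%:R.
    exists (Num.bound `|z.1 + z.2|); apply: le_trans (ler_norm _) _.
    exact: (ltW (archi_boundP (normr_ge0 _))).
  exists N => // k /= Nk; rewrite /sumgt /=; apply/negP; rewrite -leNgt.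
  by apply: le_trans hN _; rewrite ler_nat.
have [N _ hN] := integral_vanishing_sets fi mA A0 e0.
exists N%:R => r Nr; apply: le_lt_trans (hN N _); last exact: leqnn.
rewrite [leRHS]Rintegral_mkcond; apply: le_Rintegral => //.
- apply: integrable_norm; apply/(restrict_integrable mu2); first exact: measurable_sum_gt.
  by apply: integrableS fi => //; exact: measurable_sum_gt.
- apply/(restrict_integrable mu2); first exact: mA.
  by apply: integrableS fa => //; exact: mA.
move=> z _; rewrite !patchE; case: ifPn => [/set_mem zr|_].
  by rewrite mem_set// /sumgt /=; apply: le_lt_trans zr.
by rewrite normr0; case: ifP.
Qed.

End norm_bounds.

(** * Cauchy data of a pair of profiles *)
Section profile_data.
Context {R : realType}.
Notation mu := (@lebesgue_measure R).
Variables (n : nat) (G1 G2 g1 g2 : 'I_n -> R -> R).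
Hypothesis p1 : forall i, is_primitive (G1 i) (g1 i).
Hypothesis p2 : forall i, is_primitive (G2 i) (g2 i).
Hypothesis i1 : forall i, mu.-integrable setT (EFin \o g1 i).
Hypothesis i2 : forall i, mu.-integrable setT (EFin \o g2 i).

(** Data whose free evolution is G1 (x + t) + G2 (x - t), when g1 and g2 are densities of
    G1 and G2. *)
Definition profile_position x : 'cV[R]_n := \col_i (G1 i x + G2 i x).
Definition profile_velocity x : 'cV[R]_n := \col_i (g1 i x - g2 i x).

Let position_primitive i : is_primitive (fun x => profile_position x i ord0) (fun x => g1 i x + g2 i x).
Proof.
by have := is_primitiveD (p1 i) (p2 i); congr is_primitive; apply/funext => x; rewrite mxE.
Qed.

Lemma profile_L11 : L11 profile_position profile_velocity.
Proof.
split; last first.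
  move=> i; have := integrableB measurableT (i1 i) (i2 i).
  by apply: eq_integrable => // x _; rewrite /= mxE.
have /choice[B hB] (i : 'I_n) : exists B : R, forall x, `|profile_position x i ord0| <= B.
  have [|B _ h] := primitive_bounded _ (position_primitive i); last by exists B.
  exact: (integrableD measurableT (i1 i) (i2 i)).
split.
  apply: (@le_lt_trans _ _ (\sum_i B i)%:E); last by rewrite ltry.
  apply: Linf_norm_le => x; apply: le_trans (ler_norm_cV _) _.
  by apply: ler_sum => i _; exact: hB.
split; first exact: loc_abs_continuous_primitive position_primitive.
move=> i; apply: (@ae_eq_integrable _ _ _ mu setT (EFin \o (fun x => g1 i x + g2 i x))) => //.
- apply/measurable_EFinP; apply: measurable_derive1 => j.
  exact: is_primitive_continuous (position_primitive j).
- by apply: ae1S (derive1_components position_primitive) => x h _; rewrite /= h.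
- exact: (integrableD measurableT (i1 i) (i2 i)).
Qed.

(** G1 - G2 is a primitive of the velocity, so its increments pair with the half sums of
    G1 + G2. *)
Lemma dAlembert_profile t x i : 0 <= t ->
  dAlembert profile_position profile_velocity (t, x) i ord0 = G1 i (x + t) + G2 i (x - t).
Proof.
move=> t0; have Np := is_primitiveD (p1 i) (is_primitiveZ (-1) (p2 i)).
have tt : x - t <= x + t by lra.
rewrite /dAlembert !mxE.
have -> : \int[leb R]_(s in `[x - t, x + t]) profile_velocity s i ord0 =
    \int[mu]_(s in `[x - t, x + t]) (g1 i s + -1 * g2 i s).
  by apply: eq_Rintegral => s _; rewrite mxE mulN1r.
by rewrite -Np.2//; field.
Qed.

End profile_data.

(** * The scattering state *)
Section scattering.
Context {R : realType}.
Notation mu := (@lebesgue_measure R).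
Notation mu2 := (mu \x mu)%E.
Notation lray x := (`]-oo, x]%classic : set (measurableTypeR R)).
Notation rray x := (`]x, +oo[%classic : set (measurableTypeR R)).
Variables (n : nat) (u0 v0 : R -> 'cV[R]_n) (F u ut ux : R * R -> 'cV[R]_n).
Hypothesis data : L11 u0 v0.
Hypotheses (wt : weak_dt u ut) (wx : weak_dx u ux).
Hypothesis mild : forall t x, 0 <= t -> vintegrable (leb2 R) (backward_triangle t x) F /\
  u (t, x) = dAlembert u0 v0 (t, x) + 2^-1 *: vint (leb R) `[0, t]%classic (fun tau =>
    vint (leb R) `[x - t + tau, x + t - tau]%classic (fun y => F (tau, y))).
Hypothesis uH : in_H u ut.
Hypothesis Phii : forall i, mu2.-integrable setT (EFin \o source F i).

Local Notation Phi := (source F).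
Local Notation mass := (mass v0).

(** The past quadrant with corner (xi, sigma) is, up to the future quadrant, a half
    plane in xi plus a half plane in sigma minus the plane.  The first is
    attributed to the wave of argument x + t; the other two to the wave of argument
    x - t = - sigma. *)
Definition left_profile i x := 2^-1 * (u0 x i ord0 + mass i x)
  + 4^-1 * \int[mu2]_(z in lray x `*` setT) Phi i z.
Definition left_density i x := 2^-1 * (derive1 u0 x i ord0 + v0 x i ord0)
  + 4^-1 * \int[mu]_s Phi i (x, s).
Definition right_profile i x := 2^-1 * (u0 x i ord0 - mass i x)
  + 4^-1 * (\int[mu2]_(z in setT `*` lray (- x)) Phi i z - \int[mu2]_z Phi i z).
Definition right_density i x := 2^-1 * (derive1 u0 x i ord0 - v0 x i ord0)
  - 4^-1 * \int[mu]_s Phi i (s, - x).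

Let u0p := u0_primitive data wt wx mild.

Lemma left_primitive i : is_primitive (left_profile i) (left_density i).
Proof.
have h1 := is_primitiveZ 2^-1 (is_primitiveD (u0p i) (mass_primitive data i)).
have h2 := is_primitiveZ 4^-1 (is_primitive_plane1 measurableT (Phii i)).
exact: is_primitiveD h1 h2.
Qed.

Lemma right_primitive i : is_primitive (right_profile i) (right_density i).
Proof.
have n1 : (-1 : R) != 0 by rewrite oppr_eq0 oner_eq0.
have h1 := is_primitiveZ 2^-1 (is_primitiveD (u0p i) (is_primitiveZ (-1) (mass_primitive data i))).
have h2 := is_primitive_affine 0 n1 (is_primitive_plane2 measurableT (Phii i)).
have h3 := is_primitiveZ 4^-1 (is_primitive_shift (- \int[mu2]_z Phi i z) h2).
have := is_primitiveD h1 h3.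
by congr is_primitive; apply/funext => x; rewrite /right_profile /right_density !mulN1r addr0 ?mulrN.
Qed.

Lemma left_density_integrable i : mu.-integrable setT (EFin \o left_density i).
Proof.
have h1 := integrableZl measurableT 2^-1 (integrableD measurableT (du0_integrable data i) (v0_integrable data i)).
have h2 := integrableZl measurableT 4^-1 (integrable_Rfubini1 (Phii i)).
exact: (integrableD measurableT h1 h2).
Qed.

Lemma right_density_integrable i : mu.-integrable setT (EFin \o right_density i).
Proof.
have h1 := integrableZl measurableT 2^-1 (integrableB measurableT (du0_integrable data i) (v0_integrable data i)).
have [h _] := Rintegral_reflect (integrable_Rfubini2 (Phii i)).
have h2 := integrableZl measurableT 4^-1 h.
exact: (integrableB measurableT h1 h2).
Qed.

Local Notation u0bar := (profile_position left_profile right_profile).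
Local Notation v0bar := (profile_velocity left_density right_density).
Local Notation uL := (dAlembert u0bar v0bar).
Definition uLt (p : R * R) : 'cV[R]_n := \col_i (left_density i (p.2 + p.1) - right_density i (p.2 - p.1)).

(** The asymptotic state is a sum of two profiles by construction of its data. *)
Lemma uL_component t x i : 0 <= t -> uL (t, x) i ord0 = left_profile i (x + t) + right_profile i (x - t).
Proof. exact: (dAlembert_profile left_primitive right_primitive). Qed.

Lemma uL_Cb_dt : Cb_dt uL uLt.
Proof.
apply: (travelling_wave_Cb_dt left_primitive right_primitive left_density_integrable right_density_integrable).
  by move=> t x i; exact: uL_component.
by move=> t x i; rewrite mxE.
Qed.

(** What the asymptotic free wave misses is the source in the future quadrant. *)
Lemma remainder_component t x i : 0 <= t -> (u (t, x) - uL (t, x)) i ord0 =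
  4^-1 * \int[mu2]_(z in rray (x + t) `*` rray (t - x)) Phi i z.
Proof.
move=> t0; rewrite mxE mxE uL_component// (mild_component data mild)// (cone_complement _ _ (Phii i)).
rewrite /left_profile /right_profile opprB; ring.
Qed.

(** The source above the line xi + sigma = 2t, that is, after time t.  It contains all
    the future quadrants with corner on the slice t. *)
Definition late i t := (Phi i) \_ (sumgt (2 * t)).

Lemma late_integrable i t : mu2.-integrable setT (EFin \o late i t).
Proof.
apply/(restrict_integrable mu2); first exact: measurable_sum_gt.
by apply: integrableS (Phii i) => //; exact: measurable_sum_gt.
Qed.

Definition late_mass t := \sum_i \int[mu2]_z `|late i t z|.

Lemma remainder_Linf t : 0 <= t -> (Linf_norm (fun x => (u (t, x) - uL (t, x))%R) <= (late_mass t)%:E)%E.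
Proof.
move=> t0; apply: Linf_norm_le => x; apply: le_trans (ler_norm_cV _) _.
apply: ler_sum => i _; rewrite remainder_component// normrM.
have mC : measurable (rray (x + t) `*` rray (t - x)) by exact: measurableX.
have -> : \int[mu2]_(z in rray (x + t) `*` rray (t - x)) Phi i z =
    \int[mu2]_(z in rray (x + t) `*` rray (t - x)) late i t z.
  apply: eq_Rintegral => z /set_mem[/=]; rewrite !in_itv /= !andbT => h1 h2.
  by rewrite /late patchE mem_set// /sumgt /=; lra.
have li := late_integrable i t.
have h : `|\int[mu2]_(z in rray (x + t) `*` rray (t - x)) late i t z| <= \int[mu2]_z `|late i t z|.
  apply: le_trans (le_normr_Rintegral mC (integrableS measurableT mC (@subsetT _ _) li)) _.
  rewrite Rintegral_mkcond; apply: le_Rintegral => //.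
  - apply/(restrict_integrable mu2) => //; apply: integrableS (integrable_norm li) => //.
  - exact: (integrable_norm li).
  - by move=> z _; rewrite patchE; case: ifP => // _; exact: normr_ge0.
rewrite ger0_norm ?invr_ge0//; apply: le_trans h; rewrite ler_piMl// invf_le1 ?ler1n//.
Qed.

(** Each of the two derivatives of the remainder is a combination of the two
    slices of the late source, with coefficients 1/4 or -1/4. *)
Lemma slices_L1 t (c c' : R) (g : R -> 'cV[R]_n) : `|c| = 4^-1 -> `|c'| = 4^-1 ->
  (forall i, measurable_fun setT (fun x => g x i ord0)) ->
  {ae mu, forall x, forall i, g x i ord0 = c * \int[mu]_r late i t (x + t, r)
    + c' * \int[mu]_r late i t (r, t - x)} ->
  (L1_norm g <= (late_mass t)%:E)%E.
Proof.
move=> c4 c4' mg gE; apply: le_trans (L1_norm_le mg) _; rewrite /late_mass -sumEFin.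
apply: lee_sum => i _.
have [hi hle] := characteristic_slices_le t c c' (late_integrable i t).
have -> : (\int[mu]_x `|g x i ord0|%:E = \int[mu]_x `|c * \int[mu]_r late i t (x + t, r)
    + c' * \int[mu]_r late i t (r, t - x)|%:E)%E.
  apply: ae_eq_integral => //.
  - by apply/measurable_EFinP; apply: measurableT_comp => //; exact: mg.
  - by have /integrableP[] := integrable_norm hi.
  - by apply: ae1S gE => x -> _.
apply: le_trans hle _; rewrite lee_fin c4 c4'.
have I0 : 0 <= \int[mu2]_z `|late i t z| by exact: Rintegral_ge0.
by rewrite ler_piMl//; lra.
Qed.

(** Differentiating the remainder rather than the asymptotic state: its density is
    known from the sliding corner of the future quadrant. *)
Lemma remainder_dx t : 0 <= t ->
  (L1_norm (fun x => (derive1 (fun y => u (t, y)) x - derive1 (fun y => uL (t, y)) x)%R)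
    <= (late_mass t)%:E)%E.
Proof.
move=> t0.
have pu i := u_slope data wt wx mild i t0.
have pL i : is_primitive (fun x => uL (t, x) i ord0) (fun x => slope u0 v0 F i t x
    + - 4^-1 * (\int[mu]_s late i t (s, t - x) - \int[mu]_s late i t (x + t, s))).
  have := is_primitiveD (pu i) (is_primitiveZ (- 4^-1) (future_cone_primitive t (Phii i))).
  congr is_primitive; apply/funext => x.
  have := remainder_component x i t0; rewrite mxE mxE => h.
  by rewrite mulNr -h; ring.
have n4 : `|- 4^-1| = 4^-1 :> R by rewrite normrN ger0_norm.
have p4 : `|4^-1| = 4^-1 :> R by rewrite ger0_norm.
apply: (slices_L1 n4 p4).
  move=> i; rewrite (_ : (fun x => _) = (fun x => derive1 (fun y => u (t, y)) x i ord0 - derive1 (fun y => uL (t, y)) x i ord0)).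
    apply: measurable_funB; apply: measurable_derive1 => j.
      exact: is_primitive_continuous (pu j).
    exact: is_primitive_continuous (pL j).
  by apply/funext => x; rewrite !mxE.
apply: ae1S2 (derive1_components pu) (derive1_components pL) => x h1 h2 i.
by rewrite mxE mxE h1 h2; ring.
Qed.

(** Only almost every slice of the source is integrable, so it can be split at time t
    only there. *)
Lemma late_slice1 i : {ae mu, forall x, forall t,
  \int[mu]_s late i t (x, s) = \int[mu]_s Phi i (x, s) - \int[mu]_(s in lray (2 * t - x)) Phi i (x, s)}.
Proof.
apply: ae1S (ae_integrable1 (Phii i)) => x xi t.
rewrite (Rintegral_ray (2 * t - x) xi) addrAC subrr add0r.
apply: eq_Rintegral_on => s //=; rewrite in_itv /= andbT.
  by move=> _ h; rewrite /late patchE mem_set// /sumgt /=; lra.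
by move=> _ h; rewrite /late patchE memNset// /sumgt /= => h'; apply: h; lra.
Qed.

Lemma late_slice2 i : {ae mu, forall y, forall t,
  \int[mu]_s late i t (s, y) = \int[mu]_s Phi i (s, y) - \int[mu]_(s in lray (2 * t - y)) Phi i (s, y)}.
Proof.
apply: ae1S (ae_integrable2 (Phii i)) => y yi t.
rewrite (Rintegral_ray (2 * t - y) yi) addrAC subrr add0r.
apply: eq_Rintegral_on => s //=; rewrite in_itv /= andbT.
  by move=> _ h; rewrite /late patchE mem_set// /sumgt /=; lra.
by move=> _ h; rewrite /late patchE memNset// /sumgt /= => h'; apply: h; lra.
Qed.

Let ut_integrable t : 0 <= t -> vintegrable mu setT (fun x => ut (t, x)).
Proof. by have [_ [_ [h _ _]]] := uH; exact: h. Qed.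

Let uLt_integrable t : 0 <= t -> vintegrable mu setT (fun x => uLt (t, x)).
Proof. by have [_ [h _ _]] := uL_Cb_dt; exact: h. Qed.

Let vintegrableB (a b : R -> 'cV[R]_n) : vintegrable mu setT a -> vintegrable mu setT b ->
  vintegrable mu setT (fun x => a x - b x).
Proof.
move=> ai bi i; have := integrableB measurableT (ai i) (bi i).
by apply: eq_integrable => // x _; rewrite /= !mxE.
Qed.

(** The time derivative of u is determined by the representation formula at almost
    every point of almost every slice, since it is only a weak derivative. *)
Lemma remainder_dt_ae : {ae mu, forall t, 0 < t ->
  (L1_norm (fun x => (ut (t, x) - uLt (t, x))%R) <= (late_mass t)%:E)%E}.
Proof.
have h1 := ae2_fin (fun i => ae2_fst (late_slice1 i)).
have h2 := ae2_fin (fun i => ae2_snd (late_slice2 i)).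
have h3 := ae_section1 (ae2_hc (ae2_and h1 h2)).
apply: ae1S2 (ae_ut data wt wx mild) h3 => t hu hs t0.
have n4 : `|- 4^-1| = 4^-1 :> R by rewrite normrN ger0_norm.
apply: (slices_L1 n4 n4).
  exact: vintegrable_measurable (vintegrableB (ut_integrable (ltW t0)) (uLt_integrable (ltW t0))).
apply: ae1S2 hu hs => x /(_ t0) hx [/= s1 s2] i.
rewrite mxE mxE hx mxE s1 s2 /P_of /Q_of /incoming0 /outgoing0 /left_density /right_density /=.
have -> : 2 * t - (x + t) = t - x by ring.
have -> : 2 * t - (t - x) = x + t by ring.
by rewrite !opprB; field.
Qed.

Lemma Cb_near (g : R -> R -> 'cV[R]_n) (X : set (R -> 'cV[R]_n)) t0 (e : R) :
  Cb X (@L1_norm R n) g -> 0 < t0 -> 0 < e ->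
  exists2 d, 0 < d & forall t, t0 < t < t0 + d -> (L1_norm (fun x => g t x - g t0 x)%R < e%:E)%E.
Proof.
move=> [_ _ cg] t00 e0.
have nb : nbhs (0 : \bar R)%E [set y | (y < e%:E)%E].
  by apply: open_nbhs_nbhs; split; [exact: open_ereal_lt_ereal|rewrite /= lte_fin].
have := cg t0 (ltW t00) _ nb; rewrite /within /= => /nbhs_ballP[d /= d0 hd].
exists d => // t /andP[t1 t2]; apply: hd; last by rewrite /=; exact: ltW (lt_trans t00 t1).
by rewrite /ball /= ltr0_norm ?subr_lt0//; lra.
Qed.

(** Both time derivatives are continuous in time with values in L1, and there are
    arbitrarily close later times at which the bound on almost every slice holds. *)
Lemma remainder_dt t0 (e : R) : 0 < t0 -> 0 < e -> (forall t, t0 <= t -> late_mass t <= e) ->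
  (L1_norm (fun x => (ut (t0, x) - uLt (t0, x))%R) <= (e + e + e)%:E)%E.
Proof.
move=> t00 e0 he.
have [_ [_ cu]] := uH; have [_ cL] := uL_Cb_dt.
have [d1 d10 hd1] := Cb_near cu t00 e0; have [d2 d20 hd2] := Cb_near cL t00 e0.
pose d := Num.min d1 d2; have d0 : 0 < d by rewrite lt_min d10.
have td : t0 < t0 + d by rewrite ltrDl.
have [t /andP[t1 t2] ht] := ae1_ex td remainder_dt_ae.
have tp : 0 < t := lt_trans t00 t1.
have tn1 : t0 < t < t0 + d1 by rewrite t1 (lt_le_trans t2)// lerD2l ge_min lexx.
have tn2 : t0 < t < t0 + d2 by rewrite t1 (lt_le_trans t2)// lerD2l ge_min lexx orbT.
have E : (fun x => ut (t0, x) - uLt (t0, x)) = (fun x => ((ut (t, x) - uLt (t, x))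
    + (uLt (t, x) - uLt (t0, x))) + (ut (t0, x) - ut (t, x))).
  by apply/funext => x; apply/colP => i; rewrite !mxE; ring.
have I0 := ut_integrable (ltW t00); have I1 := uLt_integrable (ltW t00).
have J0 := ut_integrable (ltW tp); have J1 := uLt_integrable (ltW tp).
have K1 := vintegrableB J0 J1; have K2 := vintegrableB J1 I1; have K3 := vintegrableB I0 J0.
have K12 : vintegrable mu setT (fun x => (ut (t, x) - uLt (t, x)) + (uLt (t, x) - uLt (t0, x))).
  move=> i; have := integrableD measurableT (K1 i) (K2 i).
  by apply: eq_integrable => // x _; rewrite /= !mxE.
rewrite E; apply: le_trans (L1_normD K12 K3) _; rewrite !EFinD; apply: leeD.
  apply: le_trans (L1_normD K1 K2) _; apply: leeD.
    by apply: le_trans (ht tp) _; rewrite lee_fin; exact/he/ltW.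
  exact: ltW (hd2 t tn2).
rewrite [leLHS](_ : _ = L1_norm (fun x => curry ut t x - curry ut t0 x)).
  exact: ltW (hd1 t tn1).
by rewrite !L1_normE; apply: eq_integral => x _; rewrite /curry distrC.
Qed.

Lemma late_mass_vanishing (e : R) : 0 < e -> exists c : R, forall t, c <= t -> late_mass t <= e.
Proof.
move=> e0; have d0 : 0 < e / n.+1%:R by rewrite divr_gt0.
have /choice[c hc] (i : 'I_n) : exists c : R, forall r, c <= r ->
    \int[mu2]_z `|(Phi i \_ (sumgt r)) z| < e / n.+1%:R.
  exact: integral_sumgt_vanishing (Phii i) d0.
exists (\sum_i `|c i|) => t ct; rewrite /late_mass.
apply: (@le_trans _ _ (\sum_(i < n) e / n.+1%:R)).
  apply: ler_sum => i _; apply: ltW; rewrite /late; apply: hc.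
  have ci : `|c i| <= \sum_i `|c i| by rewrite [leRHS](bigD1 i)//= lerDl sumr_ge0.
  have := ler_norm (c i); have := normr_ge0 (c i); lra.
rewrite sumr_const card_ord -[leLHS]mulr_natl mulrCA ler_piMr//; first exact: ltW.
by rewrite ler_pdivrMr// mul1r ler_nat.
Qed.

Lemma scattering : (Linf_norm (fun x => u (t, x) - uL (t, x))%R
   + L1_norm (fun x => derive1 (fun y => u (t, y)) x - derive1 (fun y => uL (t, y)) x)%R
   + L1_norm (fun x => ut (t, x) - uLt (t, x))%R)%E @[t --> +oo] --> 0%E.
Proof.
apply: cvg_to_zero => [t|e e0].
  by rewrite !adde_ge0// Lnorm_ge0.
have d0 : 0 < e / 5 by rewrite divr_gt0.
have [c hc] := late_mass_vanishing d0.
apply: filterS (nbhs_pinfty_gt (num_real (Num.max c 0))) => t; rewrite gt_max => /andP[ct t0].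
have L : late_mass t <= e / 5 by exact: hc (ltW ct).
have Le : ((late_mass t)%:E <= (e / 5)%:E)%E by rewrite lee_fin.
(* one fifth each for the first two norms, three fifths for the time derivatives *)
have e5 : e = e / 5 + e / 5 + (e / 5 + e / 5 + e / 5) by field.
rewrite [X in (_ <= X%:E)%E]e5 !EFinD; apply: leeD; first apply: leeD.
- exact: le_trans (remainder_Linf (ltW t0)) Le.
- exact: le_trans (remainder_dx (ltW t0)) Le.
- apply: le_trans (remainder_dt t0 d0 _) _; last by rewrite !EFinD.
  by move=> s ts; apply: hc; exact: le_trans (ltW ct) ts.
Qed.

End scattering.

Theorem theorem5p13 (R : realType) (n : nat)
    (Gamma : 'I_n -> 'I_n -> 'cV[R]_n -> 'cV[R]_n) (P : 'cV[R]_n -> 'M[R]_n)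
    (Gamma_bounded : forall j k, [bounded Gamma j k y | y in setT])
    (Gamma_lipschitz : forall j k, lipschitz (Gamma j k))
    (P_bounded : [bounded P y | y in setT])
    (P_lipschitz : lipschitz P)
    (u0 v0 : R -> 'cV[R]_n) (data_L11 : L11 u0 v0)
    (f : R * R -> 'cV[R]_n) (f_L1 : vintegrable (leb2 R) (@halfplane R) f)
    (u ut ux : R * R -> 'cV[R]_n) (u_H : in_H u ut)
    (u_mild : mild_solution Gamma P u0 v0 f u ut ux) :
  exists (u0bar v0bar : R -> 'cV[R]_n),
    L11 u0bar v0bar /\
    let uL := dAlembert u0bar v0bar in
    exists uLt : R * R -> 'cV[R]_n,
      Cb_dt uL uLt /\
      (Linf_norm (fun x => u (t, x) - uL (t, x))%R
       + L1_norm (fun x => derive1 (fun y => u (t, y)) x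
                           - derive1 (fun y => uL (t, y)) x)%R
       + L1_norm (fun x => ut (t, x) - uLt (t, x))%R)%E @[t --> +oo] --> 0%E.
Proof.
have [_ wt wx mild] := u_mild.
have [K K0 NK] := nonlinearity_bound Gamma_bounded P_bounded.
have Phii := source_integrable data_L11 wt wx mild f_L1 u_H K0 (NK f u ut ux).
have pl := left_primitive data_L11 wt wx mild Phii.
have pr := right_primitive data_L11 wt wx mild Phii.
have il := left_density_integrable data_L11 Phii.
have ir := right_density_integrable data_L11 Phii.
eexists; eexists; split; first exact: (profile_L11 pl pr il ir).
eexists; split; first exact: (uL_Cb_dt data_L11 wt wx mild Phii).
have S := scattering data_L11 wt wx mild u_H Phii; exact: S.
Qed.
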